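(* Let $\beta\in\mathbb{C}$ with $|\beta|=1$ and $\beta^n\neq 1$ for all $n\in\mathbb{N}$. Let $m\in\mathrm{Hol}(\mathbb{D})$ be such that $m(z_0)=0$ for some $z_0\in\mathbb{D}$. Consider $T:\mathrm{Hol}(\mathbb{D})\to\mathrm{Hol}(\mathbb{D})$ given by $(Tf)(z)=m(z)f(\beta z)$, $z\in\mathbb{D}$. Then $\sigma_W(T)=\{\lambda\in\mathbb{C}:|\lambda|\leq M_1\}$ if $M_1<\infty$, and $\sigma_W(T)=\mathbb{C}$ if $M_1=\infty$.
   Context: $\mathbb{D}$ is the open unit disc and $\mathrm{Hol}(\mathbb{D})$ is the Fréchet space of holomorphic functions on $\mathbb{D}$ with the topology of uniform convergence on compact subsets, given by the seminorms $\|f\|_{A(r\mathbb{D})}=\sup_{|z|\leq r}|f(z)|$, $0<r<1$. For a continuous linear operator $T$ on $\mathrm{Hol}(\mathbb{D})$, $\rho(T)$ is the set of $\lambda\in\mathbb{C}$ with $\lambda\mathrm{Id}-T$ bijective, and $R_\lambda=(\lambda\mathrm{Id}-T)^{-1}$ for $\lambda\in\rho(T)$. The Waelbroeck resolvent set $\rho_W(T)$ is the set of $\lambda\in\rho(T)$ for which there is $\delta>0$ with $\overline{D}(\lambda,\delta)\subset\rho(T)$ and $\sup_{|\mu-\lambda|\leq\delta}\|R_\mu f\|_{A(r\mathbb{D})}<\infty$ for all $f\in\mathrm{Hol}(\mathbb{D})$ and all $0<r<1$; the Waelbroeck spectrum is $\sigma_W(T)=\mathbb{C}\setminus\rho_W(T)$.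 For $0<r<1$, $M_r:=\exp\left(\frac{1}{2\pi}\int_0^{2\pi}\log|m(re^{it})|\,dt\right)$, and $M_1:=\sup_{0<r<1}M_r\in[0,\infty]$. *)

(* Defs.v *)
From HB Require Import structures.
From mathcomp Require Import all_boot all_order all_algebra.
From mathcomp Require Import all_classical all_reals all_analysis.
From mathcomp Require Import complex.
Set Implicit Arguments. Unset Strict Implicit. Unset Printing Implicit Defensive.
Import Order.TTheory GRing.Theory Num.Theory.
Local Open Scope ring_scope.
Local Open Scope classical_set_scope.

Notation normc := ComplexField.Normc.normc.
Section Defs.
Variable R : realType.
Local Notation C := R[i].
Local Notation normc := (@ComplexField.Normc.normc R).

Definition inD (z : C) : Prop := normc z < 1.

Definition holD (f : C -> C) : Prop :=
  forall z, inD z -> exists l : C, forall eps : R, 0 < eps ->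
    exists2 delta : R, 0 < delta & forall w : C,
      0 < normc (w - z) < delta ->
      normc ((f w - f z) / (w - z) - l) < eps.

(* Operators on Hol(D) are modelled as maps (C -> C) -> (C -> C);
   elements of Hol(D) are identified when they agree on D. *)

Definition resolvent_set (T : (C -> C) -> (C -> C)) (lam : C) : Prop :=
  (forall g, holD g -> exists f, holD f /\
       forall z, inD z -> lam * f z - T f z = g z) /\
  (forall f1 f2, holD f1 -> holD f2 ->
     (forall z, inD z -> lam * f1 z - T f1 z = lam * f2 z - T f2 z) ->
     forall z, inD z -> f1 z = f2 z).

(* lambda \in rho_W(T): Waelbroeck resolvent set.  The condition
   sup_{|mu - lam| <= delta} ||R_mu g||_{A(rD)} < oo is written out:
   R_mu g is the (unique on D) holomorphic f with (mu Id - T) f = g. *)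
Definition waelbroeck_resolvent_set (T : (C -> C) -> (C -> C)) (lam : C)
    : Prop :=
  resolvent_set T lam /\
  exists2 delta : R, 0 < delta &
    (forall mu : C, normc (mu - lam) <= delta -> resolvent_set T mu) /\
    (forall g, holD g -> forall r : R, 0 < r < 1 ->
       exists B : R, forall mu : C, normc (mu - lam) <= delta ->
         forall f, holD f -> (forall z, inD z -> mu * f z - T f z = g z) ->
         forall z, normc z <= r -> normc (f z) <= B).

Definition waelbroeck_spectrum (T : (C -> C) -> (C -> C)) : set C :=
  [set lam | ~ waelbroeck_resolvent_set T lam].

Definition polar (r t : R) : C := Complex (r * cos t) (r * sin t).

Definition logabs (m : C -> C) (r : R) (t : R) : \bar R :=
  if m (polar r t) == 0 then -oo%E else (ln (normc (m (polar r t))))%:E.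

Definition Mr (m : C -> C) (r : R) : \bar R :=
  match (\int[lebesgue_measure]_(t in `[0%R, (2 * pi)%R]) logabs m r t)%E with
  | EFin x => (expR (x / (2 * pi)))%:E
  | -oo%E => 0%E
  | +oo%E => +oo%E
  end.

Definition M1 (m : C -> C) : \bar R := ereal_sup [set Mr m r | r in `]0%R, 1%R[].

End Defs.

(* Main.v *)
(** A number lambda lies in the Waelbroeck resolvent set of T iff M_1 < |lambda|.
    Write m_n(z) = m(z) m(beta z) ... m(beta^(n-1) z), so T^n f = m_n . f(beta^n .).

    If M_1 < c, then the logarithm of max(|m|, e^-j) has mean less than log c on
    a given circle for some j, and equidistribution of the irrational rotation,
    uniform for continuous functions, gives |m_n| <= K c^n on each compact disc.
    Hence the Neumann series converges for |lambda| > c, with bounds that are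
    locally uniform in lambda.

    Conversely let lambda be in the Waelbroeck resolvent set; lambda <> 0 because
    T f vanishes at z0.  The operators T and beta^k T are intertwined by
    multiplication by z^k, and the powers of beta are dense in the circle, so on
    a whole circle |mu| = rho with rho < |lambda| the equation (mu - T) f = 1 has
    solutions f_mu bounded uniformly in mu on compact discs.  Averaging
    w^(jk) w^j rho f_mu at mu = w^j rho over the N-th roots of unity w^j yields
    F_k with T^k F_0 = rho^k F_k for k < N and T^N F_0 = rho^N (F_0 - 1).  The last
    equation forces F_0 - 1 to vanish at z0, z0/beta, ..., z0/beta^(N-1), so by
    Blaschke factors F_0 -> 1 as N grows, and |m_k| <= rho^(k+1) B on discs.
    Integrating log|m_k| over a circle gives M_r <= rho < |lambda|.

    Cauchy's formula is derived from Goursat's argument for F(e^z) on rectangles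
    [log r, log s] x [0, 2 pi]: the mean of F over a circle does not depend on the
    radius.  A point where F is only continuous is harmless once its circle
    corresponds to a vertical edge. *)
Require Import Defs.
From HB Require Import structures.
From mathcomp Require Import all_boot all_order all_algebra.
From mathcomp Require Import all_classical all_reals all_analysis.
From mathcomp Require Import complex.
From mathcomp Require Import measurable_realfun ring lra.
Import Order.TTheory GRing.Theory Num.Theory.
Local Open Scope ring_scope.
Local Open Scope classical_set_scope.

Set Implicit Arguments.
Unset Strict Implicit.
Unset Printing Implicit Defensive.

(** * The real-valued modulus of a complex number *)

Section Modulus.
Variable R : realType.
Implicit Types (x y z w : R[i]) (a b : R).

(** The obstacle in the converse is that the assumption speaks of a small disc around one point
    $\lambda$, while separating the spectrum needs a whole circle. Intertwining by $z^k$ carries the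
    information to the angles of $\beta^{-k}\lambda$, and the positive radius $\delta$ in the
    Waelbroeck condition lets finitely many $k$ cover the circle, which keeps the bounds uniform.
    $F_0$ is then a discrete Riesz projection of the constant $1$ onto the part of the spectrum
    inside $|\mu|=\rho$. That $F_0\to 1$ says that $1$ lies wholly in this part, where $T^k$ grows
    at most like $\rho^k$. A finite average asks only for existence and bounds of the $f_\mu$, not
    for any regularity in $\mu$.

    On the analytic side $\log|m|$ may be $-\infty$ at points of a circle. *)

Lemma normc_norm z : (normc z)%:C%C = `|z|. Proof. by []. Qed.

Lemma normc_ge0 z : 0 <= normc z.
Proof. by rewrite -ler0c normc_norm. Qed.

Lemma normcD x y : normc (x + y) <= normc x + normc y.
Proof. by rewrite -lecR raddfD /= !normc_norm ler_normD. Qed.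

Lemma normcN x : normc (- x) = normc x.
Proof. by apply: complexI; rewrite !normc_norm normrN. Qed.

Lemma normcBC x y : normc (x - y) = normc (y - x).
Proof. by rewrite -normcN opprB. Qed.

Lemma normcB x y : normc (x - y) <= normc x + normc y.
Proof. by rewrite (le_trans (normcD _ _))// normcN. Qed.

Lemma normcBD y x z : normc (x - z) <= normc (x - y) + normc (y - z).
Proof. by rewrite -{1}(subrK y x) -addrA normcD. Qed.

Lemma lerB_normc x y : normc x - normc y <= normc (x - y).
Proof. by rewrite lerBlDr -{1}(subrK y x) normcD. Qed.

Lemma normcM x y : normc (x * y) = normc x * normc y.
Proof. exact: ComplexField.Normc.normcM. Qed.

Lemma normcV x : normc x^-1 = (normc x)^-1.
Proof. exact: ComplexField.Normc.normcV. Qed.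

Lemma normcX x n : normc (x ^+ n) = normc x ^+ n.
Proof. by apply: complexI; rewrite rmorphXn /= !normc_norm normrX. Qed.

Lemma normc_eq0 z : (normc z == 0) = (z == 0).
Proof. by rewrite -(inj_eq (@complexI R)) normc_norm normr_eq0. Qed.

Lemma normc_gt0 z : (0 < normc z) = (z != 0).
Proof. by rewrite lt_neqAle normc_ge0 andbT eq_sym normc_eq0. Qed.

Lemma normc0 : normc (0 : R[i]) = 0.
Proof. by apply/eqP; rewrite normc_eq0. Qed.

Lemma normcR a : normc a%:C%C = `|a|.
Proof. by rewrite /= expr0n addr0 sqrtr_sqr. Qed.

Lemma normc1 : normc (1 : R[i]) = 1.
Proof. by rewrite -[1]/(1%:C%C) normcR normr1. Qed.

Lemma normci : normc ('i%C : R[i]) = 1.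
Proof. by rewrite /= expr0n add0r expr1n sqrtr1. Qed.

Lemma normc_sqr z : normc z ^+ 2 = complex.Re z ^+ 2 + complex.Im z ^+ 2.
Proof. by case: z => a b /=; rewrite sqr_sqrtr// addr_ge0// sqr_ge0. Qed.

Lemma normc_Re z : `|complex.Re z| <= normc z.
Proof.
rewrite -(ler_pXn2r (n := 2)) ?nnegrE ?normc_ge0//.
by rewrite normc_sqr real_normK ?num_real// lerDl sqr_ge0.
Qed.

Lemma normc_Im z : `|complex.Im z| <= normc z.
Proof.
rewrite -(ler_pXn2r (n := 2)) ?nnegrE ?normc_ge0//.
by rewrite normc_sqr real_normK ?num_real// lerDr sqr_ge0.
Qed.

Lemma normc_ReIm z : normc z <= `|complex.Re z| + `|complex.Im z|.
Proof.
case: z => a b; have -> : Complex a b = a%:C%C + 'i%C * b%:C%C by exact: complexE.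
rewrite (le_trans (normcD _ _))// normcM normci mul1r !normcR /=.
by rewrite !(mul0r,mulr0,add0r,addr0,subr0,mul1r).
Qed.

Lemma normc_sum (I : Type) (s : seq I) (P : pred I) (F : I -> R[i]) :
  normc (\sum_(i <- s | P i) F i) <= \sum_(i <- s | P i) normc (F i).
Proof.
elim/big_ind2: _ => [|x a y b h1 h2|//]; first by rewrite normc0.
by rewrite (le_trans (normcD _ _))// lerD.
Qed.

Lemma normc_prod (I : Type) (s : seq I) (P : pred I) (F : I -> R[i]) :
  normc (\prod_(i <- s | P i) F i) = \prod_(i <- s | P i) normc (F i).
Proof.
by elim/big_ind2: _ => [|x a y b <- <-|//]; rewrite ?normc1 ?normcM.
Qed.

Lemma ler_addgt0P a b : (forall e, 0 < e -> a <= b + e) -> a <= b.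
Proof. by move=> h; apply/ler_addgt0Pr => e /h. Qed.

Lemma normc_small0 z : (forall e : R, 0 < e -> normc z <= e) -> z = 0.
Proof.
move=> h; apply/eqP; rewrite -normc_eq0 eq_le normc_ge0 andbT.
by apply: ler_addgt0P => e /h; rewrite add0r.
Qed.

End Modulus.

(** * Continuity, complex derivatives and closure properties of Hol(D) *)

Section ComplexCalculus.
Variable R : realType.
Local Notation C := R[i].
Implicit Types (f g phi : C -> C) (z w l : C).

Definition cnear z (P : C -> Prop) : Prop :=
  exists2 delta : R, 0 < delta & forall w, normc (w - z) < delta -> P w.

Definition ccont f z : Prop :=
  forall e : R, 0 < e -> cnear z (fun w => normc (f w - f z) < e).

(** Carathéodory's form of the derivative: the difference quotient extends to a function continuous
    at [z] with value [l]. The rules for products, inverses and compositions then reduce to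
    continuity, without division by [w - z]. *)
Definition cderiv f z l : Prop :=
  exists phi, [/\ ccont phi z, phi z = l &
    cnear z (fun w => f w - f z = phi w * (w - z))].

Lemma cnearI z (P Q : C -> Prop) :
  cnear z P -> cnear z Q -> cnear z (fun w => P w /\ Q w).
Proof.
move=> [d d0 hP] [e e0 hQ]; exists (Num.min d e); first by rewrite lt_min d0.
by move=> w; rewrite lt_min => /andP[/hP ? /hQ ?].
Qed.

Lemma cnearS z (P Q : C -> Prop) :
  (forall w, P w -> Q w) -> cnear z P -> cnear z Q.
Proof. by move=> PQ [d d0 h]; exists d => // w /h /PQ. Qed.

Lemma cnear_self z (P : C -> Prop) : cnear z P -> P z.
Proof. by move=> [d d0]; apply; rewrite subrr normc0. Qed.

Lemma cnear_ball z0 z (r : R) :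
  normc (z - z0) < r -> cnear z (fun w => normc (w - z0) < r).
Proof.
move=> h; exists (r - normc (z - z0)); first by rewrite subr_gt0.
by move=> w; rewrite ltrBrDr; apply: le_lt_trans; exact: normcBD.
Qed.

Lemma cnear_inD z : inD z -> cnear z (@inD R).
Proof.
rewrite /inD -{1}(subr0 z) => /cnear_ball; apply: cnearS => w.
by rewrite subr0.
Qed.

Lemma ccont_near f g z :
  cnear z (fun w => f w = g w) -> ccont f z -> ccont g z.
Proof.
move=> fg cf e e0; move: (cnear_self fg) (cnearI fg (cf e e0)) => fgz.
by apply: cnearS => w [<-]; rewrite fgz.
Qed.

Lemma ccont_cst l z : ccont (fun=> l) z.
Proof. by move=> e e0; exists 1 => // w _; rewrite subrr normc0. Qed.

Lemma ccont_id z : ccont id z.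
Proof. by move=> e e0; exists e. Qed.

Lemma ccontD f g z : ccont f z -> ccont g z -> ccont (fun w => f w + g w) z.
Proof.
move=> cf cg e e0; have e2 : 0 < e / 2 by lra.
apply: cnearS (cnearI (cf _ e2) (cg _ e2)) => w [h1 h2].
have -> : f w + g w - (f z + g z) = (f w - f z) + (g w - g z) by ring.
by apply: le_lt_trans (normcD _ _) _; lra.
Qed.

Lemma ccont_bnd f z :
  ccont f z -> cnear z (fun w => normc (f w) < normc (f z) + 1).
Proof.
move=> /(_ 1 ltr01); apply: cnearS => w h.
by have := lerB_normc (f w) (f z); lra.
Qed.

Lemma ccontM f g z : ccont f z -> ccont g z -> ccont (fun w => f w * g w) z.
Proof.
move=> cf cg e e0.
set A := normc (f z) + 1; set B := normc (g z) + 1.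
have A0 : 0 < A by rewrite /A; have := normc_ge0 (f z); lra.
have B0 : 0 < B by rewrite /B; have := normc_ge0 (g z); lra.
have eA : 0 < e / 2 / A by rewrite !divr_gt0.
have eB : 0 < e / 2 / B by rewrite !divr_gt0.
have := cnearI (cnearI (cf _ eB) (cg _ eA)) (ccont_bnd cf).
apply: cnearS => w [[h1 h2] h3].
have -> : f w * g w - f z * g z = (f w - f z) * g z + f w * (g w - g z) by ring.
apply: le_lt_trans (normcD _ _) _; rewrite !normcM.
rewrite [e]splitr ler_ltD//.
  rewrite ltr_pdivlMr// in h1; apply: le_trans (ltW h1).
  by apply: ler_wpM2l; [exact: normc_ge0|rewrite /B lerDl].
rewrite ltr_pdivlMr// mulrC in h2; apply: le_lt_trans h2.
by apply: ler_wpM2r; [exact: normc_ge0|exact: ltW].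
Qed.

Lemma ccont_comp f g z : ccont g z -> ccont f (g z) -> ccont (f \o g) z.
Proof.
move=> cg cf e /cf [d /cg [d' d'0 h'] h].
by exists d' => // w /h' /h.
Qed.

Lemma ccontV_id z : z != 0 -> ccont (fun w => w^-1) z.
Proof.
rewrite -normc_gt0 => z0 e e0; set n := normc z in z0.
exists (Num.min (n / 2) (e * n ^+ 2 / 2)).
  by rewrite lt_min divr_gt0//= divr_gt0// mulr_gt0// exprn_gt0.
move=> w; rewrite lt_min => /andP[h1 h2].
have h3 : n / 2 < normc w.
  by have := lerB_normc z w; rewrite normcBC -/n; lra.
have w0 : w != 0 by rewrite -normc_gt0; lra.
have z0' : z != 0 by rewrite -normc_gt0.
have -> : w^-1 - z^-1 = (z - w) * (w^-1 * z^-1) by field; rewrite w0 z0'.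
rewrite !normcM !normcV normcBC -/n -invfM ltr_pdivrMr; last first.
  by rewrite mulr_gt0//; lra.
apply: lt_le_trans h2 _; rewrite -mulrA ler_pM2l// expr2.
by rewrite mulrAC ler_pM2r// ltW.
Qed.

Lemma ccontV f z : ccont f z -> f z != 0 -> ccont (fun w => (f w)^-1) z.
Proof. by move=> cf fz; apply: (ccont_comp cf); exact: ccontV_id. Qed.

Lemma ccontN f z : ccont f z -> ccont (fun w => - f w) z.
Proof.
move=> cf e e0; apply: cnearS (cf e e0) => w.
by rewrite -opprD normcN.
Qed.

Lemma ccontB f g z : ccont f z -> ccont g z -> ccont (fun w => f w - g w) z.
Proof. by move=> cf cg; apply: ccontD => //; exact: ccontN. Qed.

Lemma cderiv_cont f z l : cderiv f z l -> ccont f z.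
Proof.
move=> [phi [cphi _ h]].
apply: (@ccont_near (fun w => f z + phi w * (w - z))).
  by apply: cnearS h => w <-; rewrite addrC subrK.
apply: ccontD; first exact: ccont_cst.
by apply: ccontM => //; apply: ccontB; [exact: ccont_id|exact: ccont_cst].
Qed.

Lemma cderiv_near f g z l :
  cnear z (fun w => f w = g w) -> cderiv f z l -> cderiv g z l.
Proof.
move=> fg [phi [cphi pz h]]; exists phi; split => //.
move: (cnear_self fg) (cnearI fg h) => fgz.
by apply: cnearS => w [<-]; rewrite fgz.
Qed.

Lemma cderiv_cst l z : cderiv (fun=> l) z 0.
Proof.
exists (fun=> 0); split => //; first exact: ccont_cst.
by exists 1 => // w _; rewrite subrr mul0r.
Qed.

Lemma cderiv_id z : cderiv id z 1.
Proof.
exists (fun=> 1); split => //; first exact: ccont_cst.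
by exists 1 => // w _; rewrite mul1r.
Qed.

Lemma cderivD f g z l k :
  cderiv f z l -> cderiv g z k -> cderiv (fun w => f w + g w) z (l + k).
Proof.
move=> [p [cp <- hp]] [q [cq <- hq]]; exists (fun w => p w + q w); split => //.
  exact: ccontD.
apply: cnearS (cnearI hp hq) => w [h1 h2].
by rewrite mulrDl -h1 -h2; ring.
Qed.

Lemma cderivM f g z l k :
  cderiv f z l -> cderiv g z k ->
  cderiv (fun w => f w * g w) z (l * g z + f z * k).
Proof.
move=> df dg; have cg := cderiv_cont dg.
case: df dg => [p [cp <- hp]] [q [cq <- hq]].
exists (fun w => p w * g w + f z * q w); split => //.
  by apply: ccontD; apply: ccontM => //; exact: ccont_cst.
apply: cnearS (cnearI hp hq) => w [h1 h2].
by rewrite mulrDl mulrAC -h1 -mulrA -h2; ring.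
Qed.

Lemma cderivV_id z : z != 0 -> cderiv (fun w => w^-1) z (- z ^- 2).
Proof.
move=> z0; exists (fun w => - (w^-1 * z^-1)); split.
- by apply: ccontN; apply: ccontM; [exact: ccontV_id|exact: ccont_cst].
- by rewrite expr2 invfM.
- exists (normc z); first by rewrite normc_gt0.
  move=> w h; have w0 : w != 0.
    by apply: contraTneq h => ->; rewrite sub0r normcN ltxx.
  by field; rewrite w0 z0.
Qed.

Lemma cderiv_comp f g z l k : cderiv g z k -> cderiv f (g z) l ->
  cderiv (f \o g) z (l * k).
Proof.
move=> dg; have cg := cderiv_cont dg.
case: dg => [q [cq <- hq]] [p [cp <- [d d0 hp]]].
exists (fun w => p (g w) * q w); split => //.
  by apply: ccontM => //; exact: (ccont_comp cg).
apply: cnearS (cnearI hq (cg d d0)) => w [h1 h2] /=.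
by rewrite hp// h1 mulrA.
Qed.

(** The little-o form is the one in which estimates arrive. Conversely, the difference quotient,
    given the value [l] at [z], serves as [phi]. *)
Lemma cderivP f z l : cderiv f z l <->
  forall e : R, 0 < e ->
    cnear z (fun w => normc (f w - f z - l * (w - z)) <= e * normc (w - z)).
Proof.
split=> [[p [cp <- hp]] e e0|h].
  apply: cnearS (cnearI hp (cp e e0)) => w [-> h].
  by rewrite -mulrBl normcM ler_wpM2r ?normc_ge0// ltW.
pose p w := if w == z then l else (f w - f z) / (w - z).
exists p; split; rewrite /p ?eqxx//; last first.
  exists 1 => // w _; case: eqP => [->|/eqP wz]; first by rewrite !subrr mulr0.
  by rewrite divfK// subr_eq0.
move=> e e0; have e2 : 0 < e / 2 by lra.
apply: cnearS (h _ e2) => w; rewrite eqxx; case: eqP => [_ _|/eqP wz hw].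
  by rewrite subrr normc0.
have wz' : w - z != 0 by rewrite subr_eq0.
have -> : (f w - f z) / (w - z) - l = (f w - f z - l * (w - z)) / (w - z).
  by field.
rewrite normcM normcV ltr_pdivrMr ?normc_gt0//.
by apply: le_lt_trans hw _; rewrite ltr_pM2r ?normc_gt0//; lra.
Qed.

Lemma holDP f : holD f <-> forall z, inD z -> exists l, cderiv f z l.
Proof.
split=> h z /h[l hl]; exists l.
  apply/cderivP => e e0; have [d d0 hd] := hl _ e0; exists d => // w wz.
  have [->|nwz] := eqVneq w z; first by rewrite !subrr mulr0 subrr normc0 mulr0.
  have wz' : w - z != 0 by rewrite subr_eq0.
  have -> : f w - f z - l * (w - z) = ((f w - f z) / (w - z) - l) * (w - z).
    by field.
  rewrite normcM ler_wpM2r ?normc_ge0// ltW// hd//.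
  by rewrite normc_gt0 wz'.
move=> e e0; have e2 : 0 < e / 2 by lra.
have [d d0 hd] := (cderivP f z l).1 hl _ e2; exists d => // w /andP[w0 /hd hw].
have wz' : w - z != 0 by rewrite -normc_gt0.
have -> : (f w - f z) / (w - z) - l = (f w - f z - l * (w - z)) / (w - z).
  by field.
rewrite normcM normcV ltr_pdivrMr//.
by apply: le_lt_trans hw _; rewrite ltr_pM2r//; lra.
Qed.

Lemma holD_cont f z : holD f -> inD z -> ccont f z.
Proof. by move=> /holDP h /h[l /cderiv_cont]. Qed.

Lemma holD_eq f g : (forall z, inD z -> f z = g z) -> holD f -> holD g.
Proof.
move=> fg /holDP hf; apply/holDP => z hz; have [l hl] := hf z hz; exists l.
by apply: cderiv_near hl; apply: cnearS (cnear_inD hz) => w /fg.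
Qed.

Lemma holD_cst l : holD (fun=> l : C).
Proof. by apply/holDP => z _; exists 0; exact: cderiv_cst. Qed.

Lemma holD_id : @holD R id.
Proof. by apply/holDP => z _; exists 1; exact: cderiv_id. Qed.

Lemma holD_add f g : holD f -> holD g -> holD (fun z => f z + g z).
Proof.
move=> /holDP hf /holDP hg; apply/holDP => z hz.
have [l dl] := hf z hz; have [k dk] := hg z hz.
by exists (l + k); exact: cderivD.
Qed.

Lemma holD_mul f g : holD f -> holD g -> holD (fun z => f z * g z).
Proof.
move=> /holDP hf /holDP hg; apply/holDP => z hz.
have [l dl] := hf z hz; have [k dk] := hg z hz.
by exists (l * g z + f z * k); exact: cderivM.
Qed.

Lemma holD_scale l f : holD f -> holD (fun z => l * f z).
Proof. by apply: holD_mul; exact: holD_cst. Qed.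

Lemma holD_opp f : holD f -> holD (fun z => - f z).
Proof.
move=> hf; apply: holD_eq (holD_scale (-1) hf) => z _; exact: mulN1r.
Qed.

Lemma holD_sum (I : Type) (s : seq I) (F : I -> C -> C) :
  (forall i, holD (F i)) -> holD (fun z => \sum_(i <- s) F i z).
Proof.
move=> hF; elim: s => [|i s ih].
  by apply: holD_eq (holD_cst 0) => z _; rewrite big_nil.
by apply: holD_eq (holD_add (hF i) ih) => z _; rewrite big_cons.
Qed.

Lemma holD_prod (I : Type) (s : seq I) (F : I -> C -> C) :
  (forall i, holD (F i)) -> holD (fun z => \prod_(i <- s) F i z).
Proof.
move=> hF; elim: s => [|i s ih].
  by apply: holD_eq (holD_cst 1) => z _; rewrite big_nil.
by apply: holD_eq (holD_mul (hF i) ih) => z _; rewrite big_cons.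
Qed.

Lemma inD_rot (b : C) z : normc b = 1 -> inD z -> inD (b * z).
Proof. by rewrite /inD normcM => ->; rewrite mul1r. Qed.

Lemma holD_rot (b : C) f : normc b = 1 -> holD f -> holD (fun z => f (b * z)).
Proof.
move=> b1 /holDP hf; apply/holDP => z hz.
have [l hl] := hf _ (inD_rot b1 hz); exists (l * (0 * z + b * 1)).
apply: (@cderiv_comp f (fun z => b * z)) => //.
by apply: cderivM; [exact: cderiv_cst|exact: cderiv_id].
Qed.

End ComplexCalculus.


(** * Nested intervals and an induction principle on rectangles *)

Section Bisection.
Variable R : realType.

Definition half_of (a b a' b' : R) : Prop :=
  (a' = a /\ b' = (a + b) / 2) \/ (a' = (a + b) / 2 /\ b' = b).

Lemma nested_halves (A B : nat -> R) : A 0%N <= B 0%N ->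
  (forall n, half_of (A n) (B n) (A n.+1) (B n.+1)) ->
  (forall n, A 0%N <= A n <= B n /\ B n <= B 0%N) /\
  exists2 x, (forall n, A n <= x <= B n) &
    forall d, 0 < d -> exists N, forall n, (N <= n)%N -> B n - A n < d.
Proof.
move=> AB0 h.
have AB n : A n <= B n by elim: n => // n ih; case: (h n) => -[-> ->]; lra.
have Am n k : A n <= A (n + k)%N.
  elim: k => [|k ih]; first by rewrite addn0.
  by rewrite addnS; have := AB (n + k)%N; case: (h (n + k)%N) => -[-> _]; lra.
have Bm n k : B (n + k)%N <= B n.
  elim: k => [|k ih]; first by rewrite addn0.
  by rewrite addnS; have := AB (n + k)%N; case: (h (n + k)%N) => -[_ ->]; lra.
split=> [n|]; first by rewrite AB andbT; split; [exact: (Am 0%N)|exact: (Bm 0%N)].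
have AleB n k : A n <= B k.
  by apply: le_trans (Am n k) _; apply: le_trans (AB _) _; rewrite addnC.
have hs : has_sup (range A).
  by split; [exists (A 0%N), 0%N|exists (B 0%N) => _ [n _ <-]].
exists (sup (range A)) => [n|d d0].
  apply/andP; split; first by apply: sup_upper_bound => //; exists n.
  by apply: ge_sup; [exists (A 0%N), 0%N|move=> _ [k _ <-]].
have len n : (B n - A n) * 2 ^+ n = B 0%N - A 0%N.
  elim: n => [|n ih]; first by rewrite expr0 mulr1.
  by rewrite -ih exprS; case: (h n) => -[-> ->]; field.
have big n : n%:R < (2 : R) ^+ n by rewrite -natrX ltr_nat ltn_expl.
pose N := Num.bound ((B 0%N - A 0%N) / d); exists N => n Nn.
have : (B 0%N - A 0%N) / d < n%:R.
  apply: lt_le_trans (_ : N%:R <= _); last by rewrite ler_nat.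
  by apply: archi_boundP; rewrite divr_ge0 ?(ltW d0)// subr_ge0.
move=> /lt_trans /(_ (big n)); rewrite ltr_pdivrMr// -(len n) mulrC.
by rewrite ltr_pM2l// exprn_gt0.
Qed.

(** If [P] failed, it would fail on one of the quarters, and repeated quartering would shrink
    failing rectangles to a point, against the local hypothesis. This plays the part of compactness
    throughout; for statements about an interval the second interval is degenerate, [c = d = 0]. *)
Lemma rect_ind (P : R -> R -> R -> R -> Prop) (a b c d : R) :
  a <= b -> c <= d ->
  (forall a b c d, P a ((a + b) / 2) c ((c + d) / 2) ->
    P ((a + b) / 2) b c ((c + d) / 2) -> P a ((a + b) / 2) ((c + d) / 2) d ->
    P ((a + b) / 2) b ((c + d) / 2) d -> P a b c d) ->
  (forall x y, a <= x <= b -> c <= y <= d ->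
    exists2 delta, 0 < delta & forall a' b' c' d',
      a <= a' <= x -> x <= b' <= b -> c <= c' <= y -> y <= d' <= d ->
      b' - a' < delta -> d' - c' < delta -> P a' b' c' d') ->
  P a b c d.
Proof.
move=> ab cd glue loc; apply: contrapT => nP.
pose bad (q : R * R * R * R) := ~ P q.1.1.1 q.1.1.2 q.1.2 q.2.
(* The assumption [bad q] stands inside the existential, so that [choice] returns a map on all
   quadruples, which can be iterated. *)
have step q : exists q', bad q -> bad q' /\
    half_of q.1.1.1 q.1.1.2 q'.1.1.1 q'.1.1.2 /\ half_of q.1.2 q.2 q'.1.2 q'.2.
  have [bq|nb] := pselect (bad q); last by exists q.
  apply: contrapT => /forallNP nq; apply: bq.
  case: q nq => [[[a1 b1] c1] d1] /= nq.
  apply: glue; apply: contrapT => nP'.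
  - by apply: (nq (a1, (a1 + b1) / 2, c1, (c1 + d1) / 2)) => _; do 2?split => //; left.
  - by apply: (nq ((a1 + b1) / 2, b1, c1, (c1 + d1) / 2)) => _; do 2?split => //; [right|left].
  - by apply: (nq (a1, (a1 + b1) / 2, (c1 + d1) / 2, d1)) => _; do 2?split => //; [left|right].
  - by apply: (nq ((a1 + b1) / 2, b1, (c1 + d1) / 2, d1)) => _; do 2?split => //; right.
have [f hf] := choice step.
pose s n := iter n f (a, b, c, d).
have bs n : bad (s n) by elim: n => // n ih; have [] := hf _ ih.
have [bx [x hx dx]] := @nested_halves (fun n => (s n).1.1.1) (fun n => (s n).1.1.2)
  ab (fun n => (hf _ (bs n)).2.1).
have [by_ [y hy dy]] := @nested_halves (fun n => (s n).1.2) (fun n => (s n).2)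
  cd (fun n => (hf _ (bs n)).2.2).
have [e e0 he] := loc x y (hx 0%N) (hy 0%N).
have [N1 h1] := dx _ e0; have [N2 h2] := dy _ e0.
pose n := maxn N1 N2; apply: (bs n); apply: he.
- by have /andP[-> _] := hx n; have [/andP[-> _] _] := bx n.
- by have /andP[_ ->] := hx n; have [_ ->] := bx n.
- by have /andP[-> _] := hy n; have [/andP[-> _] _] := by_ n.
- by have /andP[_ ->] := hy n; have [_ ->] := by_ n.
- by apply: h1; rewrite leq_maxl.
- by apply: h2; rewrite leq_maxr.
Qed.

End Bisection.

(** * Primitives of complex functions of a real variable *)

Section RealParameter.
Variable R : realType.
Local Notation C := R[i].
Implicit Types (a b s t : R) (g G : R -> C).

Definition rcont a b g : Prop := forall t, a <= t <= b ->
  forall e : R, 0 < e -> exists2 d : R, 0 < d &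
    forall s, a <= s <= b -> `|s - t| < d -> normc (g s - g t) < e.

(** [G] is a primitive of [g] on [[a, b]], one-sided at the end points. Integrals along segments and
    circles are expressed as increments of such primitives. *)
Definition rder a b G g : Prop := forall t, a <= t <= b ->
  forall e : R, 0 < e -> exists2 d : R, 0 < d &
    forall s, a <= s <= b -> `|s - t| < d ->
      normc (G s - G t - (s - t)%:C%C * g t) <= e * `|s - t|.

(** With [M] enlarged by a slack [k > 0] the inequality holds on short intervals around each point,
    and it is additive under bisection. The slack costs at most [k * (b - a) <= e] in total. *)
Lemma rder_le a b G g (M : R) : a <= b -> rder a b G g ->
  (forall t, a <= t <= b -> normc (g t) <= M) -> normc (G b - G a) <= M * (b - a).
Proof.
move=> ab dG gM; apply: ler_addgt0P => e e0.
pose k := e / (b - a + 1).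
have ba0 : 0 < b - a + 1 by lra.
have k0 : 0 < k by rewrite divr_gt0.
apply: (@le_trans _ _ ((M + k) * (b - a))); last first.
  rewrite mulrDl lerD2l /k mulrAC ler_pdivrMr//.
  by rewrite ler_pM2l//; lra.
pose P (a' b' c' d' : R) := a <= a' -> b' <= b -> a' <= b' ->
  normc (G b' - G a') <= (M + k) * (b' - a').
suff : P a b 0 0 by apply.
apply: rect_ind => //.
  move=> {dG}a' b' c' d' h1 h2 _ _ a1 b1 ab1.
  have H1 := h1 ltac:(lra) ltac:(lra) ltac:(lra).
  have H2 := h2 ltac:(lra) ltac:(lra) ltac:(lra).
  apply: le_trans (normcBD (G ((a' + b') / 2)) _ _) _.
  apply: le_trans (lerD H2 H1) _.
  by rewrite -mulrDr le_eqVlt; apply/orP; left; apply/eqP; congr (_ * _); field.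
move=> x y hx _; have [d d0 hd] := dG x hx k k0; exists d => //.
move=> a' b' c' d' /andP[a1 a2] /andP[b1 b2] _ _ bad _ _ _ _.
have := hd a' ltac:(lra) ltac:(rewrite ler0_norm; lra).
have := hd b' ltac:(lra) ltac:(rewrite ger0_norm; lra).
set u := _ - _ - _ => hu; set v := _ - _ - _ => hv.
have -> : G b' - G a' = (u - v) + (b' - a')%:C%C * g x.
  by rewrite /u /v !rmorphB /=; ring.
apply: le_trans (normcD _ _) _; rewrite normcM normcR.
have := normcB u v; have := gM x hx => hM huv.
have bx : `|b' - x| = b' - x by rewrite ger0_norm// subr_ge0.
have ax : `|a' - x| = x - a' by rewrite ler0_norm ?subr_le0// opprB.
have ba : `|b' - a'| = b' - a' by rewrite ger0_norm// subr_ge0 (le_trans a2).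
rewrite bx in hu; rewrite ax in hv; rewrite ba.
have : (b' - a') * normc (g x) <= (b' - a') * M by apply: ler_wpM2l => //; lra.
nra.
Qed.

(** The difference of two primitives has derivative zero, so [rder_le] applies with [M = 0]. This
    makes integrals independent of the chosen primitive. *)
Lemma rder_uniq a b G G' g : a <= b -> rder a b G g -> rder a b G' g ->
  G b - G a = G' b - G' a.
Proof.
move=> ab h1 h2; apply/eqP; rewrite -subr_eq0 -normc_eq0 eq_le normc_ge0 andbT.
have -> : G b - G a - (G' b - G' a) = (G b - G' b) - (G a - G' a) by ring.
rewrite -(mul0r (b - a)).
apply: (@rder_le a b (fun t => G t - G' t) (fun=> 0)) => //; last first.
  by move=> t _; rewrite normc0.
move=> t ht e e0; have e2 : 0 < e / 2 by lra.
have [d d0 hd] := h1 t ht _ e2; have [d' d'0 hd'] := h2 t ht _ e2.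
exists (Num.min d d'); first by rewrite lt_min d0.
move=> s hs; rewrite lt_min => /andP[/(hd _ hs) k1 /(hd' _ hs) k2].
set u := _ - _ - _ in k1; set v := _ - _ - _ in k2.
have -> : G s - G' s - (G t - G' t) - (s - t)%:C%C * 0 = u - v.
  by rewrite /u /v; ring.
by apply: le_trans (normcB _ _) _; lra.
Qed.

Lemma rder_lin a b G G' g g' (k : C) : rder a b G g -> rder a b G' g' ->
  rder a b (fun t => G t + k * G' t) (fun t => g t + k * g' t).
Proof.
move=> h1 h2 t ht e e0; have e2 : 0 < e / 2 by lra.
have k0 := normc_ge0 k.
have e3 : 0 < e / 2 / (normc k + 1) by rewrite divr_gt0//; lra.
have [d d0 hd] := h1 t ht _ e2; have [d' d'0 hd'] := h2 t ht _ e3.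
exists (Num.min d d'); first by rewrite lt_min d0.
move=> s hs; rewrite lt_min => /andP[/(hd _ hs) k1 /(hd' _ hs) k2].
set u := _ - _ - _ in k1; set v := _ - _ - _ in k2.
have -> : G s + k * G' s - (G t + k * G' t) - (s - t)%:C%C * (g t + k * g' t)
  = u + k * v by rewrite /u /v; ring.
apply: le_trans (normcD _ _) _; rewrite normcM.
have : normc k * normc v <= (normc k + 1) * normc v.
  by apply: ler_wpM2r; [exact: normc_ge0|lra].
have : (normc k + 1) * normc v <= e / 2 * `|s - t|.
  by rewrite mulrC -ler_pdivlMr 1?mulrAC//; lra.
lra.
Qed.

Lemma rder_affine_primitive a b (u q k l p : C) :
  rder a b (fun t => let w := q + t%:C%C * u in k * w + l * (w - p) ^+ 2 / 2)
    (fun t => u * (k + l * (q + t%:C%C * u - p))).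
Proof.
move=> t _ e e0; set A := normc (l * u ^+ 2 / 2).
have A0 : 0 <= A by exact: normc_ge0.
exists (e / (A + 1)) => [|s _ hs]; first by rewrite divr_gt0//; lra.
rewrite [X in normc X](_ : _ = (l * u ^+ 2 / 2) * ((s - t)%:C%C * (s - t)%:C%C)).
  rewrite (normcM (l * _ / _)) -/A normcM normcR mulrA ler_wpM2r//.
  have h : `|s - t| * (A + 1) <= e by rewrite -ler_pdivlMr; [exact: ltW|lra].
  by have := normr_ge0 (s - t); lra.
by rewrite rmorphB /=; field.
Qed.

End RealParameter.


(** * Goursat's theorem on a rectangle *)

Section Goursat.
Variable R : realType.
Local Notation C := R[i].
Implicit Types (a b c d x y : R) (h : C -> C) (H V : R -> R -> C).

Lemma rder_sub a b a' b' (G g : R -> C) :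
  a <= a' -> b' <= b -> rder a b G g -> rder a' b' G g.
Proof.
move=> aa bb dG t ht e e0; have [d d0 hd] := dG t ltac:(lra) e e0.
by exists d => // s hs; apply: hd; lra.
Qed.

Lemma rder_eq a b (G g g' : R -> C) : (forall t, a <= t <= b -> g t = g' t) ->
  rder a b G g -> rder a b G g'.
Proof.
move=> gg dG t ht e e0; have [d d0 hd] := dG t ht e e0; exists d => // s hs.
by rewrite -gg//; exact: hd.
Qed.

(** The integral of [h] along the boundary, counterclockwise, when [H] consists of primitives of [h]
    in the horizontal direction and [V] of primitives of ['i * h] in the vertical direction. *)
Definition rect_incr H V a b c d : C :=
  (H b c - H a c) - (H b d - H a d) + (V b d - V b c) - (V a d - V a c).

Lemma Complex_h x y : Complex x y = Complex 0 y + x%:C%C * 1.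
Proof. by rewrite mulr1; apply/eqP; rewrite eq_complex /= add0r addr0 !eqxx. Qed.

Lemma Complex_v x y : Complex x y = x%:C%C + y%:C%C * 'i%C.
Proof.
by apply/eqP; rewrite eq_complex /= !(mul0r, mulr0, mulr1, add0r, addr0, subr0) !eqxx.
Qed.

(** The affine function has a primitive [P] in the whole plane, whose increments cancel around the
    boundary. What remains is the integral of a function of size [eta] over a contour of length
    [2 * ((b - a) + (d - c))]. *)
Lemma rect_incr_le h H V a b c d (k l p : C) (eta : R) : a <= b -> c <= d ->
  (forall y, c <= y <= d -> rder a b (H^~ y) (fun x => h (Complex x y))) ->
  (forall x, a <= x <= b -> rder c d (V x) (fun y => 'i%C * h (Complex x y))) ->
  (forall x y, a <= x <= b -> c <= y <= d ->
     normc (h (Complex x y) - (k + l * (Complex x y - p))) <= eta) ->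
  normc (rect_incr H V a b c d) <= 2 * eta * ((b - a) + (d - c)).
Proof.
move=> ab cd dH dV heta; pose P w : C := k * w + l * (w - p) ^+ 2 / 2.
have hor y : c <= y <= d ->
    normc (H b y - H a y - (P (Complex b y) - P (Complex a y))) <= eta * (b - a).
  move=> hy.
  have := rder_lin (-1) (dH y hy) (@rder_affine_primitive _ a b 1 (Complex 0 y) k l p).
  move=> /rder_le -/(_ eta ab); rewrite /= -!Complex_h -!/(P _).
  rewrite [X in normc X <= _](_ : _ = H b y - H a y - (P (Complex b y) - P (Complex a y))); last by ring.
  apply => x hx; rewrite -Complex_h.
  by apply: le_trans (heta x y hx hy); rewrite mul1r mulN1r.
have ver x : a <= x <= b ->
    normc (V x d - V x c - (P (Complex x d) - P (Complex x c))) <= eta * (d - c).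
  move=> hx.
  have := rder_lin (-1) (dV x hx) (@rder_affine_primitive _ c d 'i%C x%:C%C k l p).
  move=> /rder_le -/(_ eta cd); rewrite /= -!Complex_v -!/(P _).
  rewrite [X in normc X <= _](_ : _ = V x d - V x c - (P (Complex x d) - P (Complex x c))); last by ring.
  apply => y hy; rewrite -Complex_v.
  rewrite mulN1r -mulrBr normcM normci mul1r; exact: heta.
have h1 := hor c ltac:(lra); have h2 := hor d ltac:(lra).
have h3 := ver a ltac:(lra); have h4 := ver b ltac:(lra).
rewrite [X in normc X](_ : _ =
  (H b c - H a c - (P (Complex b c) - P (Complex a c))) -
  (H b d - H a d - (P (Complex b d) - P (Complex a d))) +
  ((V b d - V b c - (P (Complex b d) - P (Complex b c))) -
  (V a d - V a c - (P (Complex a d) - P (Complex a c))))); last first.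
  by rewrite /rect_incr; ring.
apply: le_trans (normcD _ _) _.
apply: le_trans (lerD (normcB _ _) (normcB _ _)) _; lra.
Qed.

Lemma normc_rect a b c d x y x' y' : a <= x <= b -> c <= y <= d ->
  a <= x' <= b -> c <= y' <= d ->
  normc (Complex x y - Complex x' y') <= (b - a) + (d - c).
Proof.
move=> hx hy hx' hy'; apply: le_trans (normc_ReIm _) _ => /=.
by rewrite lerD// ler_norml; apply/andP; split; lra.
Qed.

(* On the two vertical edges continuity suffices: there the increment of a
   small rectangle is o(perimeter), and the perimeters of the rectangles of a
   dyadic subdivision that touch an edge add up to a bounded quantity. *)
Lemma goursat h H V a b c d : a < b -> c <= d ->
  (forall x y, a <= x <= b -> c <= y <= d -> ccont h (Complex x y)) ->
  (forall x y, a < x < b -> c <= y <= d -> exists l, cderiv h (Complex x y) l) ->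
  (forall y, c <= y <= d -> rder a b (H^~ y) (fun x => h (Complex x y))) ->
  (forall x, a <= x <= b -> rder c d (V x) (fun y => 'i%C * h (Complex x y))) ->
  rect_incr H V a b c d = 0.
Proof.
move=> ab cd ch dh dH dV; apply: normc_small0 => e0' e0'_gt0.
pose S0 := (b - a) + (d - c).
have S00 : 0 < S0 ^+ 2 + S0 * 2 by rewrite /S0; nra.
pose e := e0' / (S0 ^+ 2 + S0 * 2).
have e0 : 0 < e by rewrite divr_gt0.
(* The bound is exactly additive under quartering: every quarter has size [S / 2], so the four
   squares sum to [S ^+ 2], and a vertical edge is touched by two quarters, contributing [S / 2]
   each. Strictness of [a' < b'] keeps the midpoint off both edges. *)
pose P a' b' c' d' := a <= a' -> a' < b' -> b' <= b -> c <= c' -> c' <= d' -> d' <= d ->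
  let S := (b' - a') + (d' - c') in
  normc (rect_incr H V a' b' c' d') <=
    e * (S ^+ 2 + S * ((a' == a)%:R + (b' == b)%:R)).
have : P a b c d.
  apply: rect_ind => //; first exact: ltW.
    move=> a1 b1 c1 d1; set m := (a1 + b1) / 2; set n := (c1 + d1) / 2.
    move=> h1 h2 h3 h4 aa1 ab1 bb1 cc1 cd1 dd1; set S := _ + (d1 - c1).
    have /andP[am mb] : a1 < m < b1 by clear -ab1; rewrite /m; lra.
    have /andP[cn nd1] : c1 <= n <= d1 by clear -cd1; rewrite /n; lra.
    have mleb : m <= b by exact: le_trans (ltW mb) bb1.
    have alem : a <= m by exact: le_trans aa1 (ltW am).
    have nd : n <= d by exact: le_trans nd1 dd1.
    have clen : c <= n by exact: le_trans cc1 cn.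
    have {h1} := h1 aa1 am mleb cc1 cn nd.
    have {h2} := h2 alem mb bb1 cc1 cn nd.
    have {h3} := h3 aa1 am mleb clen nd1 dd1.
    have {h4} := h4 alem mb bb1 clen nd1 dd1.
    have -> : (m == a) = false by rewrite gt_eqF// (le_lt_trans aa1).
    have -> : (m == b) = false by rewrite lt_eqF// (lt_le_trans mb).
    set ia := (a1 == a)%:R; set ib := (b1 == b)%:R.
    have -> : (b1 - m) + (d1 - n) = S / 2 by rewrite /S /m /n; field.
    have -> : (m - a1) + (d1 - n) = S / 2 by rewrite /S /m /n; field.
    have -> : (b1 - m) + (n - c1) = S / 2 by rewrite /S /m /n; field.
    have -> : (m - a1) + (n - c1) = S / 2 by rewrite /S /m /n; field.
    move=> k1 k2 k3 k4.
    have -> : rect_incr H V a1 b1 c1 d1 =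
      rect_incr H V a1 m c1 n + rect_incr H V m b1 c1 n +
      (rect_incr H V a1 m n d1 + rect_incr H V m b1 n d1).
      by rewrite /rect_incr; ring.
    apply: le_trans (normcD _ _) _.
    apply: le_trans (lerD (normcD _ _) (normcD _ _)) _.
    apply: le_trans (lerD (lerD k4 k3) (lerD k2 k1)) _.
    by rewrite !mulr0n !addr0 !add0r !expr2 le_eqVlt; apply/orP; left; apply/eqP; field.
  move=> x y hx hy.
  (* At an interior abscissa differentiability makes the error [o(S)] per unit of length, paid for
     by the term [S ^+ 2]. On an edge there is only continuity, but a rectangle containing such a
     point touches that edge, so an indicator equal to 1 pays. *)
  have [hx'|hx'] := pselect (a < x < b).
    have [l /cderivP dl] := dh x y hx' hy.
    have e2 : 0 < e / 2 by lra.
    have [delta d0 hd] := dl _ e2; exists (delta / 2) => [|a1 b1 c1 d1]; first by lra.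
    move=> /andP[a1a a1x] /andP[b1x b1b] /andP[c1c c1y] /andP[d1y d1d] s1 s2.
    move=> _ ab1 _ _ _ _; set S := _ + (d1 - c1).
    have sub1 y0 : c1 <= y0 <= d1 -> rder a1 b1 (H^~ y0) (fun x => h (Complex x y0)).
      move=> hy0; apply: rder_sub a1a b1b (dH _ _).
      by clear -hy0 c1c d1d; lra.
    have sub2 x0 : a1 <= x0 <= b1 -> rder c1 d1 (V x0) (fun y => 'i%C * h (Complex x0 y)).
      move=> hy0; apply: rder_sub c1c d1d (dV _ _).
      by clear -hy0 a1a b1b; lra.
    apply: (@le_trans _ _ (2 * (e / 2 * S) * S)).
      apply: (@rect_incr_le h H V a1 b1 c1 d1 (h (Complex x y)) l (Complex x y)) => //.
      - exact: ltW.
      - exact: le_trans c1y d1y.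
      move=> x1 y1 hx1 hy1.
      have hS : normc (Complex x1 y1 - Complex x y) <= S.
        by apply: normc_rect => //; apply/andP.
      rewrite opprD addrA; apply: le_trans (hd _ _) _.
        by apply: le_lt_trans hS _; rewrite /S; clear -s1 s2 ab1 c1y d1y; lra.
      by apply: ler_wpM2l => //; exact: ltW.
    have S0' : 0 <= S by rewrite /S; clear -s1 s2 ab1 c1y d1y; lra.
    have : 0 <= S * ((a1 == a)%:R + (b1 == b)%:R) by apply: mulr_ge0 => //; apply: addr_ge0; exact: ler0n.
    move=> hh; have := mulr_ge0 (ltW e0) hh; rewrite expr2; clear; lra.
  have e2 : 0 < e / 2 by lra.
  have [delta d0 hd] := ch x y hx hy _ e2.
  exists (delta / 2) => [|a1 b1 c1 d1]; first by lra.
  move=> /andP[a1a a1x] /andP[b1x b1b] /andP[c1c c1y] /andP[d1y d1d] s1 s2.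
  move=> _ ab1 _ _ _ _; set S := _ + (d1 - c1).
  have sub1 y0 : c1 <= y0 <= d1 -> rder a1 b1 (H^~ y0) (fun x => h (Complex x y0)).
    move=> hy0; apply: rder_sub a1a b1b (dH _ _).
    by clear -hy0 c1c d1d; lra.
  have sub2 x0 : a1 <= x0 <= b1 -> rder c1 d1 (V x0) (fun y => 'i%C * h (Complex x0 y)).
    move=> hy0; apply: rder_sub c1c d1d (dV _ _).
    by clear -hy0 a1a b1b; lra.
  apply: (@le_trans _ _ (2 * (e / 2) * S)).
    apply: (@rect_incr_le h H V a1 b1 c1 d1 (h (Complex x y)) 0 (Complex x y)) => //.
    - exact: ltW.
    - exact: le_trans c1y d1y.
    move=> x1 y1 hx1 hy1.
    have hS : normc (Complex x1 y1 - Complex x y) <= S.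
      by apply: normc_rect => //; apply/andP.
    rewrite mul0r addr0 ltW// hd//.
    by apply: le_lt_trans hS _; rewrite /S; clear -s1 s2 ab1 c1y d1y; lra.
  have S0' : 0 <= S by rewrite /S; clear -s1 s2 ab1 c1y d1y; lra.
  have : 1 <= (a1 == a)%:R + (b1 == b)%:R :> R.
    have : a1 = a \/ b1 = b by clear -hx hx' a1a a1x b1x b1b; lra.
    by case=> ->; rewrite eqxx; [rewrite lerDl|rewrite lerDr].
  move=> /(ler_wpM2l S0') k; rewrite mulr1 in k.
  have := ler_wpM2l (ltW e0) k; have := mulr_ge0 (ltW e0) (sqr_ge0 S); clear; lra.
move=> /(_ (lexx _) ab (lexx _) (lexx _) cd (lexx _)).
rewrite !eqxx /= -/S0 => h1; apply: le_trans h1 _.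
by rewrite /e -[1 + 1]/(2%:R) divfK// gt_eqF.
Qed.

End Goursat.


(** * Existence of primitives, from the fundamental theorem of calculus *)

Section Primitives.
Variable R : realType.
Local Notation mu := (@lebesgue_measure R).
Import numFieldNormedType.Exports.

Lemma derivable_expansion (f : R -> R) (t : R) : derivable f t 1 ->
  forall e, 0 < e -> exists2 d : R, 0 < d & forall s, `|s - t| < d ->
    `|f s - f t - (s - t) * derive1 f t| <= e * `|s - t|.
Proof.
move=> df e e0.
have : h^-1 *: ((f \o shift t) (h *: 1) - f t) @[h --> 0^'] --> derive1 f t.
  by rewrite derive1E; exact: df.
move=> /cvgrPdist_le /(_ e e0)[d /= d0 hd]; exists d => // s hs.
have [->|st] := eqVneq s t; first by rewrite !subrr mul0r subrr normr0 mulr0.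
have st0 : s - t != 0 by rewrite subr_eq0.
have := hd (s - t); rewrite /ball /= sub0r normrN => /(_ hs st0).
rewrite /GRing.scale /= mulr1 subrK distrC => h.
have -> : f s - f t - (s - t) * derive1 f t =
    ((s - t)^-1 * (f s - f t) - derive1 f t) * (s - t) by field.
by rewrite normrM ler_wpM2r.
Qed.

Lemma continuous_primitive (g : R -> R) (a b : R) : a < b -> continuous g ->
  exists G : R -> R, (forall t, a <= t <= b -> forall e, 0 < e ->
     exists2 d : R, 0 < d & forall s, `|s - t| < d ->
       `|G s - G t - (s - t) * g t| <= e * `|s - t|) /\
  (\int[mu]_(t in `[a, b]) (g t)%:E = (G b - G a)%:E)%E.
Proof.
(* Starting the integral at [a - 1] makes [a] an interior point, so [G] has two-sided derivatives on
   the closed interval [[a, b]]. *)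
move=> ab cg; pose G x := (\int[mu]_(t in `[a - 1, x]) g t)%R.
have ig u : mu.-integrable `[a - 1, u] (EFin \o g).
  apply: continuous_compact_integrable; first exact: segment_compact.
  exact: continuous_subspaceT.
have dG t : a <= t -> derivable G t 1 /\ G^`() t = g t.
  move=> at_.
  apply: (@continuous_FTC1_closed _ g (a - 1) t (t + 1)) => //; [lra|lra|exact: cg].
exists G; split=> [t /andP[at_ tb] e e0|].
  have [d1 <-] := dG t at_; exact: derivable_expansion.
rewrite (@continuous_FTC2 _ g G a b)//.
- exact: continuous_subspaceT.
- split.
  + by move=> x; rewrite in_itv /= => /andP[ax _]; have [] := dG x (ltW ax).
  + apply: cvg_at_right_filter.
    by have [/derivable1_diffP /differentiable_continuous] := dG a (lexx _).
  + apply: cvg_at_left_filter.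
    by have [/derivable1_diffP /differentiable_continuous] := dG b (ltW ab).
- by move=> x; rewrite in_itv /= => /andP[ax _]; have [] := dG x (ltW ax).
Qed.

(** Composition with this 1-Lipschitz map extends a function continuous on [[a, b]] to a continuous
    function on the line. *)
Definition clamp (a b t : R) := Num.max a (Num.min t b).

Lemma clampP a b t : a <= b -> a <= clamp a b t <= b.
Proof. by move=> ab; rewrite /clamp le_max lexx ge_max ab ge_min lexx orbT. Qed.

Lemma clamp_id a b t : a <= t <= b -> clamp a b t = t.
Proof. by move=> /andP[h1 h2]; rewrite /clamp (min_l h2) (max_r h1). Qed.

Lemma clamp_lip a b s t : a <= b -> `|clamp a b s - clamp a b t| <= `|s - t|.
Proof.
move=> ab; wlog st : s t / t <= s => [hw|].
  by have [/hw//|/ltW/hw] := leP t s; rewrite distrC [leRHS]distrC.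
have mono : clamp a b t <= clamp a b s by rewrite le_max2// le_min2.
rewrite !ger0_norm ?subr_ge0// /clamp {mono}.
have [h1|h1] := leP s b; have [h2|h2] := leP t b;
have [h3|h3] := leP a s; have [h4|h4] := leP a t; have [h5|h5] := leP a b; lra.
Qed.

Lemma rcont_clamp_continuous a b (g : R -> R[i]) (p : R[i] -> R) : a <= b ->
  (forall x y, `|p x - p y| <= normc (x - y)) -> rcont a b g ->
  continuous (fun t => p (g (clamp a b t))).
Proof.
move=> ab hp cg t; apply/cvgrPdist_lt => e e0.
have [d d0 hd] := cg _ (clampP t ab) e e0.
exists d => //= s; rewrite /ball /= => hs.
apply: le_lt_trans (hp _ _) _; rewrite normcBC; apply: hd; first exact: clampP.
by apply: le_lt_trans (clamp_lip _ _ ab) _; rewrite distrC.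
Qed.

Lemma rder_exists a b (g : R -> R[i]) : a < b -> rcont a b g ->
  exists G, rder a b G g.
Proof.
move=> ab cg.
have hRe (x y : R[i]) : `|complex.Re x - complex.Re y| <= normc (x - y).
  by apply: le_trans (normc_Re _); rewrite raddfB.
have hIm (x y : R[i]) : `|complex.Im x - complex.Im y| <= normc (x - y).
  by apply: le_trans (normc_Im _); rewrite raddfB.
have [G1 [h1 _]] := continuous_primitive ab (rcont_clamp_continuous (ltW ab) hRe cg).
have [G2 [h2 _]] := continuous_primitive ab (rcont_clamp_continuous (ltW ab) hIm cg).
exists (fun t => Complex (G1 t) (G2 t)) => t ht e e0; have e2 : 0 < e / 2 by lra.
have [d d0 hd] := h1 t ht _ e2; have [d' d'0 hd'] := h2 t ht _ e2.
exists (Num.min d d'); first by rewrite lt_min d0.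
move=> s hs; rewrite lt_min => /andP[/hd k1 /hd' k2].
apply: le_trans (normc_ReIm _) _; rewrite clamp_id// in k1 k2.
case: (g t) k1 k2 => u v /= k1 k2.
rewrite !(mul0r, mulr0, add0r, addr0, subr0); lra.
Qed.

End Primitives.


(** * The unit circle and the complex exponential *)

Section ComplexExponential.
Variable R : realType.
Local Notation C := R[i].

Definition cis (t : R) : C := Complex (cos t) (sin t).

Definition cexp (z : C) : C := (expR (complex.Re z))%:C%C * cis (complex.Im z).

Lemma polarE (r t : R) : polar r t = r%:C%C * cis t.
Proof. by apply/eqP; rewrite eq_complex /= !mul0r subr0 addr0 !eqxx. Qed.

Lemma cisD s t : cis (s + t) = cis s * cis t.
Proof. by apply/eqP; rewrite eq_complex /= cosD sinD eqxx [X in _ == X]addrC eqxx. Qed.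

Lemma cis0 : cis 0 = 1.
Proof. by rewrite /cis cos0 sin0. Qed.

Lemma cis2pi : cis (2 * pi) = 1.
Proof. by rewrite /cis mulrC mulr_natr cos2pi sin2pi. Qed.

Lemma normc_cis t : normc (cis t) = 1.
Proof. by rewrite /= cos2Dsin2 sqrtr1. Qed.

Lemma cisX t n : cis t ^+ n = cis (n%:R * t).
Proof.
elim: n => [|n ih]; first by rewrite mul0r cis0 expr0.
by rewrite exprS ih -cisD -natr1 mulrDl mul1r addrC.
Qed.

Lemma normc_polar (r t : R) : 0 <= r -> normc (polar r t) = r.
Proof. by move=> r0; rewrite polarE normcM normc_cis mulr1 normcR ger0_norm. Qed.

Lemma cis_expansion0 (e : R) : 0 < e -> exists2 d : R, 0 < d &
  forall h, `|h| < d -> normc (cis h - 1 - h%:C%C * 'i%C) <= e * `|h|.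
Proof.
move=> e0; have e2 : 0 < e / 2 by lra.
have [d1 d10 h1] := derivable_expansion (@derivable_cos R 0) e2.
have [d2 d20 h2] := derivable_expansion (@derivable_sin R 0) e2.
rewrite derive1E (@derive_val _ _ _ _ _ _ _ (is_derive_cos 0)) sin0 oppr0 cos0 in h1.
rewrite derive1E (@derive_val _ _ _ _ _ _ _ (is_derive_sin 0)) cos0 sin0 in h2.
exists (Num.min d1 d2); first by rewrite lt_min d10.
move=> h; rewrite lt_min => /andP[k1 k2].
have {}h1 := h1 h; rewrite !(addr0, mulr0, subr0) in h1; have {}h1 := h1 k1.
have {}h2 := h2 h; rewrite !(subr0, mulr1) in h2; have {}h2 := h2 k2.
apply: le_trans (normc_ReIm _) _ => /=.
rewrite !(mul0r, mulr0, mulr1, subr0, addr0, oppr0, add0r); lra.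
Qed.

Lemma rder_cis a b : rder a b cis (fun t => cis t * 'i%C).
Proof.
move=> t _ e e0; have [d d0 hd] := cis_expansion0 e0; exists d => // s _ hs.
have -> : cis s - cis t - (s - t)%:C%C * (cis t * 'i%C) =
    cis t * (cis (s - t) - 1 - (s - t)%:C%C * 'i%C).
  have -> : cis s = cis (s - t) * cis t by rewrite -cisD subrK.
  by ring.
by rewrite normcM normc_cis mul1r; exact: hd.
Qed.

Lemma cis_lip s t : normc (cis s - cis t) <= `|s - t|.
Proof.
wlog st : s t / t <= s => [hw|].
  have [/hw//|/ltW/hw] := leP t s; by rewrite normcBC distrC.
rewrite ger0_norm ?subr_ge0// -[_ - t]mul1r.
apply: rder_le (@rder_cis t s) _ => // u _.
by rewrite normcM normc_cis normci mul1r.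
Qed.

Lemma cexpD z w : cexp (z + w) = cexp z * cexp w.
Proof.
rewrite /cexp !raddfD /= expRD cisD rmorphM /=.
by rewrite -!mulrA; congr (_ * _); rewrite mulrCA.
Qed.

Lemma cexp_Complex (x y : R) : cexp (Complex x y) = polar (expR x) y.
Proof. by rewrite polarE. Qed.

Lemma cderiv_cexp z : cderiv cexp z (cexp z).
Proof.
apply/cderivP => e e0; set n := normc (cexp z).
have n0 : 0 <= n by exact: normc_ge0.
pose e1 := e / (n + 1) / 4.
have e10 : 0 < e1 by rewrite /e1 !divr_gt0//; lra.
have [d1 d10 h1] := derivable_expansion (@derivable_expR R 0) e10.
rewrite derive1E (@derive_val _ _ _ _ _ _ _ (is_derive_expR 0)) expR0 in h1.
have [d2 d20 h2] := cis_expansion0 e10.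
exists (Num.min (Num.min d1 d2) (Num.min 1 e1)).
  by rewrite !lt_min d10 d20 ltr01.
move=> w; rewrite !lt_min => /andP[/andP[k1 k2] /andP[k3 k4]].
set k := w - z in k1 k2 k3 k4 *.
have -> : cexp w - cexp z - cexp z * k = cexp z * (cexp k - 1 - k).
  have -> : cexp w = cexp k * cexp z by rewrite -cexpD subrK.
  by ring.
rewrite normcM -/n.
suff : normc (cexp k - 1 - k) <= 4 * e1 * normc k.
  move=> /(ler_wpM2l n0) h; apply: le_trans h _.
  rewrite mulrA ler_wpM2r ?normc_ge0// /e1.
  have -> : n * (4 * (e / (n + 1) / 4)) = e * (n / (n + 1)) by field; lra.
  by rewrite ger_pMr// ler_pdivrMr; lra.
have ha := normc_Re k; have hb := normc_Im k.
have kE : k = (complex.Re k)%:C%C + (complex.Im k)%:C%C * 'i%C.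
  by rewrite -Complex_v; case: (k).
have {}h1 : `|expR (complex.Re k) - 1 - complex.Re k| <= e1 * `|complex.Re k|.
  by have := h1 (complex.Re k); rewrite !subr0 mulr1; apply; exact: le_lt_trans k1.
have {}h2 := h2 _ (le_lt_trans hb k2).
have -> : cexp k - 1 - k = (expR (complex.Re k))%:C%C * cis (complex.Im k) - 1 -
    ((complex.Re k)%:C%C + (complex.Im k)%:C%C * 'i%C) by rewrite -kE.
move: (complex.Re k) (complex.Im k) (normc k) (normc_ge0 k) h1 h2 ha hb k3 k4.
move=> a b N q0 h1 h2 ha hb k3 k4 {kE k1 k2}.
(* The three terms are at most [e1 * N], [2 * e1 * N] and [e1 * N], the last because [|a| <= e1];
   this explains the factor 4 in [e1]. *)
have -> : (expR a)%:C%C * cis b - 1 - (a%:C%C + b%:C%C * 'i%C) =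
  (expR a - 1 - a)%:C%C * cis b + (1 + a)%:C%C * (cis b - 1 - b%:C%C * 'i%C)
  + a%:C%C * (b%:C%C * 'i%C).
  by rewrite !rmorphB rmorphD /=; ring.
apply: le_trans (normcD _ _) _; apply: le_trans (lerD (normcD _ _) (lexx _)) _.
rewrite !(normcM, normcR) normc_cis normci !mulr1.
have q1 : `|1 + a| <= 2 by apply: le_trans (ler_normD _ _) _; rewrite normr1; lra.
have q2 : `|1 + a| * normc (cis b - 1 - b%:C%C * 'i%C) <= 2 * (e1 * N).
  apply: ler_pM => //; first exact: normc_ge0.
  by apply: le_trans h2 _; apply: ler_wpM2l => //; exact: ltW.
have q3 : `|a| * `|b| <= e1 * N by apply: ler_pM => //; lra.
have q4 : e1 * `|a| <= e1 * N by apply: ler_wpM2l => //; exact: ltW.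
lra.
Qed.

Lemma polar_lip (r s t : R) : 0 <= r -> normc (polar r s - polar r t) <= r * `|s - t|.
Proof.
move=> r0; rewrite !polarE -mulrBr normcM normcR ger0_norm//.
by rewrite ler_wpM2l// cis_lip.
Qed.

Lemma rcont_circle (F : C -> C) (r : R) a b : 0 < r ->
  (forall w, normc w = r -> ccont F w) -> rcont a b (fun t => F (polar r t)).
Proof.
move=> r0 cF t _ e e0; have [d d0 hd] := cF (polar r t) (normc_polar _ (ltW r0)) e e0.
exists (d / r) => [|s _ hs]; first by rewrite divr_gt0.
apply: hd; apply: le_lt_trans (polar_lip _ _ (ltW r0)) _.
by rewrite mulrC -ltr_pdivlMr.
Qed.

End ComplexExponential.


(** * Means over circles and Cauchy's formula *)

Section CircleMeans.
Variable R : realType.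
Local Notation C := R[i].
Implicit Types (r s : R) (F G : C -> C) (z w : C).

Lemma rcont_bounded a b (g : R -> C) : a <= b -> rcont a b g ->
  exists2 M : R, 0 <= M & forall t, a <= t <= b -> normc (g t) <= M.
Proof.
move=> ab cg.
pose P a' b' (c' d' : R) := a <= a' -> b' <= b ->
  exists2 M : R, 0 <= M & forall t, a' <= t <= b' -> normc (g t) <= M.
have : P a b 0 0.
  apply: rect_ind => //.
    move=> a1 b1 c1 d1 h1 h2 _ _ aa bb.
    have [leab|] := leP a1 b1; last first.
      by move=> ba; exists 0 => // t; lra.
    have [M1 M10 hM1] := h1 ltac:(lra) ltac:(lra).
    have [M2 M20 hM2] := h2 ltac:(lra) ltac:(lra).
    exists (M1 + M2) => [|t ht]; first by lra.
    have [tm|tm] := leP t ((a1 + b1) / 2).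
      by have := hM1 t ltac:(lra); lra.
    by have := hM2 t ltac:(lra); lra.
  move=> x y hx _; have [d d0 hd] := cg x hx 1 ltr01.
  exists d => // a1 b1 c1 d1 h1 h2 _ _ hd1 _ _ _.
  exists (normc (g x) + 1) => [|t ht]; first by have := normc_ge0 (g x); lra.
  have : normc (g t - g x) < 1.
    by apply: hd; [lra|rewrite ltr_norml; apply/andP; split; lra].
  by have := lerB_normc (g t) (g x); lra.
by case=> // M M0 hM; exists M.
Qed.

(** The mean of [F] over the circle of radius [r], read off from any primitive of $t\mapsto
    F(re^{it})$; the value does not depend on the primitive by [rder_uniq]. The default [0] is taken
    when there is no primitive. *)
Definition circ r F : C := xget 0 [set M : C | exists2 V : R -> C,
  rder 0 (2 * pi) V (fun t => F (polar r t)) &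
  M = (V (2 * pi) - V 0) / (2 * pi)%:C%C].

Lemma twopi_gt0 : 0 < 2 * pi :> R.
Proof. by rewrite mulr_gt0// pi_gt0. Qed.

Lemma twopiC_neq0 : (2 * pi : R)%:C%C != 0 :> C.
Proof. by rewrite -normc_gt0 normcR gtr0_norm twopi_gt0. Qed.

Lemma circE r F V : rder 0 (2 * pi) V (fun t => F (polar r t)) ->
  circ r F = (V (2 * pi) - V 0) / (2 * pi)%:C%C.
Proof.
move=> dV; rewrite /circ; case: xgetP => [M _ [V' dV' ->]|/(_ ((V (2 * pi) - V 0) / (2 * pi)%:C%C))].
  by rewrite (rder_uniq (ltW twopi_gt0) dV' dV).
by case; exists V.
Qed.

Lemma circ_eq r F G : 0 <= r ->
  (forall w, normc w = r -> F w = G w) -> circ r F = circ r G.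
Proof.
move=> r0 FG; rewrite /circ.
have -> // : (fun t => F (polar r t)) = (fun t => G (polar r t)).
by apply/funext => t; rewrite FG// normc_polar.
Qed.

Lemma circ_rder r F : 0 < r -> (forall w, normc w = r -> ccont F w) ->
  exists V, rder 0 (2 * pi) V (fun t => F (polar r t)).
Proof. by move=> r0 cF; apply: (rder_exists twopi_gt0); exact: rcont_circle. Qed.

Lemma circ_lin r F G (k : C) : 0 < r -> (forall w, normc w = r -> ccont F w) ->
  (forall w, normc w = r -> ccont G w) ->
  circ r (fun w => F w + k * G w) = circ r F + k * circ r G.
Proof.
move=> r0 cF cG; have [V dV] := circ_rder r0 cF; have [W dW] := circ_rder r0 cG.
rewrite (circE dV) (circE dW) (circE (rder_lin k dV dW)).
by have := twopiC_neq0; move: ((2 * pi)%:C%C) => p p0; field.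
Qed.

Lemma circ_cst r (k : C) : circ r (fun=> k) = k.
Proof.
rewrite (@circE r _ (fun t => t%:C%C * k)).
  by rewrite mul0r subr0 mulrAC divff ?mul1r// twopiC_neq0.
move=> t _ e e0; exists 1 => // s _ _.
by rewrite rmorphB /= -mulrBl subrr normc0 mulr_ge0// ltW.
Qed.

Lemma circ_le r F (M : R) : 0 < r -> (forall w, normc w = r -> ccont F w) ->
  (forall w, normc w = r -> normc (F w) <= M) -> normc (circ r F) <= M.
Proof.
move=> r0 cF hM; have [V dV] := circ_rder r0 cF; rewrite (circE dV).
have p0 := twopi_gt0.
rewrite normcM normcV normcR gtr0_norm// ler_pdivrMr//.
rewrite -[in leRHS](subr0 (2 * pi)); apply: rder_le dV _; first exact: ltW.
by move=> t _; apply: hM; rewrite normc_polar// ltW.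
Qed.

(** For [h], the composite of [F] with [cexp], the two horizontal sides cancel by the period $2\pi
    i$, and the vertical ones are $2\pi i$ times the two means. *)
Lemma circ_annulus r s F : 0 < r -> r < s ->
  (forall w, r <= normc w <= s -> ccont F w) ->
  (forall w, r < normc w < s -> exists l, cderiv F w l) ->
  circ r F = circ s F.
Proof.
move=> r0 rs cF dF; have s0 : 0 < s by exact: lt_trans rs.
pose h z := F (cexp z); pose a := ln r; pose b := ln s.
have ab : a < b by rewrite ltr_ln ?posrE.
have ea : expR a = r by rewrite lnK ?posrE.
have eb : expR b = s by rewrite lnK ?posrE.
have nexp x y : normc (cexp (Complex x y)) = expR x.
  by rewrite cexp_Complex normc_polar// ltW// expR_gt0.
have ch x y : a <= x <= b -> ccont h (Complex x y).
  move=> hx; apply: ccont_comp; first exact: cderiv_cont (cderiv_cexp _).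
  by apply: cF; rewrite nexp -ea -eb !ler_expR.
have dh x y : a < x < b -> exists l, cderiv h (Complex x y) l.
  move=> hx; have [|l dl] := dF (cexp (Complex x y)).
    by rewrite nexp -ea -eb !ltr_expR.
  by eexists; apply: cderiv_comp dl; exact: cderiv_cexp.
have ccont_line (q u : C) (c d : R) (g : C -> C) : normc u = 1 ->
    (forall t, c <= t <= d -> ccont g (q + t%:C%C * u)) ->
    rcont c d (fun t => g (q + t%:C%C * u)).
  move=> u1 cg t ht e e0; have [de de0 hde] := cg t ht e e0.
  exists de => // t' _ tt; apply: hde.
  rewrite (_ : _ - _ = (t' - t)%:C%C * u); last by rewrite rmorphB /=; ring.
  by rewrite normcM normcR u1 mulr1.
have /choice[V hV] x : exists V, a <= x <= b ->
    rder 0 (2 * pi) V (fun y => 'i%C * h (Complex x y)).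
  have [hx|nx] := pselect (a <= x <= b); last by exists (fun=> 0).
  have [|V dV] := @rder_exists R 0 (2 * pi) (fun y => 'i%C * h (x%:C%C + y%:C%C * 'i%C)) twopi_gt0.
    apply: (@ccont_line _ _ _ _ (fun w => 'i%C * h w)); first exact: normci.
    by move=> t _; apply: ccontM; [exact: ccont_cst|rewrite -Complex_v; exact: ch].
  by exists V => _; apply: rder_eq dV => y _; rewrite -Complex_v.
have /choice[H hH] y : exists H, rder a b H (fun x => h (Complex x y)).
  have [|H dH] := @rder_exists R a b (fun x => h (Complex 0 y + x%:C%C * 1)) ab.
    apply: (@ccont_line _ _ _ _ h); first exact: normc1.
    by move=> t ht; rewrite -Complex_h; exact: ch.
  by exists H; apply: rder_eq dH => x _; rewrite -Complex_h.
have := @goursat R h (fun x y => H y x) V a b 0 (2 * pi) ab (ltW twopi_gt0)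
  (fun x y hx _ => ch x y hx) (fun x y hx _ => dh x y hx) (fun y _ => hH y) hV.
rewrite /rect_incr.
have -> : H 0 b - H 0 a = H (2 * pi) b - H (2 * pi) a.
  apply: rder_uniq (hH 0) _; first exact: ltW.
  apply: rder_eq (hH (2 * pi)) => x _; rewrite /h !cexp_Complex !polarE cis2pi.
  by rewrite cis0.
rewrite subrr add0r => /eqP; rewrite subr_eq0 => /eqP VV.
have i0 : 'i%C != 0 :> C by rewrite -normc_gt0 normci.
have circV x : a <= x <= b ->
    'i%C * circ (expR x) F = (V x (2 * pi) - V x 0) / (2 * pi)%:C%C.
  move=> hx; rewrite -(@circE (expR x) (fun w => 'i%C * F w)); last first.
    by apply: rder_eq (hV x hx) => y _; rewrite /h cexp_Complex.
  have := @circ_lin (expR x) (fun=> 0) F 'i%C (expR_gt0 x).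
  rewrite circ_cst add0r => <-; first by apply: circ_eq => [|w _]; rewrite ?add0r ?expR_ge0.
  - by move=> w _; exact: ccont_cst.
  - by move=> w hw; apply: cF; rewrite hw -ea -eb !ler_expR.
apply: (mulfI i0); rewrite -{1}ea -eb !circV ?VV//; first by rewrite lexx ltW.
by rewrite lexx ltW.
Qed.

Lemma circ_small F : ccont F 0 -> forall e : R, 0 < e ->
  exists2 d : R, 0 < d & forall s, 0 < s -> s < d ->
    (forall w, normc w = s -> ccont F w) -> normc (circ s F - F 0) <= e.
Proof.
move=> c0 e e0; have [d d0 hd] := c0 e e0; exists d => // s s0 sd cF.
have -> : circ s F - F 0 = circ s (fun w => F w + (-1) * F 0).
  by rewrite (@circ_lin s F (fun=> F 0))// ?circ_cst ?mulN1r// => w _; exact: ccont_cst.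
apply: circ_le => // w hw.
  by apply: ccontD; [exact: cF|exact: ccont_cst].
by rewrite mulN1r ltW// hd// subr0 hw.
Qed.

(** The circle of radius [a] may carry points where [F] is merely continuous. The annuli on its two
    sides are treated separately, and the inner radius is then shrunk to [0], where continuity gives
    the value. *)
Lemma circ_mean_value r a F : 0 < r ->
  (forall w, normc w <= r -> ccont F w) ->
  (forall w, normc w < r -> normc w != a -> exists l, cderiv F w l) ->
  circ r F = F 0.
Proof.
move=> r0 cF dF; apply/eqP; rewrite -subr_eq0; apply/eqP/normc_small0 => e e0.
have [d d0 hd] := circ_small (cF 0 ltac:(rewrite normc0; lra)) e0.
pose a' := if 0 < a < r then a else r.
have a'0 : 0 < a' <= r by rewrite /a'; case: ifP => //; lra.
pose s := Num.min d a' / 2.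
have sd : 0 < s < d /\ s < a'.
  by rewrite /s; have [] := leP d a'; move=> ?; split; lra.
have <- : circ s F = circ r F.
  transitivity (circ a' F).
    apply: circ_annulus; [lra|lra|by move=> w hw; apply: cF; lra|].
    move=> w hw; apply: dF; first lra.
    apply/eqP => wa; move: hw; rewrite /a'; case: ifPn; rewrite wa; lra.
  rewrite /a'; case: ifP => // ha.
  apply: circ_annulus; [lra|lra|by move=> w hw; apply: cF; lra|].
  by move=> w hw; apply: dF; [lra|apply/eqP; lra].
by apply: hd; [lra|lra|move=> w hw; apply: cF; lra].
Qed.

Lemma ccont_kernel z w : w != z -> ccont (fun w => (w - z)^-1) w.
Proof.
move=> wz; apply: ccontV; last by rewrite subr_eq0.
by apply: ccontB; [exact: ccont_id|exact: ccont_cst].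
Qed.

Lemma cderiv_kernel z w : w != z -> exists l, cderiv (fun w => (w - z)^-1) w l.
Proof.
move=> wz; have wz0 : w - z != 0 by rewrite subr_eq0.
eexists; apply: (@cderiv_comp _ (fun u => u^-1) (fun u => u - z)).
  apply: cderivD; [exact: cderiv_id|exact: cderiv_cst].
exact: cderivV_id.
Qed.

Lemma normc_neq z w : normc z < normc w -> w != z.
Proof. by apply: contraTneq => ->; rewrite ltxx. Qed.

(** The mean is the same on every larger circle, where the function differs from 1 by [z / (w - z)].
    The radius [s] is chosen so that [s - normc z >= normc z / e], which makes this at most [e]. *)
Lemma circ_kernel r z : normc z < r -> circ r (fun w => w / (w - z)) = 1.
Proof.
move=> zr; have z0 := normc_ge0 z; have r0 : 0 < r by lra.
apply/eqP; rewrite -subr_eq0; apply/eqP/normc_small0 => e e0.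
pose s := r + normc z / e + normc z.
have ze : 0 <= normc z / e by rewrite divr_ge0// ltW.
have cK w : normc z < normc w -> ccont (fun w => w / (w - z)) w.
  by move=> h; apply: ccontM; [exact: ccont_id|apply: ccont_kernel; exact: normc_neq].
have zs : normc z < s by rewrite /s; lra.
have -> : circ r (fun w => w / (w - z)) = circ s (fun w => w / (w - z)).
  have [->//|rs] := eqVneq r s.
  have {}rs : r < s by rewrite lt_neqAle rs /s; lra.
  apply: circ_annulus => // w hw; first by apply: cK; lra.
  have [|l hl] := @cderiv_kernel z w; first by apply: normc_neq; lra.
  by eexists; apply: cderivM hl; exact: cderiv_id.
have s0 : 0 < s by lra.
have -> : circ s (fun w => w / (w - z)) - 1 = circ s (fun w => w / (w - z) + (-1) * 1).
  rewrite (@circ_lin s _ (fun=> 1))// ?circ_cst ?mulN1r// => w hw.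
    by apply: cK; rewrite hw.
  exact: ccont_cst.
apply: circ_le => // w hw.
  by apply: ccontD; [apply: cK; rewrite hw|exact: ccont_cst].
have wz : w - z != 0 by rewrite subr_eq0; apply: normc_neq; rewrite hw.
have -> : w / (w - z) + -1 * 1 = z / (w - z) by field.
rewrite normcM normcV ler_pdivrMr ?normc_gt0// mulrC -ler_pdivrMr//.
by have := lerB_normc w z; rewrite hw /s; lra.
Qed.

(** The mean value property is applied to [w * q w], with [q] the difference quotient of [f] at [z],
    completed by the derivative. It vanishes at [0], and the point [z], where only continuity of [q]
    is known, lies on the exceptional circle of radius [normc z]. *)
Lemma cauchy_formula f r z : holD f -> normc z < r -> r < 1 ->
  f z = circ r (fun w => w * f w / (w - z)).
Proof.
move=> hf zr r1; have r0 : 0 < r by apply: le_lt_trans zr; exact: normc_ge0.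
have zD : inD z by rewrite /inD; lra.
have [l [p [cp pz hp]]] := (holDP f).1 hf z zD.
pose q w := if w == z then l else (f w - f z) / (w - z).
have cq w : inD w -> w != z -> exists k, cderiv q w k.
  move=> wD wz; have [k dk] := (holDP f).1 hf w wD.
  have [k' dk'] := cderiv_kernel wz.
  have d1 := cderivM (cderivD dk (cderiv_cst (- f z) w)) dk'.
  eexists; apply: cderiv_near d1.
  exists (normc (z - w)) => [|u]; first by rewrite normc_gt0 subr_eq0 eq_sym.
  by rewrite /q; case: eqP => // ->; rewrite ltxx.
have cq' w : inD w -> ccont q w.
  move=> wD; have [->|/(cq w wD)[k /cderiv_cont//]] := eqVneq w z.
  apply: ccont_near cp; apply: cnearS hp => u; rewrite /q.
  case: eqP => [->//|/eqP uz] ->; rewrite mulfK// subr_eq0//.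
have c1 w : normc w <= r -> ccont (fun w => w * q w) w.
  by move=> wr; apply: ccontM; [exact: ccont_id|apply: cq'; rewrite /inD; lra].
have c2 w : normc w < r -> normc w != normc z ->
    exists k, cderiv (fun w => w * q w) w k.
  move=> wr wz; have [||k hk] := cq w; first by rewrite /inD; lra.
    by apply: contraNneq wz => ->.
  by eexists; apply: cderivM hk; exact: cderiv_id.
have := circ_mean_value r0 c1 c2; rewrite mul0r.
have wz w : normc w = r -> w != z by move=> h; apply: normc_neq; rewrite h.
rewrite (@circ_eq r _ (fun w => w * f w / (w - z) + (- f z) * (w / (w - z)))) ?ltW//; last first.
  move=> w /wz h; rewrite /q (negbTE h); field; by rewrite subr_eq0.
rewrite circ_lin// ?circ_kernel//.
- by move=> /eqP; rewrite mulr1 subr_eq0 => /eqP <-.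
- move=> w hw; apply: ccontM; last by apply: ccont_kernel; exact: wz.
  apply: ccontM; [exact: ccont_id|].
  by apply: holD_cont => //; rewrite /inD; lra.
- by move=> w hw; apply: ccontM; [exact: ccont_id|apply: ccont_kernel; exact: wz].
Qed.
End CircleMeans.


(** * Cauchy estimates, locally uniform limits and division by a zero *)

Section CauchyConsequences.
Variable R : realType.
Local Notation C := R[i].
Implicit Types (r s : R) (f g phi : C -> C) (z w a : C).


Lemma circle_polar r w : 0 < r -> normc w = r ->
  exists2 t : R, 0 <= t <= 2 * pi & w = polar r t.
Proof.
move=> r0 wr; have r0' : r != 0 by rewrite gt_eqF.
case: w wr => x y wr.
have hsq : (x / r) ^+ 2 + (y / r) ^+ 2 = 1.
  have := normc_sqr (Complex x y); rewrite wr /= => h.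
  by rewrite !expr_div_n -mulrDl -h divff// expf_neq0.
have hx : -1 <= x / r <= 1 by have := sqr_ge0 (y / r); nra.
have ac : cos (acos (x / r)) = x / r by rewrite acosK// in_itv.
have a0 := acos_ge0 hx; have a1 := acos_lepi hx.
have sn := sin_acos hx.
have sq : Num.sqrt (1 - (x / r) ^+ 2) = `|y / r| by rewrite -hsq addrAC subrr add0r sqrtr_sqr.
rewrite {}sq in sn.
have [y0|y0] := leP 0 (y / r).
  exists (acos (x / r)); first by lra.
  rewrite /polar ac sn ger0_norm//; congr Complex; by field.
exists (2 * pi - acos (x / r)); first by lra.
have -> : 2 * pi = pi *+ 2 :> R by rewrite mulrC mulr_natr.
rewrite /polar addrC cosD2pi sinD2pi cosN sinN ac sn ltr0_norm// opprK.
by congr Complex; field.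
Qed.

Lemma circle_bounded phi r : 0 < r -> (forall w, normc w = r -> ccont phi w) ->
  exists2 M : R, 0 <= M & forall w, normc w = r -> normc (phi w) <= M.
Proof.
move=> r0 cphi.
have [M M0 hM] := rcont_bounded (ltW (@twopi_gt0 R)) (rcont_circle r0 cphi).
by exists M => // w /(circle_polar r0)[t ht ->]; exact: hM.
Qed.

(** Cauchy's formula with $|w-z|\ge r-|z|$, in place of the maximum principle. The extra factor
    depends on the radii alone, so it does no harm to geometric rates. *)
Lemma maximum_bound f r z (M : R) : holD f -> normc z < r -> r < 1 ->
  (forall w, normc w = r -> normc (f w) <= M) ->
  normc (f z) <= r / (r - normc z) * M.
Proof.
move=> hf zr r1 hM; have r0 : 0 < r by apply: le_lt_trans zr; exact: normc_ge0.
rewrite (cauchy_formula hf zr r1).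
have wz w : normc w = r -> w != z by move=> h; apply: normc_neq; rewrite h.
apply: circ_le => // w hw.
  apply: ccontM; last by apply: ccont_kernel; exact: wz.
  apply: ccontM; first exact: ccont_id.
  by apply: holD_cont => //; rewrite /inD hw.
rewrite !normcM normcV hw -mulrA -[leRHS]mulrA ler_wpM2l ?(ltW r0)//.
have M0 : 0 <= M by apply: le_trans (hM w hw); exact: normc_ge0.
have wz0 : 0 < normc (w - z) by rewrite normc_gt0 subr_eq0; exact: wz.
have d : r - normc z <= normc (w - z) by rewrite -{1}hw lerB_normc.
rewrite mulrC; apply: ler_pM; rewrite ?invr_ge0 ?normc_ge0 ?hM//.
by rewrite lef_pV2 ?posrE// subr_gt0.
Qed.

(** The derivative is the mean of $\phi/(w-z)^2$; the remainder is $(u-z)^2$ times the mean of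
    $\phi/((w-z)^2(w-u))$. For [u] within [d] of [z] all three linear factors in the denominator
    have modulus at least [d]. *)
Lemma cderiv_cauchy_integral phi r z : 0 < r ->
  (forall w, normc w = r -> ccont phi w) -> normc z < r ->
  exists l, cderiv (fun u => circ r (fun w => phi w / (w - u))) z l.
Proof.
move=> r0 cphi zr; have [M M0 hM] := circle_bounded r0 cphi.
pose K u w : C := phi w / (w - u).
pose K2 w : C := phi w * ((w - z)^-1 * (w - z)^-1).
have ne u w : normc u < r -> normc w = r -> w != u.
  by move=> ur wr; apply: normc_neq; rewrite wr.
have cK u w : normc u < r -> normc w = r -> ccont (K u) w.
  move=> ur wr; apply: ccontM; first exact: cphi.
  by apply: ccont_kernel; exact: ne.
have cK2 w : normc w = r -> ccont K2 w.
  move=> wr; apply: ccontM; first exact: cphi.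
  by apply: ccontM; apply: ccont_kernel; exact: ne.
exists (circ r K2); apply/cderivP => e e0.
pose d := (r - normc z) / 2.
have d0 : 0 < d by rewrite /d; lra.
have cc : 0 < M / (d * d * d) + 1.
  have d3 : 0 <= d * d * d by have := ltW d0; move: (d) => x x0; rewrite !mulr_ge0.
  by have := divr_ge0 M0 d3; lra.
exists (Num.min d (e / (M / (d * d * d) + 1))); first by rewrite lt_min d0 divr_gt0.
move=> u; rewrite lt_min => /andP[u1 u2].
have ur : normc u < r.
  by have := lerB_normc u z; rewrite /d in u1; lra.
have -> : circ r (K u) - circ r (K z) - circ r K2 * (u - z) =
    circ r (fun w => (K u w + (-1) * K z w) + (- (u - z)) * K2 w).
  rewrite circ_lin//; last first.
    move=> w wr; apply: ccontD; first exact: cK.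
    by apply: ccontM; [exact: ccont_cst|exact: cK].
  rewrite circ_lin//; [by ring|by move=> w; exact: cK|by move=> w; exact: cK].
have -> : circ r (fun w => (K u w + (-1) * K z w) + (- (u - z)) * K2 w) =
    circ r (fun w => 0 + ((u - z) * (u - z)) * (K2 w / (w - u))).
  apply: circ_eq => [|w wr]; first exact: ltW.
  have h1 : w - u != 0 by rewrite subr_eq0; exact: ne.
  have h2 : w - z != 0 by rewrite subr_eq0; exact: ne.
  by rewrite /K /K2; field; rewrite h1 h2.
have cK3 w : normc w = r -> ccont (fun w => K2 w / (w - u)) w.
  move=> wr; apply: ccontM; first exact: cK2.
  by apply: ccont_kernel; exact: ne.
rewrite circ_lin ?circ_cst//; last by move=> w _; exact: ccont_cst.
rewrite add0r !normcM.
have h : normc (circ r (fun w => K2 w / (w - u))) <= M / (d * d * d).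
  apply: circ_le => // w wr; rewrite /K2 !normcM !normcV.
  have b1 : d <= normc (w - z).
    by have := lerB_normc w z; rewrite wr /d; lra.
  have b2 : d <= normc (w - u).
    have := lerB_normc w u; have := lerB_normc u z; rewrite wr.
    by move: u1; rewrite /d; lra.
  have i1 : (normc (w - z))^-1 <= d^-1 by rewrite lef_pV2 ?posrE//; lra.
  have i2 : (normc (w - u))^-1 <= d^-1 by rewrite lef_pV2 ?posrE//; lra.
  have j1 : 0 <= (normc (w - z))^-1 by rewrite invr_ge0 normc_ge0.
  have j2 : 0 <= (normc (w - u))^-1 by rewrite invr_ge0 normc_ge0.
  have i3 := ler_pM j1 j1 i1 i1.
  have i4 := ler_pM (mulr_ge0 j1 j1) j2 i3 i2.
  have := ler_pM (normc_ge0 _) (mulr_ge0 (mulr_ge0 j1 j1) j2) (hM w wr) i4.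
  by rewrite !invfM mulrA.
rewrite -mulrA [leRHS]mulrC ler_wpM2l ?normc_ge0//.
apply: le_trans (_ : normc (u - z) * (M / (d * d * d) + 1) <= _).
  by rewrite ler_wpM2l ?normc_ge0//; lra.
by rewrite -ler_pdivlMr// ltW.
Qed.

(** Cauchy's formula survives the uniform limit on a disc, and a Cauchy integral of a continuous
    function is differentiable. *)
Lemma holD_locally_uniform_limit f :
  (forall r (e : R), 0 < r < 1 -> 0 < e -> exists2 g, holD g &
     forall z, normc z <= r -> normc (f z - g z) <= e) -> holD f.
Proof.
move=> lim.
have cf z : inD z -> ccont f z.
  move=> zD e e0; have e3 : 0 < e / 3 by lra.
  have z0 := normc_ge0 z; rewrite /inD in zD.
  pose r := (normc z + 1) / 2.
  have [g hg fg] := lim r _ ltac:(rewrite /r; lra) e3.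
  have zr : normc (z - 0) < r by rewrite subr0 /r; lra.
  apply: cnearS (cnearI (cnear_ball zr) (holD_cont hg zD e3)) => w [wr gw].
  rewrite subr0 in wr.
  have -> : f w - f z = (f w - g w) + (g w - g z) - (f z - g z) by ring.
  have h1 := fg w (ltW wr); have h2 := fg z ltac:(rewrite /r; lra).
  apply: le_lt_trans (normcB _ _) _.
  by have := normcD (f w - g w) (g w - g z); lra.
have repr r z : normc z < r -> r < 1 -> f z = circ r (fun w => w * f w / (w - z)).
  move=> zr r1; have z0 := normc_ge0 z; have r0 : 0 < r by lra.
  apply/eqP; rewrite -subr_eq0; apply/eqP/normc_small0 => e e0.
  pose k := 1 + r / (r - normc z).
  have k0 : 0 < k by have : 0 <= r / (r - normc z) by [apply: divr_ge0; lra]; rewrite /k; lra.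
  have ek : 0 < e / k by rewrite divr_gt0.
  have [g hg fg] := lim r _ ltac:(lra) ek.
  have wz w : normc w = r -> w != z by move=> h; apply: normc_neq; rewrite h.
  have cK h w : (forall u, inD u -> ccont h u) -> normc w = r ->
      ccont (fun w => w * h w / (w - z)) w.
    move=> ch wr; apply: ccontM; last by apply: ccont_kernel; exact: wz.
    apply: ccontM; first exact: ccont_id.
    by apply: ch; rewrite /inD wr.
  have cg u : inD u -> ccont g u by exact: holD_cont.
  have -> : f z - circ r (fun w => w * f w / (w - z)) =
      (f z - g z) - (circ r (fun w => w * f w / (w - z) + (-1) * (w * g w / (w - z)))).
    rewrite circ_lin// ?(cauchy_formula hg zr r1); [by ring|..].
      by move=> w; exact: cK.
    by move=> w; exact: cK.
  apply: le_trans (normcB _ _) _.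
  have h1 := fg z (ltW zr).
  have h2 : normc (circ r (fun w => w * f w / (w - z) + (-1) * (w * g w / (w - z))))
      <= r / (r - normc z) * (e / k).
    apply: circ_le => // w wr.
      apply: ccontD; first exact: cK.
      by apply: ccontM; [exact: ccont_cst|exact: cK].
    have h0 : w - z != 0 by rewrite subr_eq0; exact: wz.
    have -> : w * f w / (w - z) + (-1) * (w * g w / (w - z)) =
      w / (w - z) * (f w - g w) by field.
    rewrite !normcM normcV wr; apply: ler_pM.
    - by rewrite divr_ge0 ?normc_ge0//; lra.
    - exact: normc_ge0.
    - rewrite ler_pM2l// lef_pV2 ?posrE ?normc_gt0//; last by lra.
      by have := lerB_normc w z; rewrite wr; lra.
    - by apply: fg; rewrite wr.
  apply: le_trans (lerD h1 h2) _.
  by rewrite -{1}[e / k]mul1r -mulrDl -/k mulrC divfK// gt_eqF.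
apply/holDP => z; rewrite /inD => zD; have z0 := normc_ge0 z.
pose r := (normc z + 1) / 2.
have zr : normc (z - 0) < r by rewrite subr0 /r; lra.
have [l dl] : exists l, cderiv (fun u => circ r (fun w => w * f w / (w - u))) z l.
  apply: cderiv_cauchy_integral; [rewrite /r; lra| |rewrite /r; lra].
  move=> w wr; apply: ccontM; first exact: ccont_id.
  by apply: cf; rewrite /inD wr /r; lra.
exists l; apply: cderiv_near dl; apply: cnearS (cnear_ball zr) => w.
by rewrite subr0 => wr; rewrite -repr//; rewrite /r; lra.
Qed.

(** Subtracting Cauchy's formulas at [z] and at [a] gives $f(z)/(z-a)$ as the Cauchy integral [I z]
    of [phi]. Near [a] the quotient thus agrees with [I], which is differentiable at [a] too and
    supplies the missing value. *)
Lemma holD_factor f a : holD f -> inD a -> f a = 0 ->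
  exists2 g, holD g & forall z, inD z -> f z = (z - a) * g z.
Proof.
move=> hf aD fa; have a0 := normc_ge0 a; have aD' := aD; rewrite /inD in aD.
pose r := (normc a + 1) / 2.
have ar : normc a < r by rewrite /r; lra.
have r1 : r < 1 by rewrite /r; lra.
have r0 : 0 < r by lra.
pose phi w := w * f w / (w - a).
have cphi w : normc w = r -> ccont phi w.
  move=> wr; have wa : w != a by apply: normc_neq; rewrite wr.
  apply: ccontM; last exact: ccont_kernel.
  apply: ccontM; first exact: ccont_id.
  by apply: holD_cont => //; rewrite /inD wr.
pose I z := circ r (fun w => phi w / (w - z)).
pose g z := if z == a then I a else f z / (z - a).
have gI z : normc z < r -> I z = g z.
  rewrite /g; case: eqP => [->//|/eqP za] zr.
  have za0 : z - a != 0 by rewrite subr_eq0.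
  have cw b w : normc b < r -> normc w = r -> ccont (fun w => w * f w / (w - b)) w.
    move=> br wr; have wb : w != b by apply: normc_neq; rewrite wr.
    apply: ccontM; last exact: ccont_kernel.
    apply: ccontM; first exact: ccont_id.
    by apply: holD_cont => //; rewrite /inD wr.
  have <- : f z - f a = f z by rewrite fa subr0.
  rewrite (cauchy_formula hf zr r1) (cauchy_formula hf ar r1).
  have -> : circ r (fun w => w * f w / (w - z)) - circ r (fun w => w * f w / (w - a))
     = circ r (fun w => w * f w / (w - z) + (-1) * (w * f w / (w - a))).
    rewrite (circ_lin (-1) r0 (fun w => cw z w zr) (fun w => cw a w ar)); ring.
  rewrite (@circ_eq _ r _ (fun w => 0 + (z - a) * (phi w / (w - z)))) ?ltW//; last first.
    move=> w wr; have w1 : w - z != 0 by rewrite subr_eq0 normc_neq// wr.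
    have w2 : w - a != 0 by rewrite subr_eq0 normc_neq// wr.
    by rewrite /phi; field; rewrite w1 w2.
  rewrite circ_lin ?circ_cst// ?add0r; first by rewrite mulrC mulKf.
    by move=> w _; exact: ccont_cst.
  move=> w wr; apply: ccontM; first exact: cphi.
  by apply: ccont_kernel; apply: normc_neq; rewrite wr.
exists g; last first.
  move=> z zD; rewrite /g; case: eqP => [->|/eqP za]; first by rewrite fa subrr mul0r.
  by rewrite mulrC divfK// subr_eq0.
apply/holDP => z zD; have [->|za] := eqVneq z a.
  have [l dl] := cderiv_cauchy_integral r0 cphi ar.
  exists l; apply: cderiv_near dl.
  have ar' : normc (a - 0) < r by rewrite subr0.
  by apply: cnearS (cnear_ball ar') => w; rewrite subr0; exact: gI.
have [l dl] := (holDP f).1 hf z zD; have [k dk] := cderiv_kernel za.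
exists (l * (z - a)^-1 + f z * k); apply: cderiv_near (cderivM dl dk).
exists (normc (a - z)) => [|u]; first by rewrite normc_gt0 subr_eq0 eq_sym.
by rewrite /g; case: eqP => // ->; rewrite ltxx.
Qed.

End CauchyConsequences.


(** * Density of the powers of an irrational rotation; roots of unity *)

Section IrrationalRotation.
Variable R : realType.
Local Notation C := R[i].

Lemma unit_cis (w : C) : normc w = 1 -> exists2 t : R, 0 <= t <= 2 * pi & w = cis t.
Proof.
move=> /(circle_polar ltr01)[t ht ->]; exists t => //.
by rewrite polarE mul1r.
Qed.

Lemma cis_2pin n : cis (2 * pi * n%:R : R) = 1.
Proof. by rewrite mulrC -cisX cis2pi expr1n. Qed.

Lemma truncn_bounds (x : R) : 0 <= x -> (Num.truncn x)%:R <= x < (Num.truncn x)%:R + 1.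
Proof. by move=> x0; rewrite natr1; exact: truncn_itv. Qed.

(** Dirichlet's box principle: among [N + 2] fractional parts of $ka/2\pi$ two fall into the same of
    [N + 1] boxes, and the difference of the indices is [d]. The angle is nonzero because no
    positive power of [beta] is 1. *)
Lemma small_rotation (beta : C) : normc beta = 1 ->
  (forall n : nat, (0 < n)%N -> beta ^+ n != 1) ->
  forall e : R, 0 < e -> exists d (theta : R),
    [/\ beta ^+ d = cis theta, theta != 0 & `|theta| < e].
Proof.
move=> b1 irr e e0; have [a /andP[a0 _] ba] := unit_cis b1.
have p0 := twopi_gt0 R.
pose N := (Num.truncn (2 * pi / e)).
have Ne : 2 * pi / N.+1%:R < e.
  rewrite ltr_pdivrMr// [ltRHS]mulrC -ltr_pdivrMr//.
  by have /andP[_] := truncn_bounds (ltW (divr_gt0 p0 e0)); rewrite natr1.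
pose y k : R := k%:R * a / (2 * pi).
have y0 k : 0 <= y k by apply: divr_ge0; [exact: mulr_ge0|exact: ltW].
pose x k : R := y k - (Num.truncn (y k))%:R.
have x01 k : 0 <= x k < 1 by have := truncn_bounds (y0 k); rewrite /x; lra.
pose u k := Num.truncn (N.+1%:R * x k).
have Nx0 k : 0 <= N.+1%:R * x k.
  by apply: mulr_ge0 => //; have := x01 k; lra.
have uN k : (u k < N.+1)%N.
  rewrite /u -(ltr_nat R); have /andP[h _] := truncn_bounds (Nx0 k).
  apply: le_lt_trans h _; rewrite gtr_pMr ?ltr0Sn//; have := x01 k; lra.
have [p [q [pq upq]]] : exists p q, (p < q)%N /\ u p = u q.
  apply: contrapT => /forallNP no.
  have inj : injective (fun k : 'I_N.+2 => Ordinal (uN k)).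
    move=> i j /(congr1 val) /= uij; apply: val_inj.
    have [ij|ji|//] := ltngtP i j; exfalso.
      by apply: (no i); exists j.
    by apply: (no j); exists i.
  by have := leq_card _ inj; rewrite !card_ord ltnn.
have xpq : `|x q - x p| < N.+1%:R^-1.
  have h1 := truncn_bounds (Nx0 p); have h2 := truncn_bounds (Nx0 q).
  rewrite -/(u p) -/(u q) upq in h1 h2.
  rewrite -[ltRHS]mul1r ltr_pdivlMr ?ltr0Sn// mulrC.
  rewrite -[X in X * _]gtr0_norm ?ltr0Sn// -normrM mulrBr ltr_norml.
  by apply/andP; split; lra.
pose theta := 2 * pi * (x q - x p).
have key : (q - p)%:R * a = 2 * pi * ((Num.truncn (y q))%:R - (Num.truncn (y p))%:R) + theta.
  rewrite /theta /x /y natrB ?(ltnW pq)//; have := gt_eqF p0.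
  by move: (2 * pi) => T T0; field; rewrite T0.
have ypq : (Num.truncn (y p) <= Num.truncn (y q))%N.
  apply: le_truncn; rewrite /y ler_pM2r ?invr_gt0// ler_wpM2r//.
  by rewrite ler_nat ltnW.
have bq : beta ^+ (q - p) = cis theta.
  by rewrite ba cisX key -natrB// cisD cis_2pin mul1r.
exists (q - p)%N, theta; split => //.
  apply: contraNneq (irr (q - p)%N ltac:(by rewrite subn_gt0)) => th0.
  by rewrite bq th0 cis0.
apply: lt_trans Ne; rewrite /theta normrM gtr0_norm//.
by rewrite ltr_pM2l.
Qed.

(** Multiples of a small angle [th] sweep the circle in at most [2 * pi / |th|] steps, so the
    exponent is bounded independently of [w]. This uniformity is what later leaves finitely many
    right-hand sides $z^k$. *)
Lemma rotation_dense (beta : C) : normc beta = 1 ->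
  (forall n : nat, (0 < n)%N -> beta ^+ n != 1) ->
  forall e : R, 0 < e -> exists K : nat, forall w, normc w = 1 ->
    exists2 k, (k <= K)%N & normc (beta ^+ k - w) < e.
Proof.
move=> b1 irr e e0; have [d [th [bd th0 the]]] := small_rotation b1 irr e0.
have p0 := twopi_gt0 R; have t0 : 0 < `|th| by rewrite normr_gt0.
exists (d * Num.truncn (2 * pi / `|th|))%N => w /unit_cis[phi hphi ->].
have [psi hpsi hw] : exists2 psi, 0 <= psi <= 2 * pi &
    cis phi = cis (Num.sg th * psi).
  (* For negative [th] the target angle is approached in the other direction, hence
     [2 * pi - phi]. *)
  have [thp|thn|th00] := ltrgt0P th; last by rewrite th00 eqxx in th0.
    by exists phi => //; rewrite gtr0_sg// mul1r.
  exists (2 * pi - phi); first by lra.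
  by rewrite ltr0_sg// mulN1r opprB -{1}(subrK (2 * pi) phi) cisD cis2pi mulr1.
pose i := Num.truncn (psi / `|th|).
have hi : i%:R <= psi / `|th| < i%:R + 1.
  by apply: truncn_bounds; apply: divr_ge0 => //; lra.
exists (d * i)%N.
  rewrite leq_mul2l; apply/orP; right; apply: le_truncn.
  by rewrite ler_pM2r ?invr_gt0//; lra.
rewrite exprM bd cisX hw; apply: le_lt_trans (cis_lip _ _) _.
apply: le_lt_trans the.
have -> : i%:R * th - Num.sg th * psi = Num.sg th * (i%:R * `|th| - psi).
  by rewrite mulrBr mulrCA -numEsg.
rewrite normrM normr_sg th0 mul1r.
have [h1 h2] := andP hi; rewrite ler_pdivlMr// in h1; rewrite ltr_pdivrMr// in h2.
by rewrite ler_norml; apply/andP; split; lra.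
Qed.

Lemma cis_eq1 (t : R) : 0 < t < 2 * pi -> cis t != 1.
Proof.
move=> ht; apply/negP => /eqP/(congr1 (@complex.Re R)) /= h.
have : 0 < sin (t / 2) by apply: sin_gt0_pi; lra.
have : cos t = cos (t / 2) ^+ 2 *+ 2 - 1 by rewrite -cos_mulr2n; congr cos; rewrite mulr2n; field.
by rewrite h cos2sin2 mulr2n => h1 h2; have := mulr_gt0 h2 h2; rewrite -expr2; lra.
Qed.

Lemma sum_root_unity N k : (0 < k < N)%N ->
  \sum_(j < N) (cis (2 * pi / N%:R : R) ^+ k) ^+ j = 0.
Proof.
move=> /andP[k0 kN]; set om := cis _; have N0 : 0 < N%:R :> R by rewrite ltr0n (leq_trans _ kN).
have omk : om ^+ k != 1.
  rewrite cisX; apply: cis_eq1; have p0 := twopi_gt0 R.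
  rewrite mulr_gt0 ?ltr0n ?divr_gt0//= mulrCA gtr_pMr// ltr_pdivrMr// mul1r.
  by rewrite ltr_nat.
have := subrX1 (om ^+ k) N; rewrite exprAC cisX.
have -> : N%:R * (2 * pi / N%:R) = 2 * pi :> R by field; rewrite gt_eqF.
rewrite cis2pi expr1n subrr => /esym/eqP; rewrite mulf_eq0 subr_eq0 (negbTE omk).
by move=> /eqP.
Qed.

End IrrationalRotation.


(** * Solutions on a whole circle of parameters and their averages *)

Section WeightedRotation.
Variable R : realType.
Local Notation C := R[i].
Variables (beta : C) (m : C -> C).
Hypotheses (beta1 : normc beta = 1) (holm : holD m).

Let T (f : C -> C) (z : C) := m z * f (beta * z).

Definition cocycle n z : C := \prod_(k < n) m (beta ^+ k * z).

Lemma normc_rot k z : normc (beta ^+ k * z) = normc z.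
Proof. by rewrite normcM normcX beta1 expr1n mul1r. Qed.

Lemma holD_cocycle n : holD (cocycle n).
Proof.
apply: holD_prod => k; apply: holD_rot => //.
by rewrite normcX beta1 expr1n.
Qed.

Lemma cocycleS n z : cocycle n.+1 z = m z * cocycle n (beta * z).
Proof.
rewrite /cocycle big_ord_recl expr0 mul1r; congr (_ * _).
by apply: eq_bigr => k _; rewrite mulrA -exprSr.
Qed.

Lemma holD_exp k : holD (fun z : C => z ^+ k).
Proof.
elim: k => [|j ihj]; first exact: holD_cst.
by apply: holD_eq (holD_mul (@holD_id R) ihj) => z _; rewrite exprS.
Qed.

Lemma eq_at0 (F G : C -> C) : ccont F 0 -> ccont G 0 ->
  (forall z, inD z -> z != 0 -> F z = G z) -> F 0 = G 0.
Proof.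
move=> cF cG FG; apply/eqP; rewrite -subr_eq0; apply/eqP/normc_small0 => e e0.
have [d d0 hd] := ccontB cF cG e0.
pose t := Num.min d 1 / 2; have t0 : 0 < t by rewrite /t; have [] := leP d 1; lra.
have t1 : t < d /\ t < 1 by rewrite /t; have [] := leP d 1; split; lra.
have tn : normc (t%:C%C : C) = t by rewrite normcR gtr0_norm.
have := hd t%:C%C; rewrite subr0 tn FG; last 2 first.
- by rewrite /inD tn; lra.
- by rewrite -normc_gt0 tn.
by rewrite subrr sub0r normcN => /(_ ltac:(lra)) /ltW.
Qed.

(* Multiplication by z^k intertwines T with beta^k T; it is onto the relevant
   solutions because a solution of the equation with right-hand side z^k
   vanishes to order k at 0. *)
Lemma divide_solution k (nu gamma : C) f : normc gamma = 1 ->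
  normc nu != normc (m 0) -> holD f ->
  (forall z, inD z -> nu * f z - gamma * m z * f (beta * z) = z ^+ k) ->
  exists g, [/\ holD g, forall z, inD z -> f z = z ^+ k * g z &
    forall z, inD z -> nu * g z - gamma * beta ^+ k * m z * g (beta * z) = 1].
Proof.
have D0 : @inD R 0 by rewrite /inD normc0.
(* Each division by $z$ multiplies [gamma] by [beta], so the induction needs [gamma] arbitrary on
   the unit circle. *)
elim: k gamma f => [|k ih] gamma f g1 nm hf eqf.
  exists f; split => // [z _|z zD]; first by rewrite expr0 mul1r.
  by rewrite mulr1 eqf// expr0.
(* At the origin the equation reads $(\nu-\gamma m(0))f(0)=0$, and the first factor is nonzero since
   $|\nu|\neq|m(0)|$. *)
have f0 : f 0 = 0.
  have := eqf 0 D0; rewrite mulr0 expr0n /= -mulrBl => /eqP.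
  rewrite mulf_eq0 subr_eq0 => /orP[/eqP nug|/eqP//].
  by rewrite nug normcM g1 mul1r eqxx in nm.
have [h hh fh] := holD_factor hf D0 f0.
have fh' z : inD z -> f z = z * h z by move=> /fh ->; rewrite subr0.
have gb1 : normc (gamma * beta) = 1 by rewrite normcM g1 beta1 mulr1.
have hl z : inD z -> z != 0 ->
    nu * h z - gamma * beta * m z * h (beta * z) = z ^+ k.
  move=> zD z0; apply: (mulfI z0); rewrite -exprS -eqf// !fh'//; first by ring.
  exact: inD_rot.
have hl0 : nu * h 0 - gamma * beta * m 0 * h (beta * 0) = 0 ^+ k.
  apply: (@eq_at0 (fun z => nu * h z - gamma * beta * m z * h (beta * z))
    (fun z => z ^+ k)) => //.
    apply: holD_cont D0; apply: holD_add; first exact: holD_scale.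
    apply: holD_opp; apply: holD_mul; last exact: holD_rot.
    exact: holD_scale.
  exact: (@holD_cont R (fun z => z ^+ k) 0 (holD_exp k) D0).
have [|g [hg hgh eqg]] := ih _ h gb1 nm hh.
  by move=> z zD; have [->|z0] := eqVneq z 0; [exact: hl0|exact: hl].
exists g; split => // z zD; first by rewrite fh'// hgh// mulrA -exprS.
by rewrite -(eqg z zD) exprS; ring.
Qed.

Hypothesis irr : forall n : nat, (0 < n)%N -> beta ^+ n != 1.

(** For [mu] on the circle some [nu = beta ^+ k * mu] with [k <= K] lies within [delta] of [lam].
    Solving there with right-hand side $z^k$, dividing by $z^k$ and multiplying by [beta ^+ k] gives
    a solution for [mu]. The bound is uniform because only finitely many [k] occur. *)
Lemma circle_of_solutions (lam : C) : lam != 0 -> waelbroeck_resolvent_set T lam ->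
  exists rho : R, 0 < rho < normc lam /\ exists B : R -> R,
    forall mu : C, normc mu = rho -> exists2 f, holD f &
      (forall z, inD z -> mu * f z - T f z = 1) /\
      (forall r z, 0 < r < 1 -> normc z <= r -> normc (f z) <= B r).
Proof.
rewrite -normc_gt0; set L := normc lam => L0 [_ [delta delta0 [res bnd]]].
(* The division by $z^k$ requires [rho] to differ from $|m(0)|$; if the first candidate fails, the
   midpoint between it and [L] is taken. *)
have [rho [h1 h2 h3]] : exists rho, [/\ 0 < rho < L, L - rho < delta & rho != normc (m 0)].
  pose r0 := Num.max (L / 2) (L - delta / 2).
  have r0L : 0 < r0 < L /\ L - r0 < delta.
    by rewrite /r0; have [] := leP (L / 2) (L - delta / 2); split; lra.
  have [E|nE] := eqVneq r0 (normc (m 0)); last by exists r0; split => //; lra.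
  exists ((r0 + L) / 2); split; [lra|lra|rewrite -E; apply/eqP; lra].
have rho0 : 0 < rho by lra.
exists rho; split => //.
pose lam' := (rho / L)%:C%C * lam.
have nl' : normc lam' = rho.
  by rewrite /lam' normcM normcR gtr0_norm ?divr_gt0// divfK// gt_eqF.
have ll' : normc (lam' - lam) = L - rho.
  have -> : lam' - lam = (rho / L - 1)%:C%C * lam by rewrite /lam' rmorphB /=; ring.
  rewrite normcM normcR ler0_norm; last by rewrite subr_le0 ler_pdivrMr//; lra.
  by rewrite -/L; field; rewrite gt_eqF.
pose eta := delta - (L - rho); have eta0 : 0 < eta by rewrite /eta; lra.
have [K hK] := rotation_dense beta1 irr (divr_gt0 eta0 rho0).
have /choice[B0 hB0] : forall kr : nat * R, exists B : R, 0 < kr.2 < 1 -> forall mu : C,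
    normc (mu - lam) <= delta -> forall f, holD f ->
    (forall z, inD z -> mu * f z - T f z = z ^+ kr.1) ->
    forall z, normc z <= kr.2 -> normc (f z) <= B.
  move=> [k r] /=; have [hr|nr] := pselect (0 < r < 1); last by exists 0.
  by have [B hB] := bnd _ (holD_exp k) r hr; exists B => _.
pose s r : R := (r + 1) / 2.
(* On the circle of radius [s r] the division by $z^k$ costs [s r ^+ k]; the first factor carries
   the bound to the disc of radius [r]. The absolute value makes the summands nonnegative, so the
   sum over [k <= K] dominates each of them. *)
pose B1 k r : R := s r / (s r - r) * (`|B0 (k, s r)| / s r ^+ k).
exists (fun r => \sum_(k < K.+1) B1 k r) => mu nmu.
have mu0 : mu != 0 by rewrite -normc_gt0 nmu.
have [|k kK hk] := hK (lam' / mu).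
  by rewrite normcM normcV nl' nmu divff// gt_eqF.
pose nu := beta ^+ k * mu.
have nnu : normc nu = rho by rewrite /nu normc_rot.
have nul : normc (nu - lam) <= delta.
  apply: le_trans (normcBD lam' _ _) _.
  have -> : nu - lam' = (beta ^+ k - lam' / mu) * mu by rewrite /nu mulrBl divfK.
  rewrite normcM nmu ll'.
  by rewrite ltr_pdivlMr// in hk; rewrite /eta in hk; lra.
have [surj _] := res nu nul.
have [f [hf eqf]] := surj _ (holD_exp k).
have [||g [hg fg eqg]] := @divide_solution k nu 1 f (normc1 R) _ hf.
- by rewrite nnu.
- by move=> z zD; rewrite mul1r; exact: eqf.
have bk0 : beta ^+ k != 0 by rewrite -normc_gt0 normcX beta1 expr1n.
exists (fun z => beta ^+ k * g z); first exact: holD_scale.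
split=> [z zD|r z hr zr].
  by rewrite -(eqg z zD) /T /nu; ring.
rewrite normcM normcX beta1 expr1n mul1r.
have s01 : 0 < s r < 1 /\ r < s r by clear -hr T beta1 holm irr; rewrite /s; split; lra.
have B1_ge0 j : 0 <= B1 j r.
  rewrite /B1; apply: mulr_ge0; first by apply: divr_ge0; clear -s01 T beta1 holm irr; lra.
  by apply: divr_ge0 => //; apply: exprn_ge0; clear -s01 T beta1 holm irr; lra.
apply: (@le_trans _ _ (B1 k r)); last first.
  have kK' : (k < K.+1)%N by rewrite ltnS.
  rewrite (bigD1 (Ordinal kK')) //= lerDl sumr_ge0// => j _; exact: B1_ge0.
have z0 := normc_ge0 z.
have sk0 : 0 < s r ^+ k by apply: exprn_gt0; clear -s01 T beta1 holm irr; lra.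
apply: (@le_trans _ _ (s r / (s r - normc z) * (`|B0 (k, s r)| / s r ^+ k))).
  apply: maximum_bound => //; [clear -s01 zr T beta1 holm irr; lra|clear -s01 T beta1 holm irr; lra|move=> w hw].
  have wD : inD w by rewrite /inD hw; clear -s01 T beta1 holm irr; lra.
  rewrite ler_pdivlMr// mulrC -{1}hw -normcX -normcM -fg//.
  apply: le_trans (ler_norm _).
  by apply: (hB0 (k, s r) _ nu) => //=; [clear -s01 T beta1 holm irr; lra|rewrite hw].
rewrite /B1; apply: ler_wpM2r; first by apply: divr_ge0 => //; exact: ltW.
by apply: ler_wpM2l; clear -s01 zr T beta1 holm irr; [lra|rewrite lef_pV2 ?posrE; lra].
Qed.

(* Averages over the N-th roots of unity replace the Riesz projection
   integral of the resolvent over the circle of radius rho. *)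
Lemma root_of_unity_chain (rho : R) (B : R -> R) : 0 < rho ->
  (forall mu : C, normc mu = rho -> exists2 f, holD f &
      (forall z, inD z -> mu * f z - T f z = 1) /\
      (forall r z, 0 < r < 1 -> normc z <= r -> normc (f z) <= B r)) ->
  forall N : nat, (0 < N)%N -> exists F : nat -> C -> C,
    [/\ forall k, holD (F k),
     forall k r z, 0 < r < 1 -> normc z <= r -> normc (F k z) <= rho * B r,
     forall k z, (k < N)%N -> inD z ->
       cocycle k z * F 0%N (beta ^+ k * z) = rho%:C%C ^+ k * F k z &
     forall z, inD z ->
       cocycle N z * F 0%N (beta ^+ N * z) = rho%:C%C ^+ N * (F 0%N z - 1)].
Proof.
move=> rho0 sol N N0; pose om : C := cis (2 * pi / N%:R).
have nom : normc om = 1 by exact: normc_cis.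
have nmu j : normc (om ^+ j * rho%:C%C) = rho.
  by rewrite normcM normcX nom expr1n mul1r normcR gtr0_norm.
have /choice[f hf] : forall j : nat, exists f, holD f /\
    (forall z, inD z -> om ^+ j * rho%:C%C * f z - T f z = 1) /\
    (forall r z, 0 < r < 1 -> normc z <= r -> normc (f z) <= B r).
  by move=> j; have [f] := sol _ (nmu j); exists f.
have Nn0 : N%:R != 0 :> C by rewrite pnatr_eq0 -lt0n.
(* The summand is $\omega^{jk}\mu f_\mu$ at $\mu=\omega^j\rho$; the factor $\mu$ is the one in
   $d\mu=i\mu\,dt$ of the Riesz integral. *)
pose F k z : C := N%:R^-1 * \sum_(j < N) om ^+ (j * k) * (om ^+ j * rho%:C%C * f j z).
(* Since $Tf_\mu=\mu f_\mu-1$, applying $T$ raises the exponent of the weight by one and leaves the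
   average of $\omega^{j(k+1)}$. This is 0 for [k.+1 < N] and 1 for [k.+1 = N], the origin of
   $F_0-1$, as $F_N=F_0$. *)
have TF k z : inD z -> m z * F k (beta * z) = rho%:C%C *
    (F k.+1 z - N%:R^-1 * \sum_(j < N) (om ^+ k.+1) ^+ j).
  move=> zD; rewrite /F -mulrBr mulrCA [RHS]mulrCA; congr (_ * _).
  rewrite -sumrB !mulr_sumr; apply: eq_bigr => j _.
  have [_ [e _]] := hf j; have e' : m z * f j (beta * z) = om ^+ j * rho%:C%C * f j z - 1.
    by rewrite -(e z zD) /T; ring.
  rewrite -exprM [(k.+1 * j)%N]mulnC mulnS exprD.
  transitivity (om ^+ (j * k) * (om ^+ j * rho%:C%C) * (m z * f j (beta * z))); first by ring.
  by rewrite e'; ring.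
have omN : om ^+ N = 1.
  rewrite /om cisX; have -> : N%:R * (2 * pi / N%:R) = 2 * pi :> R.
    by rewrite mulrC divfK// pnatr_eq0 -lt0n.
  exact: cis2pi.
have chain k z : (k < N)%N -> inD z ->
    cocycle k z * F 0%N (beta ^+ k * z) = rho%:C%C ^+ k * F k z.
  elim: k z => [|k ih] z kN zD; first by rewrite /cocycle big_ord0 !mul1r.
  rewrite cocycleS exprSr -mulrA -[beta ^+ k * beta * z]mulrA ih ?(ltnW kN)//; last exact: inD_rot.
  by rewrite mulrCA TF// sum_root_unity ?kN// mulr0 subr0 mulrA -exprSr.
exists F; split => //.
- move=> k; apply: holD_scale; apply: holD_sum => j.
  by do 2!apply: holD_scale; have [] := hf j.
- move=> k r z hr zr; rewrite /F normcM normcV.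
  have -> : normc (N%:R : C) = N%:R by rewrite -[N%:R : C](rmorph_nat (real_complex R)) normcR normr_nat.
  rewrite mulrC ler_pdivrMr ?ltr0n//; apply: le_trans (normc_sum _ _ _) _.
  apply: (@le_trans _ _ (\sum_(j < N) rho * B r)).
    apply: ler_sum => j _; rewrite !normcM !normcX nom !expr1n !mul1r normcR gtr0_norm//.
    by rewrite ler_pM2l//; have [_ [_]] := hf j; exact.
  by rewrite sumr_const card_ord mulr_natr.
- move=> z zD; case: N N0 {nmu hf} om nom Nn0 @F TF omN chain => // N _ om nom Nn0 F TF omN chain.
  rewrite cocycleS exprSr -mulrA -[beta ^+ N * beta * z]mulrA chain//; last exact: inD_rot.
  rewrite mulrCA TF// omN.
  have -> : F N.+1 z = F 0%N z.
    rewrite /F; congr (_ * _); apply: eq_bigr => j _.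
    by rewrite muln0 mulnC exprM omN expr1n.
  under eq_bigr do rewrite expr1n.
  rewrite sumr_const card_ord mulVf// exprSr; ring.
Qed.

End WeightedRotation.


(** * Estimates for Blaschke factors of a disc of radius r *)

Section Blaschke.
Variable R : realType.
Local Notation C := R[i].

Lemma expr_small (q e : R) : 0 <= q < 1 -> 0 < e ->
  exists N0 : nat, forall N, (N0 <= N)%N -> q ^+ N < e.
Proof.
move=> /andP[q0 q1] e0.
have [->|qn0] := eqVneq q 0.
  by exists 1%N => -[//|N] _; rewrite expr0n.
have qp : 0 < q by rewrite lt_neqAle eq_sym qn0.
pose h := q^-1 - 1; have h0 : 0 < h by rewrite subr_gt0 invf_gt1.
pose N0 := (Num.truncn (e^-1 / h)).+1; exists N0 => N NN.
have bern n : 1 + n%:R * h <= q^-1 ^+ n.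
  elim: n => [|n ih]; first by rewrite mul0r addr0 expr0.
  have qE : q^-1 = 1 + h by rewrite /h; ring.
  rewrite exprS; rewrite qE in ih *.
  have : 0 <= n%:R * h * h by rewrite !mulr_ge0// ltW.
  by rewrite -natr1; have := ler_wpM2l (addr_ge0 ler01 (ltW h0)) ih; lra.
have : e^-1 < q^-1 ^+ N.
  apply: lt_le_trans (bern N); rewrite -ltrBlDl.
  apply: (@lt_le_trans _ _ (e^-1)); first by lra.
  rewrite -ler_pdivrMr//; apply: (@le_trans _ _ N0%:R); last by rewrite ler_nat.
  by apply: ltW; apply: truncnS_gt.
by rewrite exprVn ltf_pV2 ?posrE// exprn_gt0.
Qed.

Lemma blaschke_identity (r : R) (a w : C) :
  normc ((r ^+ 2)%:C%C - conjc a * w) ^+ 2 - r ^+ 2 * normc (w - a) ^+ 2 =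
  (r ^+ 2 - normc w ^+ 2) * (r ^+ 2 - normc a ^+ 2).
Proof. by rewrite !normc_sqr; case: a => a b; case: w => c d /=; ring. Qed.

(** With $D=|r^2-\bar a w|$, [blaschke_identity] says that the squared modulus of the Blaschke
    factor is $1-(r^2-s^2)(r^2-|a|^2)/D^2$. As $D\le 2r^2$, it is at most [1 - k]. A single [q]
    serves the circle $|w|=s$, hence all rotations of a point. *)
Lemma blaschke_le (r s : R) (a : C) : normc a < r -> 0 <= s < r ->
  exists2 q : R, 0 <= q < 1 & forall w, normc w = s ->
    r * normc (w - a) <= q * normc ((r ^+ 2)%:C%C - conjc a * w).
Proof.
move=> ar sr; have a0 := normc_ge0 a; have r0 : 0 < r by lra.
pose k := (r ^+ 2 - s ^+ 2) * (r ^+ 2 - normc a ^+ 2) / (4 * r ^+ 4).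
have r4 : 0 < 4 * r ^+ 4 by rewrite mulr_gt0// exprn_gt0.
have h1 : 0 < r ^+ 2 - s ^+ 2 <= r ^+ 2 by have := sqr_ge0 s; rewrite !expr2; nra.
have h2 : 0 < r ^+ 2 - normc a ^+ 2 <= r ^+ 2.
  by have := sqr_ge0 (normc a); rewrite !expr2; nra.
have k0 : 0 < k by rewrite divr_gt0// mulr_gt0//; lra.
have k1 : k <= 1.
  rewrite ler_pdivrMr// mul1r (_ : r ^+ 4 = r ^+ 2 * r ^+ 2); last by rewrite -exprD.
  move: h1 h2; move: (r ^+ 2 - s ^+ 2) (r ^+ 2 - normc a ^+ 2) (r ^+ 2) => x y t.
  nra.
exists (Num.sqrt (1 - k)).
  rewrite sqrtr_ge0/= -[ltRHS]sqrtr1 ltr_sqrt//; lra.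
move=> w ws; set D := normc (_ - _ * w).
have D0 : 0 <= D by exact: normc_ge0.
have D2 : D ^+ 2 <= 4 * r ^+ 4.
  have : D <= 2 * r ^+ 2.
    apply: le_trans (normcB _ _) _; rewrite normcR ger0_norm ?sqr_ge0// normcM.
    have -> : normc (conjc a) = normc a by case: (a) => x y /=; rewrite sqrrN.
    have : normc a * normc w <= r * r by apply: ler_pM; rewrite ?normc_ge0//; lra.
    by rewrite !expr2; lra.
  move=> h; have := ler_pM D0 D0 h h.
  by rewrite -expr2 (_ : 4 * r ^+ 4 = 2 * r ^+ 2 * (2 * r ^+ 2))//; ring.
rewrite -(ler_pXn2r (n := 2)) ?nnegrE//; last 2 first.
- by rewrite mulr_ge0// ?normc_ge0// ltW.
- by rewrite mulr_ge0// sqrtr_ge0.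
rewrite !exprMn sqr_sqrtr; last by lra.
have := blaschke_identity r a w; rewrite -/D ws => E.
have : k * D ^+ 2 <= k * (4 * r ^+ 4) by rewrite ler_wpM2l// ltW.
have -> : k * (4 * r ^+ 4) = (r ^+ 2 - s ^+ 2) * (r ^+ 2 - normc a ^+ 2).
  by rewrite /k divfK// gt_eqF.
rewrite -E; lra.
Qed.

Lemma blaschke_circle (r : R) (a w : C) : 0 <= r -> normc w = r ->
  normc ((r ^+ 2)%:C%C - conjc a * w) = r * normc (w - a).
Proof.
move=> r0 wr; apply/eqP; rewrite -(eqrXn2 (n := 2)) ?mulr_ge0 ?normc_ge0// exprMn.
by rewrite -subr_eq0 blaschke_identity wr subrr mul0r.
Qed.

End Blaschke.

(** * Geometric growth of the cocycle, using the zero of m *)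

Section CocycleBound.
Variable R : realType.
Local Notation C := R[i].
Variables (beta : C) (m : C -> C) (z0 : C).
Hypotheses (beta1 : normc beta = 1) (holm : holD m) (z0D : inD z0) (mz0 : m z0 = 0).

Let T (f : C -> C) (z : C) := m z * f (beta * z).

(** For every $N>k$ the chain gives $|m_k(z)|\,|F_0(\beta^kz)|\le\rho^{k+1}B(r)$. Since
    $|\beta^kz|=|z|$, it suffices that $F_0\to1$ on the circle through [z] as $N$ grows; [defect]
    gives the rate. *)
Lemma cocycle_bound (rho : R) (B : R -> R) : 0 < rho ->
  (forall mu : C, normc mu = rho -> exists2 f, holD f &
      (forall z, inD z -> mu * f z - T f z = 1) /\
      (forall r z, 0 < r < 1 -> normc z <= r -> normc (f z) <= B r)) ->
  forall k r z, 0 < r < 1 -> normc z <= r ->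
    normc (cocycle beta m k z) <= rho ^+ k.+1 * B r.
Proof.
move=> rho0 sol k r z hr zr.
have [mt hmt mE] := holD_factor holm z0D mz0.
have z0n := normc_ge0 z0; have zn := normc_ge0 z.
have z0D1 : normc z0 < 1 by exact: z0D.
pose s := (1 + Num.max (normc z0) r) / 2.
have s01 : 0 < s < 1 /\ normc z0 < s /\ r < s.
  by rewrite /s; have [] := leP (normc z0) r; repeat split; lra.
have nb j : normc (beta ^+ j) = 1 by rewrite normcX beta1 expr1n.
have zD : inD z by rewrite /inD; lra.
have [q q01 hq] := @blaschke_le R s (normc z) z0 ltac:(lra) ltac:(lra).
pose K := s / (s - normc z) * (rho * B s + 1).
have defect N F : (0 < N)%N -> holD (F 0%N) ->
    (forall w, normc w <= s -> normc (F 0%N w) <= rho * B s) ->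
    (forall w, inD w -> cocycle beta m N w * F 0%N (beta ^+ N * w) =
       rho%:C%C ^+ N * (F 0%N w - 1)) ->
    forall w, normc w = normc z -> normc (F 0%N w - 1) <= q ^+ N * K.
  move=> N0 hF FB FN w wz.
  pose bl u : C := (s ^+ 2)%:C%C - conjc z0 * u.
  (* This is $F_0-1$ with each factor $\beta^ju-z_0$ of $m_N$ replaced by [bl], so nothing has to be
     divided by a zero. On $|u|=s$ one has $|Q|=s^N|F_0-1|$, while on the circle through [z] one has
     $s^N|F_0-1|\le q^N|Q|$; the powers of $s$ cancel. *)
  pose Q u := (rho%:C%C ^- N) * ((\prod_(j < N) (bl (beta ^+ j * u) * mt (beta ^+ j * u)))
    * F 0%N (beta ^+ N * u)).
  have holbl : holD bl.
    by apply: holD_add; [exact: holD_cst|apply: holD_opp; exact: (holD_scale _ (@holD_id R))].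
  have hQ : holD Q.
    apply: holD_scale; apply: holD_mul; last exact: holD_rot.
    by apply: holD_prod => j; apply: (@holD_rot R _ (fun u => bl u * mt u)) => //; exact: holD_mul.
  have rhoN : rho%:C%C ^+ N != 0 :> C by rewrite expf_neq0// -normc_gt0 normcR gtr0_norm.
  have FE u : inD u -> normc (F 0%N u - 1) = normc (rho%:C%C ^- N) *
      ((\prod_(j < N) (normc (beta ^+ j * u - z0) * normc (mt (beta ^+ j * u)))) *
      normc (F 0%N (beta ^+ N * u))).
    move=> uD; have -> : F 0%N u - 1 = rho%:C%C ^- N * (cocycle beta m N u * F 0%N (beta ^+ N * u)).
      by rewrite FN// mulKf.
    rewrite !normcM; congr (_ * (_ * _)); rewrite /cocycle normc_prod.
    by apply: eq_bigr => j _; rewrite -normcM -mE//; apply: inD_rot.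
  have QE u : normc (Q u) = normc (rho%:C%C ^- N) *
      ((\prod_(j < N) (normc (bl (beta ^+ j * u)) * normc (mt (beta ^+ j * u)))) *
      normc (F 0%N (beta ^+ N * u))).
    rewrite /Q !normcM; congr (_ * (_ * _)); rewrite normc_prod.
    by apply: eq_bigr => j _; rewrite normcM.
  have Qs u : normc u = s -> normc (Q u) <= s ^+ N * (rho * B s + 1).
    move=> us; have uD : inD u by rewrite /inD us; clear -s01 T beta1 holm z0D mz0; lra.
    have -> : normc (Q u) = s ^+ N * normc (F 0%N u - 1).
      rewrite FE// QE [RHS]mulrCA; congr (_ * _); rewrite mulrA; congr (_ * _).
      rewrite -[X in s ^+ X](card_ord N) -prodr_const -big_split /=.
      apply: eq_bigr => j _; rewrite mulrA blaschke_circle ?normc_rot//; clear -s01 T beta1 holm z0D mz0; lra.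
    rewrite ler_wpM2l ?exprn_ge0//; first by clear -s01 T beta1 holm z0D mz0; lra.
    by apply: le_trans (normcB _ _) _; rewrite normc1 lerD2r FB// us.
  have Qw : normc (Q w) <= s / (s - normc w) * (s ^+ N * (rho * B s + 1)).
    by apply: maximum_bound Qs => //; [rewrite wz; clear -s01 zr T beta1 holm z0D mz0; lra|clear -s01 T beta1 holm z0D mz0; lra].
  have wD : inD w by rewrite /inD wz; clear -zr hr T beta1 holm z0D mz0; lra.
  have sN : 0 < s ^+ N by rewrite exprn_gt0//; clear -s01 T beta1 holm z0D mz0; lra.
  have : s ^+ N * normc (F 0%N w - 1) <= q ^+ N * normc (Q w).
    rewrite FE// QE mulrCA [leRHS]mulrCA ler_wpM2l ?normc_ge0// !mulrA.
    rewrite ler_wpM2r ?normc_ge0//.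
    rewrite -[X in s ^+ X](card_ord N) -[X in q ^+ X](card_ord N) -!prodr_const -!big_split /=.
    apply: ler_prod => j _; apply/andP; split.
      by apply: mulr_ge0; [clear -s01 T beta1 holm z0D mz0; lra|apply: mulr_ge0; exact: normc_ge0].
    by rewrite !mulrA ler_wpM2r ?normc_ge0// hq// normc_rot.
  have qN : 0 <= q ^+ N by apply: exprn_ge0; clear -q01 T beta1 holm z0D mz0; lra.
  move=> /le_trans /(_ (ler_wpM2l qN Qw)); rewrite wz => h.
  rewrite -(ler_pM2l sN); apply: le_trans h _.
  by rewrite /K le_eqVlt; apply/orP; left; apply/eqP; ring.
have Bs0 t : 0 < t < 1 -> 0 <= B t.
  move=> ht; have [|f _ [_ fB]] := sol rho%:C%C; first by rewrite normcR gtr0_norm.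
  apply: le_trans (fB t 0 ht _); first exact: normc_ge0.
  by rewrite normc0; clear -ht T beta1 holm z0D mz0; lra.
have K0 : 0 <= K.
  rewrite /K; apply: mulr_ge0; first by apply: divr_ge0; clear -s01 zr T beta1 holm z0D mz0; lra.
  by have := mulr_ge0 (ltW rho0) (Bs0 s s01.1); clear -T beta1 holm z0D mz0; lra.
set c := normc (cocycle beta m k z); have c0 : 0 <= c by exact: normc_ge0.
apply: ler_addgt0P => e e0.
have cK : 0 < c * K + 1 by have := mulr_ge0 c0 K0; clear -T beta1 holm z0D mz0; lra.
have [N0 hN0] := expr_small q01 (divr_gt0 e0 cK).
(* Large enough both to bring [c * K * q ^+ N] below [e] and to have [k < N], as the chain
   requires. *)
pose N := (maxn N0 k).+1.
have /hN0 qN : (N0 <= N)%N by rewrite /N ltnW// ltnS leq_maxl.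
have kN : (k < N)%N by rewrite /N ltnS leq_maxr.
have [F [hF FB Fk FN]] := root_of_unity_chain beta1 rho0 sol (ltn0Sn (maxn N0 k)).
have d := @defect N F (ltn0Sn _) (hF 0%N) (fun w => FB 0%N s w s01.1) FN
  (beta ^+ k * z) (normc_rot beta1 _ _).
have : c * normc (F 0%N (beta ^+ k * z)) <= rho ^+ k.+1 * B r.
  rewrite -normcM Fk// normcM normcX normcR gtr0_norm// exprSr -mulrA.
  by rewrite ler_wpM2l ?exprn_ge0 ?(ltW rho0)// FB.
have h1 : 1 - q ^+ N * K <= normc (F 0%N (beta ^+ k * z)).
  have := lerB_normc 1 (F 0%N (beta ^+ k * z)); rewrite normc1 normcBC; clear -d T beta1 holm z0D mz0; lra.
have := ler_wpM2l c0 h1.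
have : q ^+ N * (c * K + 1) <= e by rewrite -ler_pdivlMr// ltW.
have : 0 <= q ^+ N by apply: exprn_ge0; clear -q01 T beta1 holm z0D mz0; lra.
clear -T beta1 holm z0D mz0; lra.
Qed.

End CocycleBound.


(** * Lebesgue integrals over a period and Riemann sums *)

Section CircleIntegrals.
Variable R : realType.
Local Notation C := R[i].
Local Notation mu := (@lebesgue_measure R).
Import numFieldNormedType.Exports.

Lemma integral_rder (g : R -> R) (a b : R) : a < b -> continuous g ->
  exists2 G : R -> R, rder a b (fun t => (G t)%:C%C) (fun t => (g t)%:C%C) &
  (\int[mu]_(t in `[a, b]) (g t)%:E = (G b - G a)%:E)%E.
Proof.
move=> ab cg; have [G [dG iG]] := continuous_primitive ab cg; exists G => // t ht e e0.
have [d d0 hd] := dG t ht e e0; exists d => // s _ /hd.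
by rewrite -!rmorphB -rmorphM -rmorphB normcR.
Qed.

Lemma continuous_translate (g : R -> R) (th : R) :
  continuous g -> continuous (fun t => g (t + th)).
Proof.
move=> cg t; apply: (@continuous_comp _ _ _ (fun t => t + th) g); last exact: cg.
by apply: continuousD; [exact: cvg_id|exact: cvg_cst].
Qed.

Lemma rder_shift a b th (G g : R -> C) : rder (a + th) (b + th) G g ->
  rder a b (fun t => G (t + th)) (fun t => g (t + th)).
Proof.
move=> dG t ht e e0; have [d d0 hd] := dG (t + th) ltac:(lra) e e0.
exists d => // s hs st; have := hd (s + th) ltac:(lra).
have -> : s + th - (t + th) = s - t by ring.
exact.
Qed.

Lemma rder_uniqR a b (G G' : R -> R) (g : R -> C) : a <= b ->
  rder a b (fun t => (G t)%:C%C) g -> rder a b (fun t => (G' t)%:C%C) g ->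
  G b - G a = G' b - G' a.
Proof.
move=> ab h1 h2; apply: (@complexI R); rewrite !rmorphB /=.
exact: rder_uniq ab h1 h2.
Qed.

Lemma integral_shift (g : R -> R) (th : R) : 0 <= th -> continuous g ->
  (forall t, g (t + 2 * pi) = g t) ->
  (\int[mu]_(t in `[0%R, (2 * pi)%R]) (g (t + th))%:E =
   \int[mu]_(t in `[0%R, (2 * pi)%R]) (g t)%:E)%E.
Proof.
move=> th0 cg per; have p0 := twopi_gt0 R.
have cgs : continuous (fun t => g (t + th)).
  exact: continuous_translate.
have [G dG _] := @integral_rder g 0 (2 * pi + th) ltac:(lra) cg.
have [G1 dG1 ->] := integral_rder p0 cg.
have [G2 dG2 ->] := integral_rder p0 cgs.
congr EFin.
have dGs : rder 0 (2 * pi) (fun t => (G (t + th))%:C%C) (fun t => (g (t + th))%:C%C).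
  by apply: (@rder_shift 0 (2 * pi) th (fun t => (G t)%:C%C) (fun t => (g t)%:C%C)); apply: rder_sub dG; lra.
rewrite (rder_uniqR (ltW p0) dG2 dGs).
have dG0 : rder 0 (2 * pi) (fun t => (G t)%:C%C) (fun t => (g t)%:C%C).
  by apply: rder_sub dG; lra.
rewrite (rder_uniqR (ltW p0) dG1 dG0) add0r.
have d1 : rder 0 th (fun t => (G t)%:C%C) (fun t => (g t)%:C%C).
  by apply: rder_sub dG; lra.
have d2 : rder 0 th (fun t => (G (t + 2 * pi))%:C%C) (fun t => (g t)%:C%C).
  apply: (@rder_eq _ _ _ _ (fun t => (g (t + 2 * pi))%:C%C)); first by move=> t _; rewrite per.
  by apply: (@rder_shift 0 th (2 * pi) (fun t => (G t)%:C%C) (fun t => (g t)%:C%C)); apply: rder_sub dG; lra.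
have := rder_uniqR th0 d1 d2; rewrite add0r (addrC th); lra.
Qed.

Lemma riemann_sum_le (g : R -> R) (N : nat) (e : R) : (0 < N)%N -> continuous g ->
  (forall s t, `|s - t| <= 2 * pi / N%:R -> `|g s - g t| <= e) ->
  ((2 * pi / N%:R * \sum_(j < N) g (j%:R * (2 * pi / N%:R)))%:E <=
   \int[mu]_(t in `[0%R, (2 * pi)%R]) (g t)%:E + (2 * pi * e)%:E)%E.
Proof.
move=> N0 cg osc; have p0 := twopi_gt0 R.
have [G dG ->] := integral_rder p0 cg.
have N0' : 0 < N%:R :> R by rewrite ltr0n.
set h := 2 * pi / N%:R; have h0 : 0 < h by rewrite /h divr_gt0.
have Nh : N%:R * h = 2 * pi by rewrite /h mulrC divfK// gt_eqF.
have step (j : 'I_N) : h * g (j%:R * h) <= (G (j.+1%:R * h) - G (j%:R * h)) + e * h.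
  have jN : j.+1%:R * h <= 2 * pi.
    by rewrite -Nh ler_wpM2r ?(ltW h0)// ler_nat.
  have j0 : 0 <= j%:R * h by apply: mulr_ge0 => //; exact: ltW.
  have jj : j.+1%:R * h = j%:R * h + h by rewrite -natr1 mulrDl mul1r.
  have dGj : rder (j%:R * h) (j.+1%:R * h) (fun t => (G t)%:C%C) (fun t => (g t)%:C%C).
    by apply: rder_sub dG.
  set c := g (j%:R * h).
  have dL : rder (j%:R * h) (j.+1%:R * h) (fun t => (G t - c * t)%:C%C) (fun t => (g t - c)%:C%C).
    move=> t ht x x0; have [d d0 hd] := dGj t ht x x0; exists d => // s hs st.
    rewrite [X in normc X](_ : _ = (G s)%:C%C - (G t)%:C%C - (s - t)%:C%C * (g t)%:C%C).
      exact: hd.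
    by rewrite -!rmorphB -!rmorphM -!rmorphB /=; congr _%:C%C; ring.
  have : normc ((G (j.+1%:R * h) - c * (j.+1%:R * h))%:C%C -
      (G (j%:R * h) - c * (j%:R * h))%:C%C) <= e * (j.+1%:R * h - j%:R * h).
    apply: rder_le dL _; first by rewrite jj; lra.
    move=> t ht; rewrite normcR; apply: osc.
    by rewrite -/h ger0_norm; lra.
  by rewrite -rmorphB normcR ler_norml jj => /andP[H _]; lra.
rewrite -EFinD lee_fin mulr_sumr.
apply: le_trans (ler_sum _ (fun j _ => step j)) _.
rewrite big_split /= sumr_const card_ord -mulrnAr -mulr_natl Nh (mulrC e) lerD2r.
rewrite -(big_mkord xpredT (fun j => G (j.+1%:R * h) - G (j%:R * h))).
by rewrite (telescope_sumr (fun j => G (j%:R * h)))// Nh mul0r.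
Qed.

(** Bisection of the parameter interval. Only [z] is parametrised while [w] ranges over the whole
    circle, so the angle [0] needs no separate treatment. *)
Lemma circle_uniform (phi : C -> C) r : 0 < r ->
  (forall w, normc w = r -> ccont phi w) -> forall e : R, 0 < e ->
  exists2 d : R, 0 < d & forall z w, normc z = r -> normc w = r ->
    normc (z - w) < d -> normc (phi z - phi w) < e.
Proof.
move=> r0 cphi e e0; have p0 := twopi_gt0 R.
pose P a b (c' d' : R) := exists2 d : R, 0 < d & forall t w, a <= t <= b -> normc w = r ->
    normc (polar r t - w) < d -> normc (phi (polar r t) - phi w) < e.
have : P 0 (2 * pi) 0 0.
  apply: rect_ind => //; first exact: ltW.
    move=> a b c1 c2 [d1 d10 h1] [d2 d20 h2] _ _; exists (Num.min d1 d2).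
      by rewrite lt_min d10.
    move=> t w ht wr; rewrite lt_min => /andP[k1 k2].
    have [tm|tm] := leP t ((a + b) / 2).
      by apply: h1 => //; lra.
    by apply: h2 => //; lra.
  move=> x y hx _; have e2 : 0 < e / 2 by lra.
  have [d d0 hd] := cphi (polar r x) (normc_polar _ (ltW r0)) _ e2.
  have dr : 0 < d / 2 / r by rewrite !divr_gt0.
  exists (d / 2 / r) => // a b c1 c2 h1 h2 _ _ ab _.
  exists (d / 2) => [|t w ht wr tw]; first by lra.
  have tx : normc (polar r t - polar r x) < d / 2.
    apply: le_lt_trans (polar_lip _ _ (ltW r0)) _.
    rewrite mulrC -ltr_pdivlMr//; apply: le_lt_trans ab.
    by rewrite ler_norml; apply/andP; split; lra.
  have wx : normc (w - polar r x) < d.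
    apply: le_lt_trans (normcBD (polar r t) _ _) _.
    by rewrite (normcBC w); lra.
  apply: le_lt_trans (normcBD (phi (polar r x)) _ _) _.
  have := hd _ wx; have := hd (polar r t) ltac:(lra).
  rewrite (normcBC (phi (polar r x))); lra.
case=> d d0 hd; exists d => // z w /(circle_polar r0)[t ht ->] wr; exact: hd.
Qed.

End CircleIntegrals.

(** * One-sided uniform equidistribution *)

Section WeylUpperBound.
Variable R : realType.
Local Notation C := R[i].
Local Notation mu := (@lebesgue_measure R).
Import numFieldNormedType.Exports.
Variables (beta : C) (r : R) (U : C -> R).
Hypotheses (beta1 : normc beta = 1)
  (irr : forall n : nat, (0 < n)%N -> beta ^+ n != 1) (r0 : 0 < r)
  (Uunif : forall e : R, 0 < e -> exists2 d : R, 0 < d &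
    forall z w, normc z = r -> normc w = r -> normc (z - w) < d -> `|U z - U w| < e).

Lemma circle_continuous : continuous (fun t => U (polar r t)).
Proof.
move=> t; apply/cvgrPdist_lt => e e0; have [d d0 hd] := Uunif e0.
exists (d / r) => [|s] /=; first by rewrite divr_gt0.
rewrite /ball /= => st; apply: hd; rewrite ?normc_polar ?ltW//.
apply: le_lt_trans (polar_lip _ _ (ltW r0)) _.
by rewrite mulrC -ltr_pdivlMr.
Qed.

Lemma polarD s t : polar r (s + t) = cis t * polar r s.
Proof. by rewrite !polarE cisD; ring. Qed.

Lemma polar_periodic t : polar r (t + 2 * pi) = polar r t.
Proof. by rewrite polarD cis2pi mul1r. Qed.

(* Replacing z by beta^p z changes the Birkhoff sums boundedly, and suitable
   powers of beta are close to the N-th roots of unity; so the Birkhoff sums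
   compare with those of the average of U over rotated copies, which is
   uniformly close to the mean of U. *)
Lemma weyl_upper_bound (l : R) :
  (\int[mu]_(t in `[0%R, (2 * pi)%R]) (U (polar r t))%:E < (2 * pi * l)%:E)%E ->
  exists K : R, forall n z, normc z = r ->
    \sum_(k < n) U (beta ^+ k * z) <= K + n%:R * l.
Proof.
have p0 := twopi_gt0 R.
have [G _ IG] := integral_rder p0 circle_continuous.
rewrite IG lte_fin => IA; set I := G (2 * pi) - G 0 in IG IA.
pose A := I / (2 * pi); have IE : I = 2 * pi * A by rewrite /A mulrC divfK// gt_eqF.
have Al : A < l by rewrite IE ltr_pM2l in IA.
(* The gap between the mean [A] and [l] is spent in two halves: on the Riemann sum, and on replacing
   roots of unity by powers of [beta]. *)
pose e := (l - A) / 2; have e0 : 0 < e by rewrite /e; lra.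
have [d d0 hd] := Uunif e0.
have [M hM] : exists M, forall z, normc z = r -> `|U z| <= M.
  have cU : rcont 0 (2 * pi) (fun t => (U (polar r t))%:C%C).
    move=> t _ x /Uunif[y y0 hy]; exists (y / r) => [|s _ st]; first by rewrite divr_gt0.
    rewrite -rmorphB normcR; apply: hy; rewrite ?normc_polar ?ltW//.
    by apply: le_lt_trans (polar_lip _ _ (ltW r0)) _; rewrite mulrC -ltr_pdivlMr.
  have [M _ hM] := rcont_bounded (ltW p0) cU.
  by exists M => z /(circle_polar r0)[t /hM]; rewrite normcR => ? ->.
have [K0 hK0] := rotation_dense beta1 irr (divr_gt0 d0 r0).
pose N := (Num.truncn (2 * pi * r / d)).+1.
pose h : R := 2 * pi / N%:R.
have N0 : 0 < N%:R :> R by rewrite ltr0n.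
have hr : h * r < d.
  rewrite /h mulrAC ltr_pdivrMr// [ltRHS]mulrC -ltr_pdivrMr//; exact: truncnS_gt.
have /choice[kk hkk] : forall j : nat, exists k, (k <= K0)%N /\
    normc (beta ^+ k - cis (j%:R * h)) < d / r.
  by move=> j; have [k ? ?] := hK0 _ (normc_cis (j%:R * h)); exists k.
have rot k z : normc z = r -> normc (beta ^+ k * z) = r by rewrite normc_rot.
have avg z : normc z = r -> \sum_(j < N) U (beta ^+ (kk j) * z) <= N%:R * l.
  move=> zr; have [phi hphi zE] := circle_polar r0 zr.
  have rie : h * \sum_(j < N) U (cis (j%:R * h) * z) <= I + 2 * pi * e.
    have c2 : continuous (fun t => U (polar r (t + phi))).
      exact: (@continuous_translate R (fun t => U (polar r t)) phi circle_continuous).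
    have := @riemann_sum_le R (fun t => U (polar r (t + phi))) N e (ltn0Sn _) c2.
    rewrite (@integral_shift R (fun t => U (polar r t)) phi)//; last 3 first.
    - by lra.
    - exact: circle_continuous.
    - by move=> t; rewrite polar_periodic.
    rewrite IG -EFinD lee_fin -/h => H.
    have -> : \sum_(j < N) U (cis (j%:R * h) * z) = \sum_(j < N) U (polar r (j%:R * h + phi)).
      by apply: eq_bigr => j _; rewrite zE addrC polarD.
    apply: H => s t st; apply/ltW/hd; rewrite ?normc_polar ?(ltW r0)//.
    apply: le_lt_trans (polar_lip _ _ (ltW r0)) _; apply: le_lt_trans hr.
    rewrite mulrC ler_pM2r//; apply: le_trans st; rewrite le_eqVlt; apply/orP; left.
    by apply/eqP; congr Num.norm; ring.
  have {}rie : \sum_(j < N) U (cis (j%:R * h) * z) <= N%:R * (A + e).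
    have h0 : 0 < h by rewrite /h divr_gt0.
    rewrite -(ler_pM2l h0); apply: le_trans rie _.
    have hN : h * N%:R = 2 * pi by rewrite /h divfK// gt_eqF.
    rewrite IE [leRHS]mulrA hN. by rewrite [leRHS]mulrDr.
  apply: (@le_trans _ _ (\sum_(j < N) (U (cis (j%:R * h) * z) + e))).
    apply: ler_sum => j _; rewrite -lerBlDl; apply: le_trans (ler_norm _) _.
    have [_ hj] := hkk j; apply/ltW/hd; rewrite ?rot//.
      by rewrite normcM normc_cis mul1r.
    by rewrite -mulrBl normcM zr -ltr_pdivlMr.
  rewrite big_split /= sumr_const card_ord -mulr_natl.
  by rewrite /e in rie *; lra.
pose S n z := \sum_(k < n) U (beta ^+ k * z).
have SD p n z : S (p + n)%N z = S p z + S n (beta ^+ p * z).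
  rewrite /S big_split_ord /=; congr (_ + _); apply: eq_bigr => i _.
  by rewrite mulrA -exprD addnC.
have SM n z : normc z = r -> `|S n z| <= n%:R * M.
  move=> zr; apply: le_trans (ler_norm_sum _ _ _) _.
  apply: (@le_trans _ _ (\sum_(k < n) M)); first by apply: ler_sum => k _; rewrite hM// rot.
  by rewrite sumr_const card_ord mulr_natl.
have M0 : 0 <= M by apply: le_trans (normr_ge0 _) (hM r%:C%C _); rewrite normcR gtr0_norm.
exists (2 * K0%:R * M) => n z zr.
(* Splitting $S_{p+n}(z)$ in both orders gives $S_n(z)-S_n(\beta^pz)=S_p(z)-S_p(\beta^nz)$, and both
   sums on the right have at most $K_0$ terms. *)
have shift p : (p <= K0)%N -> S n z <= S n (beta ^+ p * z) + 2 * K0%:R * M.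
  move=> pK; have := SD p n z; rewrite addnC SD => E.
  have := SM p z zr; have := SM p (beta ^+ n * z) (rot n _ zr).
  rewrite !ler_norml => /andP[h1 _] /andP[_ h2].
  have : p%:R * M <= K0%:R * M by rewrite ler_wpM2r// ler_nat.
  lra.
have : N%:R * S n z <= \sum_(j < N) (S n (beta ^+ kk j * z) + 2 * K0%:R * M).
  rewrite mulr_natl -[X in _ *+ X](card_ord N) -sumr_const; apply: ler_sum => j _.
  by apply: shift; have [] := hkk j.
rewrite big_split /= sumr_const card_ord exchange_big /= -mulr_natl.
have : \sum_(k < n) \sum_(j < N) U (beta ^+ k * (beta ^+ kk j * z)) <= \sum_(k < n) N%:R * l.
  apply: ler_sum => k _; apply: le_trans (avg (beta ^+ k * z) (rot k _ zr)).
  by apply: ler_sum => j _; rewrite mulrCA.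
rewrite sumr_const card_ord -mulr_natl => h1 h2; rewrite -/(S n z).
rewrite -(ler_pM2l N0); lra.
Qed.

End WeylUpperBound.


(** * The integral of log|m| over a circle *)

Section CircleLogs.
Variable R : realType.
Local Notation C := R[i].
Local Notation mu := (@lebesgue_measure R).
Import numFieldNormedType.Exports.
Variables (m : C -> C) (r c0 : R).
Hypotheses (r0 : 0 < r) (cm : forall w, normc w = r -> ccont m w)
  (mc0 : forall w, normc w = r -> normc (m w) <= expR c0) (c0_ge0 : 0 <= c0).

Definition logtrunc (f : C -> C) (e : R) z : R := ln (Num.max (normc (f z)) e).

Lemma ln_lip (e x y : R) : 0 < e -> e <= x -> e <= y -> `|ln x - ln y| <= `|x - y| / e.
Proof.
move=> e0; wlog xy : x y / y <= x => [hw ex ey|ex ey].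
  have [/hw|/ltW/hw] := leP y x; first exact.
  by rewrite distrC [`|x - y|]distrC; exact.
have y0 : 0 < y by exact: lt_le_trans ey.
have x0 : 0 < x by exact: lt_le_trans ex.
rewrite !ger0_norm ?subr_ge0 ?ler_ln ?posrE// -ln_div ?posrE//.
have -> : x / y = 1 + (x - y) / y by field; rewrite gt_eqF.
have h : 0 <= (x - y) / y by rewrite divr_ge0 ?subr_ge0// ltW.
apply: le_trans (le_ln1Dx _) _; first by lra.
by rewrite ler_wpM2l ?subr_ge0// lef_pV2 ?posrE.
Qed.

Lemma logtrunc_uniform (k : R) : 0 < k -> forall e : R, 0 < e -> exists2 d : R, 0 < d &
  forall z w, normc z = r -> normc w = r -> normc (z - w) < d ->
    `|logtrunc m k z - logtrunc m k w| < e.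
Proof.
move=> k0 e e0; have [d d0 hd] := circle_uniform r0 cm (mulr_gt0 e0 k0).
exists d => // z w zr wr zw.
apply: le_lt_trans (ln_lip k0 _ _) _; rewrite ?le_max ?lexx ?orbT//.
rewrite ltr_pdivrMr//; apply: le_lt_trans (hd z w zr wr zw).
have h1 := lerB_normc (m z) (m w); have h2 := lerB_normc (m w) (m z).
rewrite (normcBC (m w)) in h2.
have [] := leP (normc (m z)) k; have [] := leP (normc (m w)) k; move=> h3 h4;
by rewrite ler_norml; apply/andP; split; have := normc_ge0 (m z - m w); lra.
Qed.

(** Continuous, nondecreasing in [j], and nonnegative on the circle: [expR c0] bounds $|m|$ there,
    and [0 <= c0] makes it bound the truncation level too. Monotone convergence therefore leads to
    [logdefect]. *)
Definition logdefect_trunc j z : R := c0 - logtrunc m (expR (- j%:R)) z.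

Definition logdefect z : \bar R :=
  if m z == 0 then +oo%E else (c0 - ln (normc (m z)))%:E.

Lemma logabs_defect t : (logabs m r t = c0%:E - logdefect (polar r t))%E.
Proof.
rewrite /logabs /logdefect; case: ifP => _ //.
by rewrite -EFinB opprB addrC subrK.
Qed.

Lemma logtrunc_nonincr i j z : (i <= j)%N ->
  logtrunc m (expR (- j%:R)) z <= logtrunc m (expR (- i%:R)) z.
Proof.
move=> ij; rewrite ler_ln ?posrE ?lt_max ?expR_gt0 ?orbT//.
have : expR (- j%:R) <= expR (- i%:R) :> R by rewrite ler_expR lerN2 ler_nat.
by move=> h; rewrite ge_max !le_max lexx /= h orbT.
Qed.

Lemma logdefect_trunc_ge0 j z : normc z = r -> 0 <= logdefect_trunc j z.
Proof.
move=> zr; rewrite subr_ge0 -[leRHS]expRK ler_ln ?posrE ?lt_max ?expR_gt0 ?orbT//.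
rewrite ge_max mc0//= ler_expR; apply: le_trans c0_ge0.
by rewrite oppr_le0.
Qed.

Lemma logdefect_ge0 z : normc z = r -> (0 <= logdefect z)%E.
Proof.
move=> zr; rewrite /logdefect; case: eqP => [//|/eqP mz]; rewrite lee_fin subr_ge0.
by rewrite -[leRHS]expRK ler_ln ?posrE ?normc_gt0 ?expR_gt0// mc0.
Qed.

Lemma logdefect_cvg z : (logdefect_trunc j z)%:E @[j --> \oo] --> logdefect z.
Proof.
rewrite /logdefect; case: eqP => [mz|/eqP mz].
  apply/cvgeryP/cvgryPge => M; exists (Num.truncn M).+1 => // j /= Mj.
  rewrite /logdefect_trunc /logtrunc mz normc0 max_r ?expR_ge0// expRK opprK.
  apply: le_trans (ltW (truncnS_gt _)) _.
  by apply: (@le_trans _ _ j%:R); [rewrite ler_nat|rewrite lerDr].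
apply: cvg_near_cst; exists (Num.truncn (- ln (normc (m z)))).+1 => // j /= Mj.
rewrite /logdefect_trunc /logtrunc max_l// -[leRHS]lnK ?posrE ?normc_gt0// ler_expR.
rewrite lerNl; apply: le_trans (ltW (truncnS_gt _)) _.
by rewrite ler_nat.
Qed.

Let D : set R := `[0%R, (2 * pi)%R].

Let mD : measurable D. Proof. exact: measurable_itv. Qed.

Lemma trunc_continuous j th :
  continuous (fun t => logtrunc m (expR (- j%:R)) (polar r (t + th))).
Proof.
have := circle_continuous r0 (logtrunc_uniform (expR_gt0 (- j%:R))).
by move=> h; exact: (@continuous_translate R (fun t => logtrunc m (expR (- j%:R)) (polar r t)) th h).
Qed.

Lemma defect_continuous j th :
  continuous (fun t => logdefect_trunc j (polar r (t + th))).
Proof.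
move=> t; apply: cvgB; first exact: cvg_cst.
exact: trunc_continuous.
Qed.

Lemma polar_circle t : normc (polar r t) = r.
Proof. exact/normc_polar/ltW. Qed.

Lemma defect_trunc_measurable j th :
  measurable_fun D (fun t => (logdefect_trunc j (polar r (t + th)))%:E).
Proof.
apply/measurable_EFinP/measurable_funTS.
by apply: continuous_measurable_fun; exact: defect_continuous.
Qed.

Lemma defect_measurable th : measurable_fun D (fun t => logdefect (polar r (t + th))).
Proof.
apply: emeasurable_fun_cvg (fun j => defect_trunc_measurable j th) _.
by move=> t _; exact: logdefect_cvg.
Qed.

Lemma integral_defect_cvg th :
  (\int[mu]_(t in D) (logdefect_trunc j (polar r (t + th)))%:E @[j --> \oo] -->
   \int[mu]_(t in D) logdefect (polar r (t + th)))%E.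
Proof.
rewrite (_ : (fun t => logdefect (polar r (t + th))) =
  (fun t => limn (fun j => (logdefect_trunc j (polar r (t + th)))%:E))); last first.
  by apply/funext => t; apply/esym/cvg_lim => //; exact: logdefect_cvg.
apply: cvg_monotone_convergence => //.
- by move=> j; exact: defect_trunc_measurable.
- by move=> j t _; rewrite lee_fin logdefect_trunc_ge0// polar_circle.
- by move=> t _ i j ij; rewrite lee_fin lerD2l lerN2 logtrunc_nonincr.
Qed.

Lemma integral_defect_cvg0 :
  (\int[mu]_(t in D) (logdefect_trunc j (polar r t))%:E @[j --> \oo] -->
   \int[mu]_(t in D) logdefect (polar r t))%E.
Proof.
have := @integral_defect_cvg 0.
have -> : (\int[mu]_(t in D) logdefect (polar r (t + 0)) =
    \int[mu]_(t in D) logdefect (polar r t))%E.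
  by apply: eq_integral => t _; rewrite addr0.
suff -> : (fun j => \int[mu]_(t in D) (logdefect_trunc j (polar r (t + 0)))%:E)%E =
    (fun j => \int[mu]_(t in D) (logdefect_trunc j (polar r t))%:E)%E by [].
by apply/funext => j; apply: eq_integral => t _; rewrite addr0.
Qed.

(** The truncated defects are continuous and periodic, so their integrals are invariant; the
    invariance passes to the monotone limit, finite or not. *)
Lemma integral_defect_rot th : 0 <= th ->
  (\int[mu]_(t in D) logdefect (polar r (t + th)) =
   \int[mu]_(t in D) logdefect (polar r t))%E.
Proof.
move=> th0; have h1 := @integral_defect_cvg th; have h2 := integral_defect_cvg0.
suff E : (fun j => \int[mu]_(t in D) (logdefect_trunc j (polar r (t + th)))%:E)%E =
    (fun j => \int[mu]_(t in D) (logdefect_trunc j (polar r t))%:E)%E.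
  by rewrite E in h1; exact: (cvg_unique _ h1 h2).
apply/funext => j.
apply: (@integral_shift R (fun t => logdefect_trunc j (polar r t))) => //.
  have := @defect_continuous j 0; rewrite (_ : (fun t => _) = (fun t => logdefect_trunc j (polar r t)))//.
  by apply/funext => t; rewrite addr0.
by move=> t; rewrite polar_periodic.
Qed.

Lemma D_measure : mu D = (2 * pi)%:E.
Proof. by rewrite /D lebesgue_measure_itv /= lte_fin twopi_gt0 -EFinB subr0. Qed.

Lemma continuous_integrable_D (g : R -> R) : continuous g -> mu.-integrable D (EFin \o g).
Proof.
move=> cg; apply: continuous_compact_integrable; first exact: segment_compact.
exact: continuous_subspaceT.
Qed.

Lemma integral_trunc_defect j :
  (\int[mu]_(t in D) (logdefect_trunc j (polar r t))%:E =
   (2 * pi * c0)%:E - \int[mu]_(t in D) (logtrunc m (expR (- j%:R)) (polar r t))%:E)%E.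
Proof.
have ct : continuous (fun t => logtrunc m (expR (- j%:R)) (polar r t)).
  exact: circle_continuous r0 (logtrunc_uniform (expR_gt0 (- j%:R))).
have cc : continuous (fun _ : R => c0) by move=> t; exact: cvg_cst.
have := integralB_EFin _ (continuous_integrable_D cc) (continuous_integrable_D ct).
rewrite /= -/D => /(_ ltac:(exact: measurable_itv)) H.
transitivity (\int[mu]_(t in D) (c0%:E - (logtrunc m (expR (- j%:R)) (polar r t))%:E))%E.
  by apply: eq_integral => t _; rewrite -EFinB.
rewrite H; congr (_ - _)%E.
have := @integral_cst _ _ _ mu D (measurable_itv _) c0%:E.
by rewrite /= D_measure -EFinM (mulrC _ (2 * pi)).
Qed.

Lemma integral_logabs_fin (x : R) : (\int[mu]_(t in D) logdefect (polar r t) = x%:E)%E ->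
  (\int[mu]_(t in D) logabs m r t = (2 * pi * c0 - x)%:E)%E.
Proof.
move=> Ix.
have md : measurable_fun D (fun t => logdefect (polar r t)).
  have := @defect_measurable 0; rewrite (_ : (fun t => _) = (fun t => logdefect (polar r t)))//.
  by apply/funext => t; rewrite addr0.
have i1 : mu.-integrable D (fun t => logdefect (polar r t)).
  apply/integrableP; split => //.
  have -> : (\int[mu]_(t in D) `|logdefect (polar r t)| = x%:E)%E; last exact: ltry.
  rewrite -Ix; apply: eq_integral => t _.
  by rewrite gee0_abs// logdefect_ge0// polar_circle.
have cc : continuous (fun _ : R => c0) by move=> t; exact: cvg_cst.
have i2 := continuous_integrable_D cc.
under eq_integral => t _ do rewrite logabs_defect.
have := @integralB _ _ _ mu D (measurable_itv _) _ _ i2 i1.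
rewrite Ix /= => ->; have := @integral_cst _ _ _ mu D (measurable_itv _) c0%:E.
by rewrite /= D_measure -EFinM => ->; rewrite -EFinB (mulrC c0).
Qed.

(** The positive part of [logabs] is at most [c0], so its integral is finite and the infinite defect
    must come from the negative part. In this case [Mr] is [0]. *)
Lemma integral_logabs_oo : (\int[mu]_(t in D) logdefect (polar r t) = +oo)%E ->
  (\int[mu]_(t in D) logabs m r t = -oo)%E.
Proof.
move=> Ioo.
have md : measurable_fun D (fun t => logdefect (polar r t)).
  have := @defect_measurable 0; rewrite (_ : (fun t => _) = (fun t => logdefect (polar r t)))//.
  by apply/funext => t; rewrite addr0.
have mc : measurable_fun D (fun=> c0%:E : \bar R) by exact: measurable_cst.
have ml : measurable_fun D (logabs m r).
  rewrite (_ : logabs m r = (fun t => c0%:E - logdefect (polar r t))%E); last first.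
    by apply/funext => t; rewrite logabs_defect.
  exact: emeasurable_funB.
have Ic : (\int[mu]_(t in D) c0%:E = (2 * pi * c0)%:E)%E.
  have := @integral_cst _ _ _ mu D (measurable_itv _) c0%:E.
  by rewrite /= D_measure -EFinM (mulrC _ (2 * pi)).
have pos_le : (\int[mu]_(t in D) (logabs m r)^\+ t <= (2 * pi * c0)%:E)%E.
  rewrite -Ic; apply: ge0_le_integral => //; first exact: measurable_funepos.
  move=> t _; rewrite funeposE ge_max lee_fin c0_ge0 andbT logabs_defect.
  rewrite -[leRHS]sube0; apply: leeB => //.
  by rewrite logdefect_ge0// polar_circle.
have neg_oo : (\int[mu]_(t in D) (logabs m r)^\- t = +oo)%E.
  have : (\int[mu]_(t in D) logdefect (polar r t) <=
      \int[mu]_(t in D) (c0%:E + (logabs m r)^\- t))%E.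
    apply: ge0_le_integral => //.
    - by move=> t _; rewrite logdefect_ge0// polar_circle.
    - by apply: emeasurable_funD => //; exact: measurable_funeneg.
    - move=> t _; rewrite funenegE logabs_defect /logdefect; case: ifP => _ //.
      rewrite -EFinB -EFinN -EFin_max -EFinD lee_fin.
      have : - (c0 - (c0 - ln (normc (m (polar r t))))) <=
        Num.max (- (c0 - (c0 - ln (normc (m (polar r t)))))) 0 by rewrite le_max lexx.
      lra.
  rewrite ge0_integralD//; last exact: measurable_funeneg.
  rewrite Ioo Ic leye_eq => /eqP.
  by case: (integral _ _ _).
rewrite integralE neg_oo.
have : (0 <= \int[mu]_(t in D) (logabs m r)^\+ t)%E by apply: integral_ge0 => t _; exact: funepos_ge0.
by move: pos_le; case: (integral _ _ _).
Qed.

(** If every truncated integral were at least [2 * pi * ln c], so would be their limit, the integral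
    of $\log|m|$, and then [Mr] would be at least [c]. *)
Lemma Mr_lt_trunc (c : R) : 0 < c -> (Mr m r < c%:E)%E -> exists j,
  (\int[mu]_(t in D) (logtrunc m (expR (- j%:R)) (polar r t))%:E < (2 * pi * ln c)%:E)%E.
Proof.
move=> cpos Mc; apply: contrapT => /forallNP no.
have p0 := twopi_gt0 R.
have bnd j : (\int[mu]_(t in D) (logdefect_trunc j (polar r t))%:E <= (2 * pi * c0 - 2 * pi * ln c)%:E)%E.
  rewrite integral_trunc_defect EFinB; apply: leeB => //.
  by rewrite leNgt; apply/negP; exact: no.
have le1 : (\int[mu]_(t in D) logdefect (polar r t) <= (2 * pi * c0 - 2 * pi * ln c)%:E)%E.
  have cv := integral_defect_cvg0; rewrite -(cvg_lim _ cv)//; apply: lime_le; first by apply/cvg_ex; eexists; exact: cv.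
  exact: nearW.
have ge1 : (0 <= \int[mu]_(t in D) logdefect (polar r t))%E.
  by apply: integral_ge0 => t _; rewrite logdefect_ge0// polar_circle.
move: le1 ge1; case E: (integral _ _ _) => [x| |]// le1 _.
move: Mc; rewrite /Mr (integral_logabs_fin E) lte_fin ltNge => /negP; apply.
rewrite -[leLHS](@lnK R) ?posrE// ler_expR ler_pdivlMr//.
by move: le1; rewrite lee_fin mulrC; lra.
Qed.

Lemma ln_prod (I : Type) (s : seq I) (F : I -> R) : (forall i, 0 < F i) ->
  ln (\prod_(i <- s) F i) = \sum_(i <- s) ln (F i).
Proof.
move=> F0; elim: s => [|i s ih]; first by rewrite !big_nil ln1.
by rewrite !big_cons lnM ?posrE ?prodr_gt0// ih.
Qed.

(** The defects at [n] successive rotations sum to [n * c0] minus $\log|m_n|$, hence to at least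
    [n * (c0 - ln rho) - ln K]. By rotation invariance the integral of the sum is [n * W]; the
    constant [ln K] disappears after division by a large [n]. *)
Lemma Mr_le_growth (beta : C) (rho K : R) : normc beta = 1 -> 0 < rho -> 0 < K ->
  (forall n z, normc z = r -> normc (cocycle beta m n z) <= K * rho ^+ n) ->
  (Mr m r <= rho%:E)%E.
Proof.
move=> beta1 rho0 K0 grow; have p0 := twopi_gt0 R.
have [a /andP[a0 _] ba] := unit_cis beta1.
set W := (\int[mu]_(t in D) logdefect (polar r t))%E.
have rot k t : beta ^+ k * polar r t = polar r (t + k%:R * a).
  by rewrite ba cisX polarD.
have ka0 k : 0 <= k%:R * a by exact: mulr_ge0.
have key n : ((2 * pi * (n%:R * (c0 - ln rho) - ln K))%:E <= n%:R%:E * W)%E.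
  have -> : (n%:R%:E * W = \int[mu]_(t in D) \sum_(k < n) logdefect (polar r (t + k%:R * a)))%E.
    rewrite ge0_integral_sum//.
    - rewrite (eq_bigr (fun=> W)); last by move=> k _; rewrite integral_defect_rot.
      by rewrite sumr_const card_ord mule_natl.
    - by move=> k; exact: defect_measurable.
    - by move=> k t _; rewrite logdefect_ge0// polar_circle.
  (* Monotonicity of the integral is used for nonnegative functions, so a nonpositive lower bound is
     treated apart. *)
  have [neg|pos] := leP (n%:R * (c0 - ln rho) - ln K) 0.
    apply: (@le_trans _ _ 0%E); first by rewrite lee_fin; nra.
    apply: integral_ge0 => t _; apply: sume_ge0 => k _.
    by rewrite logdefect_ge0// polar_circle.
  have <- : (\int[mu]_(t in D) (n%:R * (c0 - ln rho) - ln K)%:E =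
    (2 * pi * (n%:R * (c0 - ln rho) - ln K))%:E)%E.
    have := @integral_cst _ _ _ mu D (measurable_itv _) (n%:R * (c0 - ln rho) - ln K)%:E.
    by rewrite /= D_measure -EFinM (mulrC _ (2 * pi)).
  apply: ge0_le_integral => //.
  - by move=> t _; rewrite lee_fin ltW.
  - by apply: emeasurable_sum => k; exact: defect_measurable.
  move=> t _; have ge0 k : (0 <= logdefect (polar r (t + k%:R * a)))%E.
    by rewrite logdefect_ge0// polar_circle.
  have [[k mk]|nz] := pselect (exists k : 'I_n, m (polar r (t + k%:R * a)) = 0).
    rewrite (bigD1 k)//= [X in (X + _)%E]/logdefect mk eqxx addye ?leey//.
    by rewrite gt_eqF// (lt_le_trans (ltNyr 0))// sume_ge0.
  have nz' (k : 'I_n) : m (polar r (t + k%:R * a)) != 0 by apply/eqP => h; apply: nz; exists k.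
  rewrite (eq_bigr (fun k : 'I_n => (c0 - ln (normc (m (polar r (t + k%:R * a)))))%:E)); last first.
    by move=> k _; rewrite /logdefect (negbTE (nz' k)).
  rewrite sumEFin lee_fin sumrB sumr_const card_ord -mulr_natl.
  have -> : \sum_(k < n) ln (normc (m (polar r (t + k%:R * a)))) =
      ln (normc (cocycle beta m n (polar r t))).
    rewrite -ln_prod; last by move=> k; rewrite normc_gt0.
    rewrite /cocycle normc_prod; congr ln; apply: eq_bigr => k _.
    by rewrite rot.
  have cn0 : 0 < normc (cocycle beta m n (polar r t)).
    rewrite normc_gt0; apply/prodf_neq0 => k _.
    by rewrite rot; exact: nz'.
  have : ln (normc (cocycle beta m n (polar r t))) <= ln (K * rho ^+ n).
    by rewrite ler_ln ?posrE ?mulr_gt0 ?exprn_gt0// grow// polar_circle.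
  rewrite lnM ?posrE ?exprn_gt0// lnXn// -[ln rho *+ n]mulr_natl; lra.
have W0 : (0 <= W)%E by apply: integral_ge0 => t _; rewrite logdefect_ge0// polar_circle.
move: key W0; rewrite /W; case E: (integral _ _ _) => [x| |]// key _; last first.
  by rewrite /Mr (integral_logabs_oo E) lee_fin ltW.
rewrite /Mr (integral_logabs_fin E) lee_fin -[leRHS](@lnK R) ?posrE// ler_expR.
rewrite ler_pdivrMr//.
suff : 2 * pi * (c0 - ln rho) <= x by lra.
rewrite leNgt; apply/negP => xlt.
(* [key] says that [n * y <= 2 * pi * ln K] for all [n], which is impossible for [y > 0]. *)
pose y := 2 * pi * (c0 - ln rho) - x; have y0 : 0 < y by rewrite subr_gt0.
pose n := (Num.truncn (2 * pi * ln K / y)).+1.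
have : 2 * pi * ln K < n%:R * y by rewrite -ltr_pdivrMr//; exact: truncnS_gt.
by have := key n; rewrite -EFinM lee_fin /y; lra.
Qed.

End CircleLogs.


(** * Limits at a geometric rate *)

Section GeometricLimits.
Variable R : realType.

(** With [E n] the tail of the geometric series, [s n - E n] increases and [s n + E n] decreases;
    the supremum of the former lies between the two. *)
Lemma real_geometric_limit (s : nat -> R) (A q : R) : 0 <= q < 1 ->
  (forall n, `|s n.+1 - s n| <= A * q ^+ n) ->
  exists l, forall n, `|s n - l| <= A / (1 - q) * q ^+ n.
Proof.
move=> q01 hs; pose E n := A / (1 - q) * q ^+ n.
have ES n : E n - E n.+1 = A * q ^+ n by rewrite /E exprS; field; lra.
have A0 : 0 <= A.
  by have := le_trans (normr_ge0 _) (hs 0%N); rewrite expr0 mulr1.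
have E0 n : 0 <= E n by rewrite /E mulr_ge0 ?divr_ge0 ?exprn_ge0//; lra.
have step n : s n - E n <= s n.+1 - E n.+1 /\ s n.+1 + E n.+1 <= s n + E n.
  by have := hs n; have := ES n; rewrite ler_norml => ? /andP[? ?]; split; lra.
have lo n k : s n - E n <= s (n + k)%N - E (n + k)%N.
  elim: k => [|k ih]; first by rewrite addn0.
  by rewrite addnS; have [h _] := step (n + k)%N; lra.
have hi n k : s (n + k)%N + E (n + k)%N <= s n + E n.
  elim: k => [|k ih]; first by rewrite addn0.
  by rewrite addnS; have [_ h] := step (n + k)%N; lra.
have lohi n k : s n - E n <= s k + E k.
  by have := lo n k; have := hi k n; have := E0 (n + k)%N; rewrite (addnC k); lra.
have ss : has_sup (range (fun n => s n - E n)).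
  by split; [exists (s 0%N - E 0%N), 0%N|exists (s 0%N + E 0%N) => _ [n _ <-]].
exists (sup (range (fun n => s n - E n))) => n; rewrite -/(E n) ler_norml.
have : s n - E n <= sup (range (fun n => s n - E n)).
  by apply: sup_upper_bound => //; exists n.
have : sup (range (fun n => s n - E n)) <= s n + E n.
  by apply: ge_sup; [exists (s 0%N - E 0%N), 0%N|move=> _ [k _ <-]].
by move=> ? ?; apply/andP; split; lra.
Qed.

Lemma geometric_limit (s : nat -> R[i]) (A q : R) : 0 <= q < 1 ->
  (forall n, normc (s n.+1 - s n) <= A * q ^+ n) ->
  exists l, forall n, normc (s n - l) <= 2 * (A / (1 - q)) * q ^+ n.
Proof.
move=> q01 hs.
have [a ha] := @real_geometric_limit (fun n => complex.Re (s n)) A q q01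
  (fun n => ltac:(rewrite -raddfB; exact: le_trans (normc_Re _) (hs n))).
have [b hb] := @real_geometric_limit (fun n => complex.Im (s n)) A q q01
  (fun n => ltac:(rewrite -raddfB; exact: le_trans (normc_Im _) (hs n))).
exists (Complex a b) => n; apply: le_trans (normc_ReIm _) _.
by rewrite !raddfB /=; have := ha n; have := hb n; lra.
Qed.

Lemma geometric_small (x E q : R) : 0 <= q < 1 -> 0 <= E ->
  (forall n, x <= E * q ^+ n) -> x <= 0.
Proof.
move=> q01 E0 h; apply: ler_addgt0P => e e0; rewrite add0r.
have E1 : 0 < E + 1 by lra.
have [N /(_ N (leqnn N)) hN] := expr_small q01 (divr_gt0 e0 E1).
have := h N; rewrite ltr_pdivlMr// in hN.
by have : 0 <= q ^+ N by [apply: exprn_ge0; lra]; lra.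
Qed.

End GeometricLimits.

(** * The Neumann series outside a disc *)

Section NeumannSeries.
Variable R : realType.
Local Notation C := R[i].
Variables (beta : C) (m : C -> C) (c : R).
Hypotheses (beta1 : normc beta = 1) (holm : holD m) (c0 : 0 < c)
  (grow : forall r, 0 < r < 1 -> exists2 K : R, 0 <= K &
     forall n z, normc z <= r -> normc (cocycle beta m n z) <= K * c ^+ n).

Let T (f : C -> C) (z : C) := m z * f (beta * z).

Lemma holD_bounded (g : C -> C) r : holD g -> 0 < r < 1 ->
  exists2 G : R, 0 <= G & forall z, normc z <= r -> normc (g z) <= G.
Proof.
move=> hg hr; pose s := (r + 1) / 2; have hs : r < s < 1 by rewrite /s; lra.
have [M M0 hM] : exists2 M : R, 0 <= M & forall w, normc w = s -> normc (g w) <= M.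
  apply: circle_bounded; first by lra.
  by move=> w ws; apply: holD_cont => //; rewrite /inD ws; lra.
have k0 : 0 <= s / (s - r) by apply: divr_ge0; lra.
exists (s / (s - r) * M) => [|z zr]; first exact: mulr_ge0.
apply: le_trans (maximum_bound hg _ _ hM) _; [lra|lra|].
apply: ler_wpM2r => //; apply: ler_wpM2l; first by lra.
by rewrite lef_pV2 ?posrE; lra.
Qed.

(** Partial sum of $\sum_k\mu^{-k-1}T^kg$. *)
Definition neumann (mu : C) g n z : C :=
  \sum_(k < n) cocycle beta m k z * g (beta ^+ k * z) / mu ^+ k.+1.

Lemma neumannS mu g n z : mu != 0 ->
  mu * neumann mu g n.+1 z - m z * neumann mu g n (beta * z) = g z.
Proof.
move=> mu0; have coc0 : cocycle beta m 0 z = 1 by rewrite /cocycle big_ord0.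
rewrite /neumann big_ord_recl mulrDr /= expr0 !mul1r coc0 mul1r expr1.
rewrite mulrC divfK// -[RHS]addr0 -addrA; congr (_ + _).
apply/eqP; rewrite subr_eq0; apply/eqP; rewrite !mulr_sumr; apply: eq_bigr => k _.
rewrite /bump /= add1n cocycleS (mulrA _ beta z) -exprSr [mu ^+ k.+2]exprS.
by field; rewrite expf_neq0 ?mu0.
Qed.

Lemma holD_neumann mu g n : holD g -> holD (neumann mu g n).
Proof.
move=> hg; apply: holD_sum => k; apply: holD_mul; last exact: holD_cst.
apply: holD_mul; first exact: holD_cocycle.
by apply: holD_rot => //; rewrite normcX beta1 expr1n.
Qed.

(** The relation $f=\mu^{-1}g+\mu^{-1}Tf$ iterated [n] times. It holds for every solution, and so
    yields uniqueness and bounds. *)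
Lemma solution_expansion mu f g n z : mu != 0 ->
  (forall z, inD z -> mu * f z - T f z = g z) -> inD z ->
  f z = neumann mu g n z + cocycle beta m n z * f (beta ^+ n * z) / mu ^+ n.
Proof.
move=> mu0 eqf zD; elim: n => [|n ih].
  by rewrite /neumann /cocycle !big_ord0 !expr0 !mul1r divr1 add0r.
rewrite {1}ih /neumann big_ord_recr /= -addrA; congr (_ + _).
have bD : inD (beta ^+ n * z) by rewrite /inD normc_rot.
have := eqf _ bD; rewrite /T (mulrA beta) -exprS => <-.
have -> : cocycle beta m n.+1 z = cocycle beta m n z * m (beta ^+ n * z).
  by rewrite /cocycle big_ord_recr.
by rewrite [mu ^+ n.+1]exprS; field; rewrite expf_neq0 ?mu0.
Qed.

Variable d : R.
Hypothesis cd : c < d.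

Lemma term_le (K G : R) (mu : C) n (a b : C) : d <= normc mu -> 0 <= K -> 0 <= G ->
  normc a <= K * c ^+ n -> normc b <= G ->
  normc (a * b / mu ^+ n) <= K * G * (c / d) ^+ n.
Proof.
move=> dmu K0 G0 ha hb; have d0 : 0 < d by exact: lt_trans cd.
have mun : d ^+ n <= normc mu ^+ n.
  by apply: lerXn2r => //; rewrite nnegrE ?normc_ge0// ltW.
rewrite !normcM normcV normcX expr_div_n.
have -> : K * G * (c ^+ n / d ^+ n) = K * c ^+ n * G / d ^+ n by ring.
apply: ler_pM.
- by apply: mulr_ge0; exact: normc_ge0.
- by rewrite invr_ge0 exprn_ge0 ?normc_ge0.
- by apply: ler_pM => //; exact: normc_ge0.
- by rewrite lef_pV2 ?posrE// exprn_gt0//; exact: lt_le_trans dmu.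
Qed.

Lemma cd01 : 0 <= c / d < 1.
Proof.
have d0 : 0 < d by exact: lt_trans cd.
by rewrite divr_ge0 ?ltW//= ltr_pdivrMr// mul1r.
Qed.

Lemma neumann_step r (K G : R) mu g : d <= normc mu -> 0 <= K -> 0 <= G ->
  (forall n z, normc z <= r -> normc (cocycle beta m n z) <= K * c ^+ n) ->
  (forall z, normc z <= r -> normc (g z) <= G) ->
  forall n z, normc z <= r ->
  normc (neumann mu g n.+1 z - neumann mu g n z) <= K * G / d * (c / d) ^+ n.
Proof.
move=> dmu K0 G0 hK hG n z zr; have d0 : 0 < d by exact: lt_trans cd.
rewrite /neumann big_ord_recr /= addrAC subrr add0r [mu ^+ n.+1]exprS invfM mulrA mulrAC normcM normcV.
rewrite [K * G / d * _]mulrAC; apply: ler_pM; rewrite ?normc_ge0 ?invr_ge0 ?normc_ge0//.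
  by apply: term_le => //; [exact: hK|apply: hG; rewrite normc_rot].
by rewrite lef_pV2 ?posrE//; exact: lt_le_trans dmu.
Qed.

(** The remainder in [solution_expansion] is at most [K * F * q ^+ n], where only [F] depends on
    [f]; letting [n] grow removes it. The partial sums are bounded by a geometric series of ratio
    [q = c / d], the same for all [mu] with [d <= normc mu]. *)
Lemma solution_bound r : 0 < r < 1 -> exists2 K : R, 0 <= K &
  forall mu f g (G : R), d <= normc mu -> holD f -> 0 <= G ->
  (forall z, inD z -> mu * f z - T f z = g z) ->
  (forall z, normc z <= r -> normc (g z) <= G) ->
  forall z, normc z <= r -> normc (f z) <= K * G.
Proof.
move=> hr; have [K K0 hK] := grow hr; have d0 : 0 < d by exact: lt_trans cd.
have := cd01; set q := c / d => q01.
exists (K / d / (1 - q)) => [|mu f g G dmu hf G0 eqf hG z zr].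
  by apply: divr_ge0; [apply: divr_ge0 => //; exact: ltW|lra].
have mu0 : mu != 0 by rewrite -normc_gt0; exact: lt_le_trans dmu.
have [F F0 hF] := holD_bounded hf hr.
rewrite -subr_le0; apply: (@geometric_small _ _ (K * F) q) => // [|n]; first exact: mulr_ge0.
have zD : inD z by rewrite /inD; lra.
rewrite (solution_expansion n mu0 eqf zD) lerBlDr.
apply: le_trans (normcD _ _) _; rewrite addrC; apply: lerD.
  by apply: term_le => //; [exact: hK|apply: hF; rewrite normc_rot].
have q1 : 0 < 1 - q by lra.
suff : normc (neumann mu g n z) <= K * G / d * ((1 - q ^+ n) / (1 - q)).
  move=> h; apply: le_trans h _.
  have -> : K / d / (1 - q) * G = K * G / d * (1 / (1 - q)) by ring.
  apply: ler_wpM2l; first by apply: divr_ge0; [exact: mulr_ge0|exact: ltW].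
  rewrite ler_pM2r ?invr_gt0//.
  by have : 0 <= q ^+ n by [apply: exprn_ge0; lra]; lra.
elim: n => [|n ih]; first by rewrite /neumann big_ord0 normc0 expr0 subrr mul0r mulr0.
have hs := neumann_step dmu K0 G0 hK hG n zr.
rewrite -[neumann mu g n.+1 z](subrK (neumann mu g n z)).
apply: le_trans (normcD _ _) _; apply: le_trans (lerD hs ih) _.
rewrite -mulrDr -/q le_eqVlt; apply/orP; left; apply/eqP; congr (_ * _).
by rewrite exprS; field; rewrite gt_eqF.
Qed.

Lemma solution_exists mu g : d <= normc mu -> holD g ->
  exists f, holD f /\ forall z, inD z -> mu * f z - T f z = g z.
Proof.
move=> dmu hg; have d0 : 0 < d by exact: lt_trans cd.
have := cd01; set q := c / d => q01.
have mu0 : mu != 0 by rewrite -normc_gt0; exact: lt_le_trans dmu.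
have loc r : 0 < r < 1 -> exists2 E : R, 0 <= E & forall z, normc z <= r ->
    exists l, forall n, normc (neumann mu g n z - l) <= E * q ^+ n.
  move=> hr; have [K K0 hK] := grow hr; have [G G0 hG] := holD_bounded hg hr.
  exists (2 * (K * G / d / (1 - q))).
    by do !(apply: mulr_ge0 => //); rewrite ?invr_ge0; lra.
  move=> z zr; apply: (geometric_limit q01) => n.
  exact: neumann_step dmu K0 G0 hK hG n z zr.
have /choice[f hf] : forall z, exists l, inD z -> exists2 E : R, 0 <= E &
    forall n, normc (neumann mu g n z - l) <= E * q ^+ n.
  move=> z; have [zD|nz] := pselect (inD z); last by exists 0.
  have z0 := normc_ge0 z; rewrite /inD in zD.
  have [E E0 hE] := loc ((normc z + 1) / 2) ltac:(lra).
  by have [l hl] := hE z ltac:(lra); exists l => _; exists E.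
(* The values [f z] were chosen pointwise, with a constant depending on [z]. Uniqueness of limits
   identifies them with the limits from [loc], whose constant is uniform on the disc. *)
have unif r : 0 < r < 1 -> exists2 E : R, 0 <= E & forall n z, normc z <= r ->
    normc (neumann mu g n z - f z) <= E * q ^+ n.
  move=> hr; have [E E0 hE] := loc r hr; exists E => // n z zr.
  have [l hl] := hE z zr; suff -> : f z = l by exact: hl.
  have [E' E'0 hE'] := hf z ltac:(rewrite /inD; lra).
  apply/eqP; rewrite -subr_eq0 -normc_eq0 eq_le normc_ge0 andbT.
  apply: (@geometric_small _ _ (E' + E) q) => // [|k]; first by lra.
  apply: le_trans (normcBD (neumann mu g k z) _ _) _.
  by rewrite normcBC mulrDl lerD.
exists f; split.
  apply: holD_locally_uniform_limit => r e hr e0.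
  have [E E0 hE] := unif r hr; have E1 : 0 < E + 1 by lra.
  have [n /(_ n (leqnn n)) hn] := expr_small q01 (divr_gt0 e0 E1).
  exists (neumann mu g n); first exact: holD_neumann.
  move=> z zr; rewrite normcBC; apply: le_trans (hE n z zr) _.
  rewrite ltr_pdivlMr// in hn.
  by have : 0 <= q ^+ n by [apply: exprn_ge0; lra]; lra.
move=> z zD; have z0 := normc_ge0 z; have zD' := zD; rewrite /inD in zD'.
have [E E0 hE] := unif ((normc z + 1) / 2) ltac:(lra).
have hz := fun n => hE n z ltac:(lra).
have hbz := fun n => hE n (beta * z) ltac:(rewrite normcM beta1 mul1r; lra).
apply/eqP; rewrite -subr_eq0 -normc_eq0 eq_le normc_ge0 andbT.
apply: (@geometric_small _ _ ((normc mu + normc (m z)) * E) q) => // [|n].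
  by rewrite mulr_ge0// addr_ge0// normc_ge0.
rewrite -[g z](@neumannS mu g n)//.
have -> : mu * f z - T f z - (mu * neumann mu g n.+1 z - m z * neumann mu g n (beta * z)) =
  m z * (neumann mu g n (beta * z) - f (beta * z)) - mu * (neumann mu g n.+1 z - f z).
  by rewrite /T; ring.
apply: le_trans (normcB _ _) _; rewrite !normcM addrC -mulrA mulrDl.
apply: lerD; apply: ler_wpM2l; rewrite ?normc_ge0//.
apply: le_trans (hz n.+1) _; apply: ler_wpM2l => //.
by rewrite exprS ler_piMl ?exprn_ge0//; lra.
Qed.

Lemma large_resolvent mu : d <= normc mu -> resolvent_set T mu.
Proof.
move=> dmu; split=> [g|f1 f2 h1 h2 E z zD]; first exact: solution_exists.
have z0 := normc_ge0 z; rewrite /inD in zD.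
have hr : 0 < (normc z + 1) / 2 < 1 by lra.
have [K K0 hK] := solution_bound hr.
have hh : holD (fun z => f1 z - f2 z) by apply: holD_add => //; exact: holD_opp.
have eqh w : inD w -> mu * (f1 w - f2 w) - T (fun z => f1 z - f2 z) w = 0.
  move=> wD; transitivity ((mu * f1 w - T f1 w) - (mu * f2 w - T f2 w)).
    by rewrite /T; ring.
  by rewrite E// subrr.
have h0 w : normc w <= (normc z + 1) / 2 -> normc (0 : C) <= 0 by rewrite normc0.
have := hK mu _ (fun=> 0) 0 dmu hh (lexx 0) eqh h0 z ltac:(lra).
rewrite mulr0 => H; apply/eqP; rewrite -subr_eq0 -normc_eq0 eq_le normc_ge0 andbT.
exact: H.
Qed.

Lemma large_waelbroeck lam : d < normc lam -> waelbroeck_resolvent_set T lam.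
Proof.
move=> dlam; split; first by apply: large_resolvent; exact: ltW.
exists (normc lam - d); first by rewrite subr_gt0.
have far mu : normc (mu - lam) <= normc lam - d -> d <= normc mu.
  by move=> h; have := lerB_normc lam mu; rewrite normcBC; lra.
split=> [mu /far|g hg r hr]; first exact: large_resolvent.
have [K K0 hK] := solution_bound hr; have [G G0 hG] := holD_bounded hg hr.
exists (K * G) => mu /far dmu f hf eqf z zr; exact: hK eqf hG z zr.
Qed.

End NeumannSeries.

(** * Determination of the Waelbroeck resolvent set *)

Section Spectrum.
Variable R : realType.
Local Notation C := R[i].
Variables (beta : C) (m : C -> C) (z0 : C).
Hypotheses (beta1 : normc beta = 1)
  (irr : forall n : nat, (0 < n)%N -> beta ^+ n != 1)
  (holm : holD m) (z0D : inD z0) (mz0 : m z0 = 0).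

Let T (f : C -> C) (z : C) := m z * f (beta * z).

Lemma circle_log_bound r : 0 < r < 1 -> exists2 c0 : R, 0 <= c0 &
  forall w, normc w = r -> normc (m w) <= expR c0.
Proof.
move=> hr; have [G G0 hG] := holD_bounded holm hr; exists G => // w wr.
apply: le_trans (hG w _) _; first by rewrite wr.
by apply: le_trans (expR_ge1Dx G); lra.
Qed.

Lemma holD_circle_cont r w : 0 < r < 1 -> normc w = r -> ccont m w.
Proof. by move=> hr wr; apply: holD_cont => //; rewrite /inD wr; lra. Qed.

(** The equidistribution bound is needed on one circle of radius [s > r] only: exponentials of
    truncated logarithms dominate $|m|$ there, and [maximum_bound] carries the estimate inside. *)
Lemma cocycle_growth (c : R) : 0 < c -> (M1 m < c%:E)%E ->
  forall r, 0 < r < 1 -> exists2 K : R, 0 <= K &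
    forall n z, normc z <= r -> normc (cocycle beta m n z) <= K * c ^+ n.
Proof.
move=> c0 Mc r hr; pose s := (r + 1) / 2; have hs : r < s < 1 by rewrite /s; lra.
have s01 : 0 < s < 1 by lra.
have s0 : 0 < s by lra.
have cs w : normc w = s -> ccont m w by exact: holD_circle_cont.
have [k k0 hk] := circle_log_bound s01.
have Ms : (Mr m s < c%:E)%E.
  apply: le_lt_trans Mc; apply: ereal_sup_ubound; by exists s.
have [j hj] := Mr_lt_trunc s0 cs hk k0 c0 Ms.
have [K hK] := weyl_upper_bound beta1 irr s0
  (logtrunc_uniform s0 cs (expR_gt0 (- j%:R))) hj.
have sr : 0 < s - r by lra.
exists (s / (s - r) * expR K) => [|n z zr].
  by rewrite mulr_ge0 ?expR_ge0// divr_ge0 ?ltW.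
have bd w : normc w = s -> normc (cocycle beta m n w) <= expR K * c ^+ n.
  move=> ws; rewrite /cocycle normc_prod.
  apply: (@le_trans _ _ (\prod_(i < n) expR (logtrunc m (expR (- j%:R)) (beta ^+ i * w)))).
    apply: ler_prod => i _; rewrite normc_ge0/= /logtrunc lnK ?le_max ?lexx//.
    by rewrite posrE lt_max expR_gt0 orbT.
  rewrite -expR_sum; apply: (@le_trans _ _ (expR (K + n%:R * ln c))).
    by rewrite ler_expR; exact: hK.
  by rewrite expRD expRM_natl lnK ?posrE.
have zs : normc z < s by lra.
apply: le_trans (maximum_bound (holD_cocycle beta1 holm n) zs _ bd) _; first by lra.
rewrite -[leRHS]mulrA; apply: ler_wpM2r.
  by rewrite mulr_ge0 ?expR_ge0// exprn_ge0// ltW.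
by apply: ler_wpM2l; [exact: ltW|rewrite lef_pV2 ?posrE; lra].
Qed.

Lemma waelbroeck_resolventP lam :
  waelbroeck_resolvent_set T lam <-> (M1 m < (normc lam)%:E)%E.
Proof.
split=> [res|Ml].
  have lam0 : lam != 0.
    apply/eqP => l0; have [[surj _] _] := res.
    have [f [_ /(_ z0 z0D)]] := surj _ (holD_cst 1).
    rewrite l0 /T mz0 !mul0r subrr => /eqP.
    by rewrite eq_sym oner_eq0.
  have [rho [/andP[rho0 rhol] [B hB]]] := circle_of_solutions beta1 holm irr lam0 res.
  apply: (@le_lt_trans _ _ rho%:E); last by rewrite lte_fin.
  apply: ge_ereal_sup => _ [r /= hr <-]; rewrite in_itv /= in hr.
  have [k k0 hk] := circle_log_bound hr.
  have grow := cocycle_bound beta1 holm z0D mz0 rho0 hB.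
  have r0 : 0 < r by lra.
  have B0 : 0 <= rho * B r.
    have := grow 0%N r 0 hr; rewrite normc0 expr1 => /(_ (ltW r0)).
    by apply: le_trans; exact: normc_ge0.
  apply: (@Mr_le_growth R m r k r0 _ hk k0 beta rho (rho * B r + 1)) => //.
  - by move=> w; exact: holD_circle_cont.
  - by lra.
  - move=> n z zr; apply: le_trans (grow n r z hr _) _; first by rewrite zr.
    have : 0 <= rho ^+ n by apply: exprn_ge0; exact: ltW.
    by rewrite exprS; lra.
(* Any single radius shows this; it excludes [-oo] and makes the [c] below positive. *)
have M0 : (0 <= M1 m)%E.
  apply: (@le_trans _ _ (Mr m 2^-1)).
    by rewrite /Mr; case: (integral _ _ _) => [x| |]//; rewrite lee_fin expR_ge0.
  apply: ereal_sup_ubound; exists 2^-1 => //=.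
  by rewrite in_itv /=; lra.
move: Ml M0; case E: (M1 m) => [x| |]//; rewrite lte_fin lee_fin => xl x0.
(* The points at one and two thirds of the gap give $M_1<c<d<|\lambda|$: growth at rate [c],
   convergence for moduli at least [d], and room for a disc around $\lambda$. *)
pose c := x + (normc lam - x) / 3.
have c0 : 0 < c by rewrite /c; lra.
have Mc : (M1 m < c%:E)%E by rewrite E lte_fin /c; lra.
apply: (@large_waelbroeck R beta m c beta1 holm c0 (cocycle_growth c0 Mc)
  (x + 2 * (normc lam - x) / 3)); rewrite /c; lra.
Qed.

End Spectrum.

Theorem theorem7p5 (R : realType) (beta : R[i]) (m : R[i] -> R[i]) (z0 : R[i]) :
  normc beta = 1 ->
  (forall n : nat, (0 < n)%N -> beta ^+ n != 1) ->
  holD m -> inD z0 -> m z0 = 0 ->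
  let T := fun (f : R[i] -> R[i]) (z : R[i]) => m z * f (beta * z) in
  ((M1 m < +oo)%E ->
     waelbroeck_spectrum T = [set lam | ((normc lam)%:E <= M1 m)%E]) /\
  (M1 m = +oo%E -> waelbroeck_spectrum T = [set: R[i]]).
Proof.
move=> beta1 irr holm z0D mz0 T.
have spectrumE lam : waelbroeck_spectrum T lam <-> ((normc lam)%:E <= M1 m)%E.
  rewrite /waelbroeck_spectrum /= (waelbroeck_resolventP beta1 irr holm z0D mz0).
  by rewrite leNgt; split=> /negP.
split=> [_|Moo]; apply/seteqP; split=> lam //=.
- by move=> /spectrumE.
- by move=> ?; apply/spectrumE.
- by move=> _; apply/spectrumE; rewrite Moo leey.
Qed.
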